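(* Let $n\geq 2$ and $\ell\geq 0$ be integers and let $N=\binom{n+\ell-2}{\ell}$. The action of $B_n$ on $\mathbf{W}_{n,\ell}$ has Zariski-dense image in $\mathrm{PSL}_{N}(\bar{\mathbb{K}})$; that is, the image of $B_n$ under the composition $B_n\to \mathrm{GL}_N(\mathbb{L})\to\mathrm{PGL}_N(\bar{\mathbb{K}})=\mathrm{PSL}_N(\bar{\mathbb{K}})$ is Zariski-dense.
   Context: $B_n$ is the braid group with generators $\sigma_1,\dots,\sigma_{n-1}$ and relations $\sigma_i\sigma_{i+1}\sigma_i=\sigma_{i+1}\sigma_i\sigma_{i+1}$, and $\sigma_i\sigma_j=\sigma_j\sigma_i$ for $|i-j|\ge 2$. Let $\mathbb{L}=\mathbb{Z}[q,q^{-1},s,s^{-1}]$ with $q,s$ two variables, $\mathbb{K}=\mathbb{Q}(q,s)$, and $\bar{\mathbb{K}}$ an algebraic closure of $\mathbb{K}$. Put $[n]_q=\frac{q^n-q^{-n}}{q-q^{-1}}$, $[n]_q!=[n]_q\cdots[1]_q$, ${n\brack k}_q=\frac{[n]_q!}{[k]_q!\,[n-k]_q!}$. Let $\mathbf{V}$ be the free $\mathbb{L}$-module with basis $(v_j)_{j\ge0}$ (with $v_{-1}=0$), and let $K,E$ act on $\mathbf{V}$ by $Kv_j=sq^{-2j}v_j$, $Ev_j=v_{j-1}$. On $\mathbf{V}^{\otimes n}$ (tensor over $\mathbb{L}$), via the coproduct $\Delta(K)=K\otimes K$, $\Delta(E)=E\otimes K+1\otimes E$, the element $E$ acts as $\sum_{i=1}^n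 1^{\otimes(i-1)}\otimes E\otimes K^{\otimes(n-i)}$. Define $R\in\mathrm{End}(\mathbf{V}\otimes\mathbf{V})$ by $$R(v_i \otimes v_j) = s^{-i-j}\sum_{m=0}^{i} q^{2(i-m)(j+m)+\frac{m(m-1)}{2}}{m + j \brack j}_q\prod_{k=0}^{m-1} (sq^{-k-j} - s^{-1}q^{k + j})\,v_{j + m} \otimes v_{i-m}.$$ It is known that $R$ is an automorphism satisfying $(R\otimes1)(1\otimes R)(R\otimes1)=(1\otimes R)(R\otimes1)(1\otimes R)$ and commuting with $E$, so $B_n$ acts on $\mathbf{V}^{\otimes n}$ with $\sigma_i$ acting by $R$ on the $i$-th and $(i+1)$-st tensor factors. $\mathbf{V}_{n,\ell}\le\mathbf{V}^{\otimes n}$ is the $\mathbb{L}$-span of the tensors $v_{a_1}\otimes\cdots\otimes v_{a_n}$ with $a_1+\dots+a_n=\ell$, and $\mathbf{W}_{n,\ell}=\ker(E)\cap\mathbf{V}_{n,\ell}$. The $B_n$-action restricts to $\mathbf{W}_{n,\ell}$, which is known to be a free $\mathbb{L}$-module of rank $N=\binom{n+\ell-2}{\ell}$; choosing a basis yields the homomorphism $B_n\to\mathrm{GL}_N(\mathbb{L})$. *)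

(* Defs.v *)
From HB Require Import structures.
From mathcomp Require Import all_boot all_order all_algebra.
From mathcomp Require Import boolp.
From mathcomp Require Import mpoly.
From mathcomp Require Import finmap monalg.
From mathcomp Require Import ring.

Set Implicit Arguments.
Unset Strict Implicit.
Unset Printing Implicit Defensive.

Import GRing.Theory.
Local Open Scope ring_scope.
Local Open Scope quotient_scope.

(* Q(q, s) is Frac(Q[q][s]): [q] is the inner variable and [s] the outer one. *)
Definition KK : fieldType := {fraction {poly {poly rat}}}.

Definition q : KK := tofrac ('X%:P).
Definition s : KK := tofrac 'X.

(* Z[q, q^-1, s, s^-1], as the subring of K generated by these elements. *)
Inductive laurent : KK -> Prop :=
| laurent_1 : laurent 1
| laurent_B x y : laurent x -> laurent y -> laurent (x - y)
| laurent_M x y : laurent x -> laurent y -> laurent (x * y)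
| laurent_q : laurent q
| laurent_qV : laurent q^-1
| laurent_s : laurent s
| laurent_sV : laurent s^-1.

Definition laurent_pred : {pred KK} := fun x => `[< laurent x >].

Lemma laurentP x : reflect (laurent x) (x \in laurent_pred).
Proof. exact: asboolP. Qed.

Fact laurent_subring : subring_closed laurent_pred.
Proof.
split; first by apply/laurentP/laurent_1.
- by move=> x y /laurentP hx /laurentP hy; apply/laurentP/laurent_B.
- by move=> x y /laurentP hx /laurentP hy; apply/laurentP/laurent_M.
Qed.

HB.instance Definition _ :=
  GRing.isSubringClosed.Build KK laurent_pred laurent_subring.

Record LL : predArgType :=
  LaurentPoly { LLval : KK; LLvalP : LLval \in laurent_pred }.

HB.instance Definition _ := [isSub for LLval].
HB.instance Definition _ := [Choice of LL by <:].
HB.instance Definition _ := [SubChoice_isSubComNzRing of LL by <:].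

Definition LL_unit : pred LL :=
  fun x => (val x != 0) && ((val x)^-1 \in laurent_pred).

Definition LL_inv (x : LL) : LL := insubd x (val x)^-1.

Fact LL_mulVr : {in LL_unit, left_inverse 1 LL_inv *%R}.
Proof.
move=> x /andP[x0 xV]; apply: val_inj.
by rewrite rmorphM rmorph1 /= /LL_inv insubdK // mulVf.
Qed.

Fact LL_unitPl (x y : LL) : y * x = 1 -> LL_unit x.
Proof.
move=> /(congr1 val); rewrite rmorphM rmorph1 /= => yx1.
have x0 : val x != 0.
  by apply/eqP => x0; move/eqP: yx1; rewrite x0 mulr0 eq_sym oner_eq0.
rewrite /LL_unit x0 /=.
suff -> : (val x)^-1 = val y by exact: valP.
by apply: (mulIf x0); rewrite mulVf.
Qed.

Fact LL_invr_out : {in [predC LL_unit], LL_inv =1 id}.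
Proof.
move=> x; rewrite inE /= /LL_unit negb_and negbK => /orP[/eqP x0|xV].
  by apply: val_inj; rewrite /LL_inv x0 invr0 -x0 valKd.
by apply: val_inj; rewrite /LL_inv val_insubd (negbTE xV).
Qed.

HB.instance Definition _ :=
  GRing.ComNzRing_hasMulInverse.Build LL LL_mulVr LL_unitPl LL_invr_out.

Definition qL : LL := Sub q (introT (laurentP _) laurent_q).
Definition sL : LL := Sub s (introT (laurentP _) laurent_s).

Definition qint (n : nat) : KK := (q ^+ n - q ^- n) / (q - q^-1).
Definition qfact (n : nat) : KK := \prod_(1 <= i < n.+1) qint i.
Definition qbinom (n k : nat) : KK := qfact n / (qfact k * qfact (n - k)).

Lemma q_neq0 : q != 0.
Proof. by rewrite /q tofrac_eq0 polyC_eq0 polyX_eq0. Qed.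

Lemma qn_neq1 n : (0 < n)%N -> q ^+ n != 1.
Proof.
move=> n0; rewrite /q -tofracXn -tofrac1 tofrac_eq -rmorphXn /=.
rewrite -[1]/(1%:P) (inj_eq (@polyC_inj _)).
apply/eqP => /(congr1 (fun p : {poly rat} => size p)).
by rewrite size_polyXn size_poly1 => -[] /eqP; rewrite -leqn0 leqNgt n0.
Qed.

Lemma qsub_neq0 n : (0 < n)%N -> q ^+ n - q ^- n != 0.
Proof.
move=> n0; rewrite subr_eq0; apply/eqP => h.
have := @qn_neq1 (n + n) _; rewrite addn_gt0 n0 => /(_ isT) /eqP; apply.
by rewrite exprD {1}h mulVf // expf_neq0 // q_neq0.
Qed.

Lemma qint_neq0 n : (0 < n)%N -> qint n != 0.
Proof.
move=> n0; rewrite /qint mulf_neq0 ?invr_neq0 ?qsub_neq0 //.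
exact: (@qsub_neq0 1).
Qed.

Lemma qfactS n : qfact n.+1 = qfact n * qint n.+1.
Proof. by rewrite /qfact big_nat_recr. Qed.

Lemma qfact_neq0 n : qfact n != 0.
Proof.
elim: n => [|n IH]; first by rewrite /qfact big_geq // oner_eq0.
by rewrite qfactS; apply: mulf_neq0 IH _; exact: qint_neq0.
Qed.

Lemma qintD a b : qint (a + b) = q ^+ b * qint a + q ^- a * qint b.
Proof.
rewrite /qint !mulrA -mulrDl; congr (_ * _).
have qa0 : q ^+ a != 0 by rewrite expf_neq0 // q_neq0.
rewrite !mulrBr exprD invfM -!exprVn.
by rewrite [q ^+ b * q ^+ a]mulrC addrA [q ^+ b * _]mulrC addrNK.
Qed.

Lemma pascal_aux (F : fieldType) (t z w x y u v : F) :
  x != 0 -> y != 0 -> z != 0 -> w != 0 ->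
  t * (u * x + v * y) / (z * y * (w * x)) =
  u * (t / (z * y * w)) + v * (t / (z * (w * x))).
Proof. by move=> x0 y0 z0 w0; field; rewrite x0 y0 z0 w0. Qed.

Lemma qbinomS n k : (k < n)%N ->
  qbinom n.+1 k.+1 = q ^+ k.+1 * qbinom n k.+1 + q ^- (n - k) * qbinom n k.
Proof.
move=> kn; have [d dE] : {d | d = (n - k.+1)%N} by exists (n - k.+1)%N.
have nkE : (n - k = d.+1)%N by rewrite dE subnSK.
have nE : (n.+1 = d.+1 + k.+1)%N by rewrite -nkE addnS subnK // ltnW.
rewrite /qbinom subSS nkE -dE (qfactS n) (qfactS k) (qfactS d) nE qintD.
apply: pascal_aux.
- exact: qint_neq0.
- exact: qint_neq0.
- exact: qfact_neq0.
- exact: qfact_neq0.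
Qed.

Lemma qbinom_laurent n k : (k <= n)%N -> qbinom n k \in laurent_pred.
Proof.
have qbn0 m : qbinom m 0 = 1.
  by rewrite /qbinom subn0 {2}/qfact big_geq // mul1r mulfV // qfact_neq0.
have qbnn m : qbinom m m = 1.
  rewrite /qbinom subnn {3}/qfact big_geq // mulr1 mulfV //; exact: qfact_neq0.
elim: n k => [|n IH] [|k] //; rewrite ?qbn0 ?rpred1 //.
rewrite ltnS leq_eqVlt => /orP[/eqP ->|kn]; first by rewrite qbnn rpred1.
rewrite qbinomS // rpredD // rpredM ?IH // 1?ltnW //.
  by rewrite rpredX //; apply/laurentP/laurent_q.
by rewrite -exprVn rpredX //; apply/laurentP/laurent_qV.
Qed.

Definition qbinomL (m j : nat) : LL :=
  Sub (qbinom (m + j) j) (qbinom_laurent (leq_addl m j)).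

(* The free L-module on the set of multi-indices a = (a_0, ..., a_{n-1}): the
   basis vector <<a>> is the pure tensor v_(a_0) ⊗ ... ⊗ v_(a_{n-1}). *)
Definition Vtens (n : nat) : lmodType LL := {malg LL[{ffun 'I_n -> nat}]}.

Definition vtens (n : nat) (a : {ffun 'I_n -> nat}) : Vtens n := << a >>.

Definition lin_ext (n : nat) (f : {ffun 'I_n -> nat} -> Vtens n) (x : Vtens n) :
    Vtens n :=
  \sum_(a <- msupp x) mcoeff a x *: f a.

(* K v_j = Kwt j *: v_j *)
Definition Kwt (j : nat) : LL := sL * qL ^ (- (2 * j)%:Z).

(* The i-th summand 1 ⊗ ... ⊗ 1 ⊗ E ⊗ K ⊗ ... ⊗ K of E, with E in position i. *)
Definition Eterm (n : nat) (i : 'I_n) (a : {ffun 'I_n -> nat}) : Vtens n :=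
  if a i == 0%N then 0
  else (\prod_(j < n | (i < j)%N) Kwt (a j)) *:
         vtens [ffun j => if j == i then (a i).-1 else a j].

Definition Eop (n : nat) : Vtens n -> Vtens n :=
  lin_ext (fun a => \sum_(i < n) Eterm i a).

(* The coefficient of v_(j+m) ⊗ v_(i-m) in R (v_i ⊗ v_j), for m <= i. *)
Definition Rcoef (i j m : nat) : LL :=
  sL ^ (- (i + j)%:Z)
  * qL ^+ (2 * (i - m) * (j + m) + (m * (m - 1)) %/ 2)%N
  * qbinomL m j
  * \prod_(0 <= k < m) (sL * qL ^ (- (k + j)%:Z) - sL^-1 * qL ^+ (k + j)).

Lemma ord_pred_succ (n : nat) (i : 'I_n.-1) : (i.+1 < n)%N.
Proof. by case: n i => [|n] [i] //=. Qed.

(* The i-th generator, i = 0, ..., n - 2, acts on the factors i and i + 1. *)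
Definition pos1 (n : nat) (i : 'I_n.-1) : 'I_n := Ordinal (ltnW (ord_pred_succ i)).
Definition pos2 (n : nat) (i : 'I_n.-1) : 'I_n := Ordinal (ord_pred_succ i).

Definition Rop (n : nat) (i : 'I_n.-1) : Vtens n -> Vtens n :=
  lin_ext (fun a : {ffun 'I_n -> nat} =>
    \sum_(0 <= m < (a (pos1 i)).+1)
      Rcoef (a (pos1 i)) (a (pos2 i)) m *:
        vtens [ffun k => if k == pos1 i then (a (pos2 i) + m)%N
                         else if k == pos2 i then (a (pos1 i) - m)%N
                         else a k]).

Definition Vweight (n l : nat) (x : Vtens n) : Prop :=
  forall a : {ffun 'I_n -> nat}, a \in msupp x -> (\sum_(i < n) a i)%N = l.

Definition Wspace (n l : nat) (x : Vtens n) : Prop :=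
  Eop x = 0 /\ Vweight l x.

Definition is_basis_of (V : lmodType LL) (W : V -> Prop) (N : nat)
    (b : 'I_N -> V) : Prop :=
  (forall j, W (b j)) /\
  (forall x, W x -> exists! c : 'rV[LL]_N, x = \sum_j c 0 j *: b j).

(* A word in the generators and their inverses: (i, false) is the i-th
   generator, (i, true) its inverse. *)
Definition braid_word (n : nat) := seq ('I_n.-1 * bool).

Definition gen_word (n : nat) (i : 'I_n.-1) : braid_word n := [:: (i, false)].

Inductive braid_step (n : nat) : braid_word n -> braid_word n -> Prop :=
| braid_cancel (i : 'I_n.-1) (e : bool) :
    braid_step [:: (i, e); (i, ~~ e)] [::]
| braid_yb (i j : 'I_n.-1) : j = i.+1 :> nat ->
    braid_step (gen_word i ++ gen_word j ++ gen_word i)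
               (gen_word j ++ gen_word i ++ gen_word j)
| braid_far (i j : 'I_n.-1) : (i.+2 <= j)%N ->
    braid_step (gen_word i ++ gen_word j) (gen_word j ++ gen_word i).

Inductive braid_cong (n : nat) : braid_word n -> braid_word n -> Prop :=
| braid_ctx u v x y : braid_step x y -> braid_cong (u ++ x ++ v) (u ++ y ++ v)
| braid_refl x : braid_cong x x
| braid_sym x y : braid_cong x y -> braid_cong y x
| braid_trans x y z : braid_cong x y -> braid_cong y z -> braid_cong x z.

Definition braid_congb (n : nat) : rel (braid_word n) :=
  fun x y => `[< braid_cong x y >].

Fact braid_congb_equiv (n : nat) : equiv_class_of (@braid_congb n).
Proof.
split.
- by move=> x; apply/asboolP/braid_refl.
- by move=> x y; apply/asboolP/asboolP; apply: braid_sym.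
- move=> y x z /asboolP xy /asboolP yz; apply/asboolP; exact: braid_trans yz.
Qed.

Canonical braid_equiv (n : nat) := EquivRelPack (braid_congb_equiv n).

Definition braid (n : nat) := {eq_quot (braid_equiv n)}.
HB.instance Definition _ (n : nat) := Choice.on (braid n).

Definition braid_of_word (n : nat) (x : braid_word n) : braid n := \pi x.

Section BraidGroup.
Variable n : nat.
Implicit Types (x y z : braid_word n) (g h : braid n).

Lemma braid_eq x y : braid_of_word x = braid_of_word y <-> braid_cong x y.
Proof.
split; first by move/eqmodP/asboolP.
by move=> h; apply/eqmodP/asboolP.
Qed.

Lemma braid_reprK g : braid_of_word (repr g) = g.
Proof. exact: reprK. Qed.

Lemma braid_repr x : braid_cong (repr (braid_of_word x)) x.
Proof. by apply/braid_eq; rewrite braid_reprK. Qed.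

Lemma braid_cong_ctx u v x y :
  braid_cong x y -> braid_cong (u ++ x ++ v) (u ++ y ++ v).
Proof.
elim=> {x y} [u' v' x y h|x|x y _|x y z _ h1 _ h2].
- by have := braid_ctx (u ++ u') (v' ++ v) h; rewrite !catA -!catA.
- exact: braid_refl.
- exact: braid_sym.
- exact: braid_trans h2.
Qed.

Lemma braid_cong_cat x x' y y' :
  braid_cong x x' -> braid_cong y y' -> braid_cong (x ++ y) (x' ++ y').
Proof.
move=> hx hy; apply: (@braid_trans _ _ (x' ++ y)).
  exact: (@braid_cong_ctx [::] y).
by have := @braid_cong_ctx x' [::] _ _ hy; rewrite !cats0.
Qed.

Definition inv_word x : braid_word n := rev [seq (a.1, ~~ a.2) | a <- x].

Lemma inv_word_cat x y : inv_word (x ++ y) = inv_word y ++ inv_word x.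
Proof. by rewrite /inv_word map_cat rev_cat. Qed.

Lemma inv_wordK x : inv_word (inv_word x) = x.
Proof.
rewrite /inv_word map_rev revK -map_comp -[RHS]map_id.
by apply: eq_map => -[i e] /=; rewrite negbK.
Qed.

Lemma word_mulV x : braid_cong (x ++ inv_word x) [::].
Proof.
elim: x => [|[i e] x IH]; first exact: braid_refl.
rewrite -cat1s inv_word_cat.
apply: (@braid_trans _ _ ([:: (i, e)] ++ [::] ++ inv_word [:: (i, e)])).
  by rewrite catA -!catA (catA x); apply: braid_cong_ctx.
exact: (braid_ctx [::] [::] (braid_cancel i e)).
Qed.

Lemma word_mulVl x : braid_cong (inv_word x ++ x) [::].
Proof. by have := word_mulV (inv_word x); rewrite inv_wordK. Qed.

Lemma inv_word_cong x y : braid_cong x y -> braid_cong (inv_word x) (inv_word y).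
Proof.
move=> h; apply: (@braid_trans _ _ (inv_word x ++ (y ++ inv_word y))).
  rewrite -{1}[inv_word x]cats0; apply: braid_cong_cat (braid_refl _) _.
  exact/braid_sym/word_mulV.
rewrite catA -[X in braid_cong _ X]cat0s.
apply: braid_cong_cat (braid_refl _).
apply: braid_trans (word_mulVl x).
exact: braid_cong_cat (braid_refl _) (braid_sym h).
Qed.

Definition braid_one : braid n := braid_of_word [::].
Definition braid_mul g h : braid n := braid_of_word (repr g ++ repr h).
Definition braid_inv g : braid n := braid_of_word (inv_word (repr g)).

Fact braid_mulA : associative braid_mul.
Proof.
move=> g h k; apply/braid_eq.
apply: (@braid_trans _ _ (repr g ++ repr h ++ repr k)).
  exact: braid_cong_cat (braid_refl _) (braid_repr _).
rewrite catA; apply: braid_cong_cat (braid_refl _).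
exact/braid_sym/braid_repr.
Qed.

Fact braid_mul1 : left_id braid_one braid_mul.
Proof.
move=> g; rewrite -[RHS]braid_reprK; apply/braid_eq.
exact: (braid_cong_cat (braid_repr [::]) (braid_refl _)).
Qed.

Fact braid_mulr1 : right_id braid_one braid_mul.
Proof.
move=> g; rewrite -[RHS]braid_reprK; apply/braid_eq.
rewrite -[X in braid_cong _ X]cats0.
exact: (braid_cong_cat (braid_refl _) (braid_repr [::])).
Qed.

Fact braid_mulV : left_inverse braid_one braid_inv braid_mul.
Proof.
move=> g; apply/braid_eq; apply: braid_trans (word_mulVl (repr g)).
exact: braid_cong_cat (braid_repr _) (braid_refl _).
Qed.

Fact braid_mulrV : right_inverse braid_one braid_inv braid_mul.
Proof.
move=> g; apply/braid_eq; apply: braid_trans (word_mulV (repr g)).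
exact: braid_cong_cat (braid_refl _) (braid_repr _).
Qed.

HB.instance Definition _ := isGroup.Build (braid n)
  braid_mulA braid_mul1 braid_mulr1 braid_mulV braid_mulrV.

End BraidGroup.

Definition sigma (n : nat) (i : 'I_n.-1) : braid n := braid_of_word (gen_word i).

Record GL (R : comUnitRingType) (N : nat) : predArgType :=
  GLElt { GLmat : 'M[R]_N; GLmatP : GLmat \in unitmx }.

HB.instance Definition _ R N := [isSub for @GLmat R N].
HB.instance Definition _ R N := [Choice of GL R N by <:].

Section GLGroup.
Variables (R : comUnitRingType) (N : nat).
Implicit Types A B : GL R N.

Fact GL_mul_proof A B : val A *m val B \in unitmx.
Proof. by rewrite unitmx_mul (valP A) (valP B). Qed.
Fact GL_inv_proof A : invmx (val A) \in unitmx.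
Proof. by rewrite unitmx_inv (valP A). Qed.

Definition GL_one : GL R N := GLElt (unitmx1 R N).
Definition GL_mul A B : GL R N := GLElt (GL_mul_proof A B).
Definition GL_inv A : GL R N := GLElt (GL_inv_proof A).

Fact GL_mulA : associative GL_mul.
Proof. by move=> A B C; apply: val_inj; rewrite /= mulmxA. Qed.
Fact GL_mul1 : left_id GL_one GL_mul.
Proof. by move=> A; apply: val_inj; rewrite /= mul1mx. Qed.
Fact GL_mulr1 : right_id GL_one GL_mul.
Proof. by move=> A; apply: val_inj; rewrite /= mulmx1. Qed.
Fact GL_mulV : left_inverse GL_one GL_inv GL_mul.
Proof. by move=> A; apply: val_inj; rewrite /= mulVmx // (valP A). Qed.
Fact GL_mulrV : right_inverse GL_one GL_inv GL_mul.
Proof. by move=> A; apply: val_inj; rewrite /= mulmxV // (valP A). Qed.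

HB.instance Definition _ := isGroup.Build (GL R N)
  GL_mulA GL_mul1 GL_mulr1 GL_mulV GL_mulrV.
End GLGroup.

Fact GL_map_proof (R S : comUnitRingType) (f : {rmorphism R -> S}) N (A : GL R N) :
  map_mx f (val A) \in unitmx.
Proof.
by rewrite unitmxE det_map_mx rmorph_unit // -unitmxE; apply: (valP A).
Qed.

Definition GL_map (R S : comUnitRingType) (f : {rmorphism R -> S}) (N : nat)
  (A : GL R N) : GL S N := GLElt (GL_map_proof f A).

Definition scal_eqb (F : fieldType) (N : nat) : rel (GL F N) :=
  fun A B => `[< exists2 c : F, c != 0 & val A = c *: val B >].

Fact scal_eqb_equiv (F : fieldType) (N : nat) : equiv_class_of (@scal_eqb F N).
Proof.
have sym (A B : GL F N) : scal_eqb A B -> scal_eqb B A.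
  move=> /asboolP[c c0 h]; apply/asboolP; exists c^-1; rewrite ?invr_neq0 //.
  by rewrite h scalerA mulVf // scale1r.
split.
- by move=> A; apply/asboolP; exists 1; rewrite ?oner_eq0 // scale1r.
- by move=> A B; apply/idP/idP; apply: sym.
- move=> B A C /asboolP[c c0 h] /asboolP[d d0 h']; apply/asboolP.
  by exists (c * d); rewrite ?mulf_neq0 // h h' scalerA.
Qed.

Canonical scal_equiv (F : fieldType) (N : nat) :=
  EquivRelPack (scal_eqb_equiv F N).

(* PGL_N(F) = GL_N(F) / F^*, which for F algebraically closed is PSL_N(F). *)
Definition PGL (F : fieldType) (N : nat) := {eq_quot (scal_equiv F N)}.

Definition to_PGL (F : fieldType) (N : nat) (A : GL F N) : PGL F N := \pi A.

Definition mx_eval (F : fieldType) (N : nat) (p : mpoly.mpoly (N * N) F)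
    (A : 'M[F]_N) : F :=
  mpoly.meval (fun k => mxvec A 0 k) p.

(* PGL_N is the principal open subset det <> 0 of the projective space P(M_N),
   so a closed subset is the zero locus of a set of homogeneous polynomials in
   the N^2 matrix entries. *)
Definition zariski_closed (F : fieldType) (N : nat) (Z : PGL F N -> Prop) : Prop :=
  exists S : mpoly.mpoly (N * N) F -> Prop,
    (forall p, S p -> exists d : nat, p \is d.-homog) /\
    (forall A : GL F N,
       Z (to_PGL A) <-> (forall p, S p -> mx_eval p (val A) = 0)).

Definition zariski_dense (F : fieldType) (N : nat) (X : PGL F N -> Prop) : Prop :=
  forall Z, zariski_closed Z -> (forall x, X x -> Z x) -> forall x, Z x.

(* Main.v *)
Require Import Defs.
From HB Require Import structures.
From mathcomp Require Import all_boot all_order all_algebra.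
From mathcomp Require Import mxtens boolp.
From mathcomp Require Import mpoly.
From mathcomp Require Import ring zify.

Set Implicit Arguments.
Unset Strict Implicit.
Unset Printing Implicit Defensive.

Import GRing.Theory.
Local Open Scope ring_scope.

(** Let Gam be the image of the braid group in GL_N over the closed field.

A homogeneous polynomial of degree d in the entries of a matrix X is a linear
form in the tensor power of X of order d ([homog_mx_evalE]).  Hence Gam is dense
once, for every d, the tensor powers of its elements span all tensor powers
([homog_vanish]).  Their span is an algebra, and the matrices X whose
derivation [tder d X], the sum of the d copies of X acting on one factor each,
lies in it form a Lie algebra.  By Newton's identities the tensor power of X is
a polynomial in the derivations of the powers of X, so it is enough that this
Lie algebra is gl_N ([tspan_tpow_of_tder]).

A generator of the braid group acts diagonalizably, with eigenvalues
lam_k = (- s^-2)^k q^(k (k - 1)) for k = 0, ..., l, the last of which is simple.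
A product of d eigenvalues determines the sum of the k and the sum of the
k (k - 1).  So, if T multiplies the k-th eigenspace by a combination of k and
k (k - 1), then the derivation of T is a polynomial in the tensor power of the
generator, and T belongs to the Lie algebra.  For a good combination, ad T
isolates the column and the row of the top eigenvector in every element of the
Lie algebra.  These are matrices of rank one; if the top eigenvector and its
dual coordinate are cyclic, there are enough of them to generate gl_N
([lie_all], [tspan_full]).

Two facts on the representation remain.  The spectrum comes from the
commutation of R with E on two factors ([E2_R2]): an element of the kernel of E
of weight m is determined by one coefficient, R multiplies it by lam_m, and an
induction on the weight gives the rest ([opprod_kill], [opprod_top]).

Cyclicity amounts to the nonvanishing of a determinant in the Laurent
polynomials, whose entries pair the top eigenvector with the top coordinate
through positive braid words.  This may be checked at q = 1, s = 2.  There the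
action is the symmetric power of order l of the Burau representation, and the
pairing is a multiple of the l-th power of the Burau invariant form
([word_pairing]).  The orbit of one root under the Burau reflections, which have
infinite order, is Zariski dense ([closure_all]), and the l-th powers of linear
forms span the forms of degree l; so some words, N on each side, give a nonzero
determinant, N being the number of monomials of degree l in n - 1 variables
([gram_words]). *)

(** * Tensor powers of a matrix *)

Section Tensmx.
Variables (R : comPzRingType) (m n p r : nat).

Lemma tensmxDl (A B : 'M[R]_(m, n)) (C : 'M[R]_(p, r)) :
  (A + B) *t C = A *t C + B *t C.
Proof. by apply/matrixP=> i j; rewrite !mxE mulrDl. Qed.

Lemma tensmxDr (A B : 'M[R]_(m, n)) (C : 'M[R]_(p, r)) :
  C *t (A + B) = C *t A + C *t B.
Proof. by apply/matrixP=> i j; rewrite !mxE mulrDr. Qed.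

Lemma tensmxZl a (A : 'M[R]_(m, n)) (C : 'M[R]_(p, r)) :
  (a *: A) *t C = a *: (A *t C).
Proof. by apply/matrixP=> i j; rewrite !mxE mulrA. Qed.

Lemma tensmxZr a (A : 'M[R]_(m, n)) (C : 'M[R]_(p, r)) :
  C *t (a *: A) = a *: (C *t A).
Proof. by apply/matrixP=> i j; rewrite !mxE mulrCA. Qed.

End Tensmx.

Lemma tens_mx1 (R : comPzRingType) m n : (1%:M : 'M[R]_m) *t (1%:M : 'M[R]_n) =
  1%:M.
Proof.
apply/matrixP=> i j.
case: (mxtens_indexP i) => i1 i2; case: (mxtens_indexP j) => j1 j2.
rewrite tensmxE !mxE (can_eq (@mxtens_indexK _ _)) xpair_eqE.
by rewrite -natrM mulnb.
Qed.

Lemma addr_cross (V : zmodType) (a b c d e e' : V) :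
  a - b + (c - d) = (a + e + (e' + c)) - (b + e' + (e + d)).
Proof.
rewrite (addrC e' c) (addrACA a e) (addrC e d) (addrACA b) (addrC e' e).
by rewrite (opprD (b + d)) (addrACA (a + c)) subrr addr0 opprD addrACA.
Qed.

Section TensorPower.
Variables (F : fieldType) (N : nat).
Implicit Types X Y : 'M[F]_N.

Fixpoint tdim (d : nat) : nat := if d is d'.+1 then (N * tdim d')%N else 1%N.

Fixpoint tpow d X : 'M[F]_(tdim d) :=
  if d is d'.+1 return 'M[F]_(tdim d) then X *t tpow d' X else 1%:M.

(** The action of gl_N on the tensor power: the derivative of [tpow d] at the
    identity. *)
Fixpoint tder d X : 'M[F]_(tdim d) :=
  if d is d'.+1 return 'M[F]_(tdim d) then X *t 1%:M + 1%:M *t tder d' X else 0.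

Lemma tpow1 d : tpow d 1%:M = 1%:M.
Proof. by elim: d => //= d ->; rewrite tens_mx1. Qed.

Lemma tpowM d X Y : tpow d (X *m Y) = tpow d X *m tpow d Y.
Proof. by elim: d => [|d IH] /=; rewrite ?mulmx1 // tensmx_mul IH. Qed.

Lemma tderD d X Y : tder d (X + Y) = tder d X + tder d Y.
Proof.
elim: d => [|d IH] /=; first by rewrite addr0.
by rewrite IH tensmxDl tensmxDr addrACA.
Qed.

Lemma tderZ d a X : tder d (a *: X) = a *: tder d X.
Proof.
elim: d => [|d IH] /=; first by rewrite scaler0.
by rewrite IH tensmxZl tensmxZr scalerDr.
Qed.

Lemma tder1 d : tder d 1%:M = d%:R%:M.
Proof.
elim: d => [|d IH] /=; first by rewrite raddf0.
rewrite IH tens_mx1 -[d%:R]mulr1 -scale_scalar_mx tensmxZr tens_mx1.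
by rewrite scale_scalar_mx mulr1 -raddfD /= -mulrS.
Qed.

Lemma tder_bracket d X Y :
  tder d (X *m Y - Y *m X) = tder d X *m tder d Y - tder d Y *m tder d X.
Proof.
elim: d => [|d IH] /=; first by rewrite mul0mx subrr.
rewrite IH -scaleN1r tensmxDl tensmxZl -[X in 1%:M *t (_ - X)]scale1r -scaleNr.
rewrite tensmxDr tensmxZr !scaleN1r.
rewrite !mulmxDl !mulmxDr !tensmx_mul !mulmx1 !mul1mx.
exact: addr_cross.
Qed.

Lemma tder_conj d P X Y : P *m Y = 1%:M ->
  tder d (P *m X *m Y) = tpow d P *m tder d X *m tpow d Y.
Proof.
move=> PY; elim: d => [|d IH] /=; first by rewrite mulmx0 mul0mx.
rewrite IH mulmxDr mulmxDl !tensmx_mul !mulmx1 PY.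
by rewrite -tpowM PY tpow1.
Qed.

(** The k-th elementary symmetric function of the d commuting copies of X,
    i.e. the coefficient of t^k in the tensor power of 1 + t X. *)
Fixpoint tesym (d k : nat) X : 'M[F]_(tdim d) :=
  match d return 'M[F]_(tdim d) with
  | d'.+1 => 1%:M *t tesym d' k X + (if k is k'.+1 then X *t tesym d' k' X else 0)
  | 0 => (k == 0%N)%:R%:M
  end.

Lemma tesym0 d X : tesym d 0 X = 1%:M.
Proof. by elim: d => //= d ->; rewrite addr0 tens_mx1. Qed.

Lemma tesym_gt d k X : (d < k)%N -> tesym d k X = 0.
Proof.
elim: d k => [|d IH] [|k] //=; first by rewrite raddf0.
rewrite ltnS => dk.
by rewrite !IH // ?tensmx0 ?addr0 // ltnW.
Qed.

Lemma tesym_top d X : tesym d d X = tpow d X.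
Proof.
elim: d => [|d IH] //=.
by rewrite IH tesym_gt // tensmx0 add0r.
Qed.

Fixpoint mxpow X j : 'M[F]_N := if j is j'.+1 then X *m mxpow X j' else 1%:M.

(** Newton's identity; the power sums of the d copies of X are the derivations
    of the powers of X.  In the induction on d the terms with X^(j+1) on the first
    factor telescope. *)
Lemma tesym_newton d k X :
  k.+1%:R *: tesym d k.+1 X =
  \sum_(j < k.+1) (-1) ^+ j *: (tesym d (k - j)%N X *m tder d (mxpow X j.+1)).
Proof.
elim: d k => [|d IH] k /=.
  rewrite raddf0 scaler0 big1 // => j _; by rewrite mulmx0 scaler0.
rewrite scalerDr.
rewrite -tensmxZr IH.
have step (j : 'I_k.+1) : (-1) ^+ j *: ((1%:M *t tesym d (k - j)%N X +
      match (k - j)%N with 0 => 0 | k'.+1 => X *t tesym d k' X end) *m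
     ((X *m mxpow X j) *t 1%:M + 1%:M *t tder d (X *m mxpow X j))) =
  1%:M *t ((-1) ^+ j *: (tesym d (k - j)%N X *m tder d (mxpow X j.+1))) +
  ((-1) ^+ j *: (mxpow X j.+1 *t tesym d (k - j)%N X)
   - (-1) ^+ j.+1 *: (if (k - j)%N is k'.+1 then mxpow X j.+2 *t tesym d k' X else
     0))
  + (if (k - j)%N is k'.+1 then
     X *t ((-1) ^+ j *: (tesym d k' X *m tder d (mxpow X j.+1))) else 0).
  rewrite exprS mulN1r scaleNr opprK -scalerDr.
  case: (k - j)%N => [|k'] /=; rewrite !(mulmxDl, mulmxDr, mul0mx, tensmx_mul,
    mulmx1, mul1mx) ?addr0
   ?scaler0 ?addr0 !scalerDr !tensmxZr -?addrA; first by rewrite addrC.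
  by rewrite addrCA.
under [RHS]eq_bigr => j _ do rewrite step.
rewrite !big_split /= -addrA; congr (_ + _).
  by rewrite (big_morph _ (fun a b => tensmxDr a b _) (tensmx0 _)).
have -> : \sum_(i < k.+1) (-1) ^+ i *: (mxpow X i.+1 *t tesym d (k - i)%N X)
 + \sum_(i < k.+1) - ((-1) ^+ i.+1 *: match (k - i)%N with 0 => 0 | k'.+1 => 
       mxpow X i.+2 *t tesym d k' X end) = X *t tesym d k X.
  rewrite big_ord_recl big_ord_recr /= subnn scaler0 subr0 subn0 expr0 scale1r
    mulmx1.
  rewrite -addrA -big_split big1 ?addr0 //= => i _.
  by rewrite -(subnSK (ltn_ord i)) subrr.
rewrite big_ord_recr /= subnn addr0.
case: k IH step => [|k] IH step.
  by rewrite big_ord0 addr0 scale1r.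
rewrite mulrS scalerDl scale1r -tensmxZr IH; congr (_ + _).
rewrite (big_morph _ (fun a b => tensmxDr a b _) (tensmx0 _)).
apply: eq_bigr => j _ /=; by rewrite subSn // -ltnS.
Qed.

(** With [monomial_seq] and [mxvec_prod], a monomial of degree d is an entry of
    the tensor power. *)
Lemma tpow_prod (s : seq ('I_N * 'I_N)) :
  exists I J, forall X, tpow (size s) X I J = \prod_(a <- s) X a.1 a.2.
Proof.
elim: s => [|[i j] s [I [J IH]]] /=.
  by exists ord0, ord0 => X; rewrite big_nil mxE.
exists (mxtens_index (i, I)), (mxtens_index (j, J)) => X.
by rewrite big_cons tensmxE IH.
Qed.

End TensorPower.

(** * Spans of tensor powers and homogeneous polynomials *)

Section TensorSpan.
Variables (F : fieldType) (N : nat) (Gam : 'M[F]_N -> Prop).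
Hypothesis Gam1 : Gam 1%:M.
Hypothesis GamM : forall X Y, Gam X -> Gam Y -> Gam (X *m Y).
Hypothesis char0 : forall k, k.+1%:R != 0 :> F.

Inductive tspan (d : nat) : 'M[F]_(tdim N d) -> Prop :=
| tspan0 : tspan 0
| tspanD A B : tspan A -> tspan B -> tspan (A + B)
| tspanZ a A : tspan A -> tspan (a *: A)
| tspan_tpow X : Gam X -> tspan (tpow d X).

Variable d : nat.
Implicit Types A B : 'M[F]_(tdim N d).

Lemma tspanB A B : tspan A -> tspan B -> tspan (A - B).
Proof. by move=> hA hB; rewrite -scaleN1r; apply/tspanD/tspanZ. Qed.

Lemma tspanM A B : tspan A -> tspan B -> tspan (A *m B).
Proof.
move=> hA hB; elim: hA => [|A1 A2 _ h1 _ h2|a A' _ h|X hX].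
- by rewrite mul0mx; apply: tspan0.
- by rewrite mulmxDl; apply: tspanD.
- by rewrite -scalemxAl; apply: tspanZ.
elim: hB => [|A1 A2 _ h1 _ h2|a A' _ h|Y hY].
- by rewrite mulmx0; apply: tspan0.
- by rewrite mulmxDr; apply: tspanD.
- by rewrite -scalemxAr; apply: tspanZ.
by rewrite -tpowM; apply/tspan_tpow/GamM.
Qed.

(** The tensor power of X is its last elementary symmetric function, which
    [tesym_newton] produces from derivations; this divides by k + 1, whence the
    characteristic zero. *)
Lemma tspan_tpow_of_tder :
  (forall X, tspan (tder d X)) -> forall X, tspan (tpow d X).
Proof.
move=> hder X; rewrite -tesym_top.
suff H k j : (j <= k)%N -> tspan (tesym d j X) by exact: (H d).
elim: k j => [|k IH] j.
  by rewrite leqn0 => /eqP ->; rewrite tesym0 -(tpow1 F N); apply: tspan_tpow.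
rewrite leq_eqVlt => /orP[/eqP ->|]; last exact: IH.
rewrite -[tesym _ _ _]scale1r -(mulVf (char0 k)) -scalerA tesym_newton.
apply: tspanZ; elim/big_ind: _ => [|A B|i _]; first exact: tspan0.
  exact: tspanD.
by apply/tspanZ/tspanM => //; apply: IH; rewrite leq_subr.
Qed.

Lemma mxvec_prod (ks : seq 'I_(N * N)) : exists2 ps : seq ('I_N * 'I_N),
  size ps = size ks &
  forall X : 'M[F]_N, \prod_(k <- ks) mxvec X 0 k = \prod_(a <- ps) X a.1 a.2.
Proof.
elim: ks => [|k ks [ps sz IH]]; first by exists [::] => // X; rewrite !big_nil.
case/mxvec_indexP: k => i j; exists ((i, j) :: ps); first by rewrite /= sz.
by move=> X; rewrite !big_cons mxvecE IH.
Qed.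

Lemma monomial_seq (m : 'X_{1..N * N}) : exists2 ks : seq 'I_(N * N),
  size ks = mdeg m &
  forall v : 'I_(N * N) -> F, \prod_i v i ^+ m i = \prod_(k <- ks) v k.
Proof.
exists (flatten [seq nseq (m k) k | k <- index_enum 'I_(N * N)]).
  rewrite size_flatten sumnE !big_map mdegE.
  by apply: eq_bigr => i _; rewrite size_nseq.
move=> v; rewrite big_flatten /= big_map.
apply: eq_bigr => i _; rewrite big_nseq.
by elim: (m i) => [|k IH] //=; rewrite exprS IH.
Qed.

Lemma homog_mx_evalE (p : {mpoly F[N * N]}) : p \is d.-homog ->
  exists2 L : 'M[F]_(tdim N d) -> F,
    (forall a A B, L (a *: A + B) = a * L A + L B) &
    forall X, mx_eval p X = L (tpow d X).
Proof.
move/dhomogP=> hp.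
suff [L Llin LE] : exists2 L : 'M[F]_(tdim N d) -> F,
    (forall a A B, L (a *: A + B) = a * L A + L B) &
    forall X, \sum_(m <- msupp p) p@_m * \prod_i mxvec X 0 i ^+ m i = L (tpow d X).
  by exists L => // X; rewrite -LE /mx_eval mevalE.
elim: (msupp p : seq _) hp => [|m s IH] hs.
  by exists (fun => 0) => [a A B|X]; rewrite ?big_nil ?mulr0 ?addr0.
have [|L Llin LE] := IH; first by move=> m' m's; apply: hs; rewrite inE m's orbT.
have [ks szk hk] := monomial_seq m; have [ps szp hpX] := mxvec_prod ks.
have [I [J hIJ]] := tpow_prod F ps.
have sz : size ps = d by rewrite szp szk; apply: hs; rewrite inE eqxx.
move: I J hIJ; rewrite sz => I J hIJ.
exists (fun A => p@_m * A I J + L A) => [a A B|X].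
  by rewrite Llin !mxE; ring.
by rewrite big_cons LE hk hpX hIJ.
Qed.

Lemma homog_vanish (p : {mpoly F[N * N]}) X :
  p \is d.-homog -> (forall Y, Gam Y -> mx_eval p Y = 0) ->
  tspan (tpow d X) -> mx_eval p X = 0.
Proof.
move/homog_mx_evalE => [L Llin LE] hG; rewrite LE.
have L0 : L 0 = 0.
  have := Llin 1 0 0; rewrite scale1r addr0 mul1r => /eqP.
  by rewrite -subr_eq subrr eq_sym => /eqP.
elim=> [|A B _ hA _ hB|a A _ hA|Y hY] //.
- by rewrite -[A]scale1r Llin hA hB mulr0 addr0.
- by rewrite -[_ *: _]addr0 Llin hA L0 mulr0 addr0.
- by rewrite -LE hG.
Qed.

End TensorSpan.

Section Interpolation.
Variable F : fieldType.

Lemma interpolation (s : seq F) (h : F -> F) :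
  exists p : {poly F}, forall x, x \in s -> p.[x] = h x.
Proof.
elim: s => [|x s [p hp]]; first by exists 0.
have [xs|xs] := boolP (x \in s).
  by exists p => y; rewrite inE => /orP[/eqP ->|]; apply: hp.
pose w := \prod_(y <- s) ('X - y%:P).
have wE y : (w.[y] == 0) = (y \in s).
  by rewrite -[_ == 0]/(root w y) root_prod_XsubC.
exists (p + ((h x - p.[x]) / w.[x]) *: w) => y; rewrite inE hornerD hornerZ.
move=> /orP[/eqP ->|ys]; first by rewrite divfK ?wE // addrC subrK.
by move: (ys); rewrite -wE => /eqP ->; rewrite mulr0 addr0 hp.
Qed.

(** A function of i that factors through r i is a polynomial in r i, the index
    set being finite. *)
Lemma interpolation_fun (I : finType) (r r' : I -> F) :
  (forall i j, r i = r j -> r' i = r' j) ->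
  exists p : {poly F}, forall i, p.[r i] = r' i.
Proof.
move=> rr'.
have [p hp] := interpolation [seq r i | i <- enum I]
  (fun x => if [pick i | r i == x] is Some i then r' i else 0).
exists p => i; rewrite hp ?map_f ?mem_enum //.
by case: pickP => [j /eqP/rr' //|/(_ i)]; rewrite eqxx.
Qed.

(** The entries of [diag_mx r'] are the values at those of [diag_mx r] of one
    polynomial, so [diag_mx r'] belongs to the algebra generated by [diag_mx r]. *)
Lemma diag_interpolation n (A : 'M[F]_n -> Prop) (r r' : 'rV[F]_n) :
  (forall X Y, A X -> A Y -> A (X + Y)) -> (forall a X, A X -> A (a *: X)) ->
  (forall X Y, A X -> A Y -> A (X *m Y)) -> A 1%:M -> A (diag_mx r) ->
  (forall i j, r 0 i = r 0 j -> r' 0 i = r' 0 j) -> A (diag_mx r').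
Proof.
move=> AD AZ AM A1 Ar /(@interpolation_fun _ (r 0) (r' 0)) [p hp].
have -> : r' = \row_i p.[r 0 i] by apply/rowP=> i; rewrite mxE hp.
elim/poly_ind: p {hp} => [|p c IH].
  have -> : \row_i 0.[r 0 i] = 0 :> 'rV[F]_n by apply/rowP=> i;
    rewrite !mxE horner0.
  by rewrite raddf0 -(scale0r 1%:M); apply: AZ.
have -> : \row_i (p * 'X + c%:P).[r 0 i] = \row_i (p.[r 0 i] * r 0 i) + const_mx c.
  by apply/rowP=> i; rewrite !mxE !hornerE.
rewrite raddfD /=; apply: AD; last by rewrite diag_const_mx -scalemx1; apply: AZ.
have -> : diag_mx (\row_i (p.[r 0 i] * r 0 i)) = diag_mx (\row_i p.[r 0 i]) *m
  diag_mx r.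
  by rewrite mulmx_diag; congr diag_mx; apply/rowP=> i; rewrite !mxE.
exact: AM.
Qed.

End Interpolation.

(** * A Lie algebra containing a diagonal matrix with a simple top eigenvalue *)

(** The coefficient of k exceeds every sum of two terms k (k - 1) with k <= l, so
    that in an equality of sums of two weights the two parts can be compared
    separately. *)
Definition lie_weight (l k : nat) : nat := (k * (k - 1) + (2 * l * l).+1 * k)%N.

Lemma lie_weight_inj l j k : (j <= l)%N -> (k <= l)%N -> lie_weight l j =
  lie_weight l k -> j = k.
Proof. rewrite /lie_weight => jl kl; nia. Qed.

(** The pairs {k, b} and {a, l} have the same sum and the same sum of squares, so
    they are equal. *)
Lemma lie_weight_gap l a b k : (a <= l)%N -> (b <= l)%N -> (k < l)%N ->
  (lie_weight l k + lie_weight l b = lie_weight l a + lie_weight l l)%N -> (b = l)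
    /\ (a < l)%N.
Proof.
rewrite /lie_weight; move M_def: (2 * l * l).+1 => M al bl kl H.
have sq j : (j <= l)%N -> (j * (j - 1) <= l * l)%N.
  by move=> jl; rewrite leq_mul // (leq_trans _ jl) // leq_subr.
have lt1 : (k * (k - 1) + b * (b - 1) < M)%N.
  by have := sq _ bl; have := sq _ (ltnW kl); lia.
have lt2 : (a * (a - 1) + l * (l - 1) < M)%N.
  by have := sq _ al; have := sq _ (leqnn l); lia.
have {}H : ((k + b) * M + (k * (k - 1) + b * (b - 1)) =
            (a + l) * M + (a * (a - 1) + l * (l - 1)))%N.
  by rewrite !mulnDl ![(_ * M)%N]mulnC; lia.
have E1 : (k + b = a + l)%N.
  have := congr1 (fun x => x %/ M)%N H.
  by rewrite !divnMDl ?divn_small ?addn0 // -M_def.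
have E2 : (k * (k - 1) + b * (b - 1) = a * (a - 1) + l * (l - 1))%N.
  by move: H; rewrite E1 => /addnI.
clear -E1 E2 al bl kl.
have [x lE] : exists x, l = (k + x)%N by exists (l - k)%N; lia.
have bE : b = (a + x)%N by lia.
subst l b.
have sqr j : (j * (j - 1) + j = j * j)%N by case: j => // j; rewrite subn1 -mulnSr.
have x0 : (0 < x)%N by lia.
have ak : (a * x = k * x)%N.
  move: (sqr k) (sqr a) (sqr (a + x)%N) (sqr (k + x)%N) E2.
  by rewrite !(mulnDl _ _ (_ + _)) !mulnDr ![(x * _)%N]mulnC; lia.
by move/eqP: ak; rewrite eqn_pmul2r // => /eqP ->.
Qed.

Section LieAlgebra.
Variables (F : fieldType) (N : nat) (Gam : 'M[F]_N -> Prop).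
Hypothesis Gam1 : Gam 1%:M.
Hypothesis GamM : forall X Y, Gam X -> Gam Y -> Gam (X *m Y).
Hypothesis GamV : forall X, Gam X -> exists2 Y, Gam Y & X *m Y = 1%:M /\ Y *m X =
  1%:M.
Hypothesis char0 : forall k, k.+1%:R != 0 :> F.
Variables (u v : F) (kap : 'I_N -> nat) (l : nat) (i0 : 'I_N).
Hypothesis uv_indep : forall a b a' b',
  u ^+ a * v ^+ b = u ^+ a' * v ^+ b' -> a = a' /\ b = b'.
Hypothesis kap_le : forall i, (kap i <= l)%N.
Hypothesis kap_i0 : kap i0 = l.
Hypothesis kap_top : forall i, kap i = l -> i = i0.

Let S : 'M[F]_N := diag_mx (\row_i (u ^+ kap i * v ^+ (kap i * (kap i - 1)))).
Hypothesis GamS : Gam S.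

Definition is_subspace m n (P : 'M[F]_(m, n) -> Prop) :=
  [/\ P 0, forall x y, P x -> P y -> P (x + y) & forall a x, P x -> P (a *: x)].

Hypothesis cyclic_col : forall P : 'cV[F]_N -> Prop, is_subspace P ->
  P (delta_mx i0 0) ->
  (forall X Y, Gam X -> Gam Y -> X *m Y = 1%:M -> forall x, P x -> P (X *m S *m Y
    *m x)) ->
  forall x, P x.
Hypothesis cyclic_row : forall P : 'rV[F]_N -> Prop, is_subspace P ->
  P (delta_mx 0 i0) ->
  (forall X Y, Gam X -> Gam Y -> X *m Y = 1%:M -> forall x, P x -> P (x *m (X *m S
    *m Y))) ->
  forall x, P x.

(* T has the same eigenspaces as S. *)
Let T : 'M[F]_N := diag_mx (\row_i (lie_weight l (kap i))%:R).

Lemma natr_inj : injective (fun n => n%:R : F).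
Proof.
move=> m n; wlog mn : m n / (m <= n)%N => [H|] E.
  by case/orP: (leq_total m n) => ?; [apply: H | symmetry; apply: H].
apply/eqP; rewrite eqn_leq mn /= leqNgt; apply/negP => nm.
have := char0 (n - m).-1; rewrite prednK ?subn_gt0 // natrB // E subrr eqxx //.
Qed.

Variable d : nat.
(* The Lie algebra of the group, as seen in degree d. *)
Let lie X := tspan Gam (tder d X).

Lemma lie0 : lie 0.
Proof. by rewrite /lie -(scale0r (0 : 'M_N)) tderZ scale0r; apply: tspan0. Qed.

Lemma lieD X Y : lie X -> lie Y -> lie (X + Y).
Proof. by rewrite /lie tderD; apply: tspanD. Qed.

Lemma lieZ a X : lie X -> lie (a *: X).
Proof. by rewrite /lie tderZ; apply: tspanZ. Qed.

Lemma lieB X Y : lie X -> lie Y -> lie (X - Y).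
Proof. by move=> hX hY; rewrite -scaleN1r; apply/lieD/lieZ. Qed.

Lemma lie_bracket X Y : lie X -> lie Y -> lie (X *m Y - Y *m X).
Proof.
by move=> hX hY; rewrite /lie tder_bracket; apply: tspanB; apply: tspanM.
Qed.

Lemma tspan1 : tspan Gam (1%:M : 'M_(tdim N d)).
Proof. by rewrite -tpow1; apply: tspan_tpow. Qed.

Lemma lie1 : lie 1%:M.
Proof. by rewrite /lie tder1 -scalemx1; apply/tspanZ/tspan1. Qed.

Lemma lie_conj X Y Z : Gam X -> Gam Y -> X *m Y = 1%:M -> lie Z -> lie (X *m Z *m
  Y).
Proof.
move=> hX hY XY hZ; rewrite /lie tder_conj //.
by apply: tspanM => //; first apply: tspanM => //; apply: tspan_tpow.
Qed.

(** The tensor power of S and the derivation of T are diagonal, and both entries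
    at I are functions of the same two integers, which add up along the tensor
    factors. *)
Lemma tpow_diag_weights e : exists a b : 'I_(tdim N e) -> nat,
  tpow e S = diag_mx (\row_I (u ^+ a I * v ^+ b I)) /\
  tder e T = diag_mx (\row_I (b I + (2 * l * l).+1 * a I)%:R).
Proof.
elim: e => [|e [a [b [hS hT]]]] /=.
  exists (fun=> 0%N), (fun=> 0%N); split; apply/matrixP=> i j;
    rewrite !mxE ?mulr1 //.
  by rewrite muln0 mul0rn.
exists (fun I => kap (mxtens_unindex I).1 + a (mxtens_unindex I).2)%N.
exists (fun I => kap (mxtens_unindex I).1 * (kap (mxtens_unindex I).1 - 1)
                 + b (mxtens_unindex I).2)%N.
rewrite hS hT; split; apply/matrixP=> I J.
  case: (mxtens_indexP I) => i1 i2; case: (mxtens_indexP J) => j1 j2.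
  rewrite tensmxE !mxE !mxtens_indexK /= (can_eq (@mxtens_indexK _ _)) xpair_eqE.
  case: eqP => _; case: eqP => _; rewrite /= ?mulr0n ?mulr1n ?mulr0 ?mul0r //.
  by rewrite !exprD mulrACA.
rewrite mxE; case: (mxtens_indexP I) => i1 i2; case: (mxtens_indexP J) => j1 j2.
rewrite !tensmxE !mxE !mxtens_indexK /= (can_eq (@mxtens_indexK _ _)) xpair_eqE.
case: eqP => _; case: eqP => _; rewrite /= ?mulr0n ?mulr1n ?mulr0 ?mul0r ?mulr1
  ?mul1r ?addr0 //.
by rewrite /lie_weight -natrD mulnDr addnACA.
Qed.

(** As u and v are multiplicatively independent, an entry of the tensor power of
    S determines the two integers of [tpow_diag_weights], hence the entry of the
    derivation of T. *)
Lemma lieT : lie T.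
Proof.
have [a [b [hS hT]]] := tpow_diag_weights d.
rewrite /lie hT; apply: (@diag_interpolation _ _ _ (\row_I (u ^+ a I * v ^+ b I))).
- exact: tspanD.
- exact: tspanZ.
- exact: tspanM.
- exact: tspan1.
- by rewrite -hS; apply: tspan_tpow.
by move=> I J; rewrite !mxE => /uv_indep [-> ->].
Qed.

(** The bracket with T multiplies the entry (i, j) by the difference of the
    weights of i and j; so a polynomial in ad T acts entrywise. *)
Lemma lie_hadamard (p : {poly F}) X : lie X ->
  lie (\matrix_(i, j) (p.[(lie_weight l (kap i))%:R - (lie_weight l (kap j))%:R] *
    X i j)).
Proof.
move=> hX; elim/poly_ind: p => [|p c IH].
  rewrite (_ : \matrix_(i, j) _ = 0); first exact: lie0.
  by apply/matrixP=> i j; rewrite !mxE horner0 mul0r.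
have := lieD (lie_bracket lieT IH) (lieZ c hX); congr lie.
apply/matrixP=> i j; rewrite mul_diag_mx mul_mx_diag !mxE !hornerE /=.
by move: (_%:R) (lie_weight l (kap j))%:R => x y; ring.
Qed.

Let E : 'M[F]_N := delta_mx i0 i0.
(* Locked, so that distributivity does not expand it in products. *)
Let C : 'M[F]_N := locked (1%:M - E).
Lemma compl_projE : C = 1%:M - E. Proof. by rewrite /C -lock. Qed.

Lemma lie_select (P : 'I_N -> 'I_N -> bool) X :
  (forall i j i' j', P i j ->
    (lie_weight l (kap i) + lie_weight l (kap j') = lie_weight l (kap i') +
      lie_weight l (kap j))%N ->
    P i' j') ->
  lie X -> lie (\matrix_(i, j) ((P i j)%:R * X i j)).
Proof.
move=> hP hX.
have [|p hp] := @interpolation_fun F ('I_N * 'I_N)%type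
  (fun z => (lie_weight l (kap z.1))%:R - (lie_weight l (kap z.2))%:R) (fun z => (P
    z.1 z.2)%:R).
  have eqn a b a' b' : a%:R - b%:R = a'%:R - b'%:R :> F -> (a + b' = a' + b)%N.
    move=> /eqP; rewrite subr_eq addrAC eq_sym subr_eq -!natrD => /eqP/natr_inj ->;
      lia.
  case=> [i j] [i' j'] /= H; congr (nat_of_bool _)%:R.
  by apply/idP/idP => Pij; apply: hP Pij _; apply: eqn.
have := lie_hadamard p hX; congr lie.
by apply/matrixP=> i j; rewrite !mxE -(hp (i, j)).
Qed.

Lemma proj_mulmxE n (X : 'M[F]_(N, n)) i j : (E *m X) i j = (i == i0)%:R * X i j.
Proof.
rewrite !mxE (bigD1 i0) //= big1 => [|k /negPf k0];
  last by rewrite !mxE k0 andbF mul0r.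
by rewrite !mxE eqxx andbT addr0; case: eqP => [->|_]; rewrite ?mul0r.
Qed.

Lemma mulmx_projE n (X : 'M[F]_(n, N)) i j : (X *m E) i j = (j == i0)%:R * X i j.
Proof.
rewrite !mxE (bigD1 i0) //= big1 => [|k /negPf k0]; last by rewrite !mxE k0 mulr0.
by rewrite !mxE eqxx addr0 mulrC; case: eqP => [->|_]; rewrite ?mul0r.
Qed.

Lemma compl_mulmxE n (X : 'M[F]_(N, n)) i j : (C *m X) i j = (i != i0)%:R * X i j.
Proof.
rewrite compl_projE mulmxBl mul1mx mxE [X in _ + X]mxE proj_mulmxE.
by case: eqP => _; rewrite ?mul0r ?mul1r ?subrr ?subr0.
Qed.

Lemma mulmx_complE n (X : 'M[F]_(n, N)) i j : (X *m C) i j = (j != i0)%:R * X i j.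
Proof.
rewrite compl_projE mulmxBr mulmx1 mxE [X in _ + X]mxE mulmx_projE.
by case: eqP => _; rewrite ?mul0r ?mul1r ?subrr ?subr0.
Qed.

Lemma kap_lt i : i != i0 -> (kap i < l)%N.
Proof. by rewrite ltn_neqAle kap_le andbT; apply: contra => /eqP/kap_top ->. Qed.

(** By [lie_weight_gap] the nonzero differences of weights in the column of the top
    eigenvector occur nowhere else. *)
Lemma lie_col X : lie X -> lie (C *m X *m E).
Proof.
move=> hX; have := @lie_select (fun i j => (i != i0) && (j == i0)) X _ hX.
have -> : \matrix_(i, j) (((i != i0) && (j == i0))%:R * X i j) = C *m X *m E.
  by apply/matrixP=> i j; rewrite mulmx_projE compl_mulmxE !mxE mulrA mulrC -natrM
    mulnb andbC mulrC.
apply=> i j i' j' /andP[/kap_lt hi /eqP ->]; rewrite kap_i0.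
move=> /(lie_weight_gap (kap_le _) (kap_le _) hi) [/kap_top -> hi'].
by rewrite eqxx andbT; apply/eqP => i'0; move: hi'; rewrite i'0 kap_i0 ltnn.
Qed.

Lemma lie_row X : lie X -> lie (E *m X *m C).
Proof.
move=> hX; have := @lie_select (fun i j => (j != i0) && (i == i0)) X _ hX.
have -> : \matrix_(i, j) (((j != i0) && (i == i0))%:R * X i j) = E *m X *m C.
  by apply/matrixP=> i j; rewrite mulmx_complE proj_mulmxE !mxE mulrA mulrC -natrM
    mulnb andbC mulrC.
apply=> i j i' j' /andP[/kap_lt hi /eqP ->]; rewrite kap_i0 addnC [RHS]addnC.
move=> H; have [] := @lie_weight_gap l (kap j') (kap i') (kap j) (kap_le _) (kap_le
  _) hi.
  by rewrite -H addnC.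
move=> /kap_top -> hj'.
by rewrite eqxx andbT; apply/eqP => j'0; move: hj'; rewrite j'0 kap_i0 ltnn.
Qed.

Let e : 'cV[F]_N := delta_mx i0 0.
Let f : 'rV[F]_N := delta_mx 0 i0.

Lemma proj_rank1 : E = e *m f. Proof. by rewrite mul_delta_mx. Qed.
Lemma proj_pairing : f *m e = 1%:M.
Proof. by rewrite mul_delta_mx; apply/matrixP=> i j; rewrite !ord1 !mxE. Qed.
Lemma compl_idem : C *m C = C.
Proof.
by rewrite compl_projE mulmxBl mul1mx [E *m _]mulmxBr mulmx1 mul_delta_mx subrr
  subr0.
Qed.
Lemma compl_vec : C *m e = 0.
Proof. by apply/matrixP=> i j; rewrite compl_mulmxE !mxE; case: (i == i0);
  rewrite /= ?mulr0 ?mul0r. Qed.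
Lemma covec_compl : f *m C = 0.
Proof. by apply/matrixP=> i j; rewrite mulmx_complE !mxE; case: (j == i0);
  rewrite ?andbF /= ?mulr0 ?mul0r. Qed.

Let Pc (x : 'cV[F]_N) := lie (C *m x *m f).
Let Pr (y : 'rV[F]_N) := lie (e *m y *m C).

Lemma Pc_closed : is_subspace Pc.
Proof.
rewrite /Pc; split=> [|x y|a x].
- by rewrite mulmx0 mul0mx; apply: lie0.
- by rewrite mulmxDr mulmxDl; apply: lieD.
- by rewrite -scalemxAr -scalemxAl; apply: lieZ.
Qed.

Lemma Pr_closed : is_subspace Pr.
Proof.
rewrite /Pr; split=> [|x y|a x].
- by rewrite mulmx0 mul0mx; apply: lie0.
- by rewrite mulmxDr mulmxDl; apply: lieD.
- by rewrite -scalemxAr -scalemxAl; apply: lieZ.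
Qed.

(** Put x0 = C x.  Applied to the top basis vector e, the bracket of X with the
    rank one matrix x0 f gives X x0 up to a multiple of x0; [lie_col] keeps this
    part, and the remaining component of x along e is dealt with by [lie_col X]. *)
Lemma Pc_stable X x : lie X -> Pc x -> Pc (X *m x).
Proof.
move=> hX; rewrite /Pc => hx.
have /lie_col := lie_bracket hX hx.
have /lie_col := hX.
rewrite !proj_rank1.
have [a aE] : exists a, f *m X *m e = a%:M by exists ((f *m X *m e) 0 0);
  apply: mx11_scalar.
have [b bE] : exists b, f *m x = b%:M by exists ((f *m x) 0 0); apply: mx11_scalar.
move=> h1 h2.
have -> : C *m (X *m x) *m f = C *m (X *m (C *m x *m f) - C *m x *m f *m X) *m (e
  *m f)
   + a *: (C *m x *m f) + b *: (C *m X *m (e *m f)).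
  rewrite mulmxBr mulmxBl !mulmxA compl_idem.
  rewrite -[C *m X *m C *m x *m f *m e]mulmxA proj_pairing mulmx1.
  have -> : C *m x *m f *m X *m e = a *: (C *m x).
    by rewrite -!mulmxA [f *m _]mulmxA aE mulmxA mul_mx_scalar.
  rewrite -scalemxAl subrK.
  rewrite {3}compl_projE proj_rank1.
  rewrite mulmxBr mulmx1 !mulmxBl.
  have -> : C *m X *m (e *m f) *m x = b *: (C *m X *m e).
    by rewrite -!mulmxA bE mul_mx_scalar -!scalemxAr.
  by rewrite -scalemxAl subrK.
by apply: lieD; [apply: lieD => // | ]; apply: lieZ.
Qed.

(** The transpose of the argument for [Pc_stable]. *)
Lemma Pr_stable X y : lie X -> Pr y -> Pr (y *m X).
Proof.
move=> hX; rewrite /Pr => hy.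
have /lie_row := lie_bracket hy hX.
have /lie_row := hX.
rewrite !proj_rank1.
have [a aE] : exists a, f *m X *m e = a%:M by exists ((f *m X *m e) 0 0);
  apply: mx11_scalar.
have [b bE] : exists b, y *m e = b%:M by exists ((y *m e) 0 0); apply: mx11_scalar.
move=> h1 h2.
have -> : e *m (y *m X) *m C = e *m f *m (e *m y *m C *m X - X *m (e *m y *m C)) *m
  C
   + a *: (e *m y *m C) + b *: (e *m f *m X *m C).
  rewrite mulmxBr mulmxBl.
  have -> : e *m f *m (e *m y *m C *m X) *m C = e *m y *m C *m X *m C.
    by rewrite -!mulmxA [f *m (e *m _)]mulmxA proj_pairing mul1mx.
  have -> : e *m f *m (X *m (e *m y *m C)) *m C = a *: (e *m y *m C).
    rewrite -!mulmxA compl_idem !mulmxA.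
    by rewrite -2![in LHS](mulmxA e) aE mul_mx_scalar -!scalemxAl.
  rewrite subrK.
  rewrite {2}compl_projE proj_rank1.
  rewrite mulmxBr mulmx1 !mulmxBl !mulmxA.
  have -> : e *m y *m e *m f *m X *m C = b *: (e *m f *m X *m C).
    by rewrite -(mulmxA e) bE mul_mx_scalar -!scalemxAl.
  by rewrite subrK.
by apply: lieD; [apply: lieD => // | ]; apply: lieZ.
Qed.

(** The weight of k determines k, so S is a polynomial in T. *)
Lemma S_of_T (A : 'M[F]_N -> Prop) :
  (forall X Y, A X -> A Y -> A (X + Y)) -> (forall a X, A X -> A (a *: X)) ->
  (forall X Y, A X -> A Y -> A (X *m Y)) -> A 1%:M -> A T -> A S.
Proof.
move=> AD AZ AM A1 AT; apply: diag_interpolation AT _ => // i j.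
by rewrite !mxE => /natr_inj /(lie_weight_inj (kap_le _) (kap_le _)) ->.
Qed.

Lemma Pc_all x : Pc x.
Proof.
apply: cyclic_col x; first exact: Pc_closed.
  by rewrite /Pc compl_vec mul0mx; apply: lie0.
move=> X Y hX hY XY x hx.
have [Z _ [XZ ZX]] := GamV hX.
have YE : Y = Z by rewrite -[LHS]mul1mx -ZX -mulmxA XY mulmx1.
have YX : Y *m X = 1%:M by rewrite YE.
have [P0 PD PZ] := Pc_closed.
move: x hx; apply: (@S_of_T (fun B => forall x, Pc x -> Pc (X *m B *m Y *m x))).
- by move=> B B' hB hB' x hx; rewrite mulmxDr !mulmxDl; apply: PD; auto.
- by move=> a B hB x hx; rewrite -scalemxAr -!scalemxAl; apply: PZ; auto.
- move=> B B' hB hB' x hx.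
  have -> : X *m (B *m B') *m Y *m x = X *m B *m Y *m (X *m B' *m Y *m x).
    by rewrite !mulmxA -[X *m B *m Y *m X]mulmxA YX mulmx1.
  by auto.
- by move=> x hx; rewrite mulmx1 XY mul1mx.
by move=> x hx; apply: Pc_stable => //; apply: lie_conj => //; apply: lieT.
Qed.

Lemma Pr_all x : Pr x.
Proof.
apply: cyclic_row x; first exact: Pr_closed.
  by rewrite /Pr -mulmxA covec_compl mulmx0; apply: lie0.
move=> X Y hX hY XY x hx.
have [Z _ [XZ ZX]] := GamV hX.
have YE : Y = Z by rewrite -[LHS]mul1mx -ZX -mulmxA XY mulmx1.
have YX : Y *m X = 1%:M by rewrite YE.
have [P0 PD PZ] := Pr_closed.
move: x hx; apply: (@S_of_T (fun B => forall x, Pr x -> Pr (x *m (X *m B *m Y)))).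
- by move=> B B' hB hB' x hx; rewrite mulmxDr mulmxDl mulmxDr; apply: PD; auto.
- by move=> a B hB x hx; rewrite -scalemxAr -!scalemxAl -scalemxAr; apply: PZ; auto.
- move=> B B' hB hB' x hx.
  have -> : x *m (X *m (B *m B') *m Y) = x *m (X *m B *m Y) *m (X *m B' *m Y).
    by rewrite !mulmxA -[x *m X *m B *m Y *m X]mulmxA YX mulmx1.
  by auto.
- by move=> x hx; rewrite mulmx1 XY mulmx1.
by move=> x hx; apply: Pr_stable => //; apply: lie_conj => //; apply: lieT.
Qed.

(** The bracket of C x f with e y C is C x y C up to a multiple of E = e f; these
    matrices, together with the column and the row through the top vector, span
    the matrices modulo E. *)
Lemma lie_trace (X : 'M[F]_N) : lie (X - (X i0 i0 + \tr (C *m X)) *: E).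
Proof.
have h1 (x : 'cV[F]_N) (y : 'rV[F]_N) : lie (C *m x *m y *m C - (y *m C *m x) 0 0
  *: E).
  have := lie_bracket (Pc_all x) (Pr_all y); congr lie.
  congr (_ - _).
    by rewrite -!mulmxA [f *m (e *m _)]mulmxA proj_pairing mul1mx.
  rewrite -[_ *m (C *m x *m f)]mulmxA !mulmxA -[e *m y *m C *m C]mulmxA compl_idem.
  rewrite -[e *m y *m C *m x]mulmxA -[e *m y *m _]mulmxA.
  by rewrite (mx11_scalar (y *m (C *m x))) mul_mx_scalar -scalemxAl proj_rank1
    mulmxA.
have h2 : lie (\sum_j (C *m col j X *m row j 1%:M *m C - (row j 1%:M *m C *m col j
  X) 0 0 *: E)).
  by elim/big_ind: _ => [|A B|i _]; [exact: lie0 | exact: lieD | exact: h1].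
have h3 : lie (C *m X *m E) by rewrite proj_rank1 !mulmxA -(mulmxA C);
  apply: Pc_all.
have h4 : lie (E *m X *m C) by rewrite proj_rank1 -(mulmxA e f); apply: Pr_all.
have := lieD h2 (lieD h3 h4); congr lie.
rewrite sumrB -scaler_suml scalerDl opprD [RHS]addrA.
have -> : \sum_i (row i 1%:M *m C *m col i X) 0 0 = \tr (C *m X).
  apply: eq_bigr => i _; rewrite -row_mul mul1mx mxE [RHS]mxE.
  by apply: eq_bigr => k _; rewrite !mxE.
have -> : \sum_i C *m col i X *m row i 1%:M *m C = C *m X *m C.
  rewrite -mulmx_suml; congr (_ *m _).
  under eq_bigr => i _ do rewrite -mulmxA.
  rewrite -mulmx_sumr; congr (_ *m _); rewrite -[RHS]mulmx1.
  apply/matrixP=> i j; rewrite summxE mxE; apply: eq_bigr => k _.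
  by rewrite mxE big_ord1 !mxE.
have EXE : E *m X *m E = X i0 i0 *: E.
  apply/matrixP=> i j; rewrite mulmx_projE proj_mulmxE !mxE.
  by case: eqP => [->|_]; case: eqP => [->|_];
    rewrite /= ?mul0r ?mulr0 ?mul1r ?mulr1.
rewrite [LHS]addrAC; congr (_ - _); apply/eqP; rewrite eq_sym subr_eq -EXE.
apply/eqP; have {1}-> : X = (C + E) *m X *m (C + E) by rewrite compl_projE subrK
  mul1mx mulmx1.
by rewrite mulmxDr !mulmxDl -!addrA; congr (_ + _); rewrite addrCA.
Qed.

(** For the identity matrix, [lie_trace] gives that N E belongs to the Lie
    algebra, hence so does E, and [lie_trace] for X concludes. *)
Lemma lie_all (X : 'M[F]_N) : lie X.
Proof.
have Nneq0 : N%:R != 0 :> F by case: (N) i0 => [[]|].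
have lieE : lie E.
  have := lieB lie1 (lie_trace 1%:M).
  rewrite opprB addrC subrK mulmx1.
  have -> : 1%:M i0 i0 + \tr C = N%:R :> F.
    rewrite compl_projE linearB /= mxtrace1 mxE eqxx /mxtrace (bigD1 i0) //= mxE
      eqxx.
    by rewrite big1 => [|k /negPf k0]; [rewrite addr0 addrC subrK | rewrite mxE k0].
  by move=> /(lieZ N%:R^-1); rewrite scalerA mulVf // scale1r.
by rewrite -[X](subrK ((X i0 i0 + \tr (C *m X)) *: E));
  apply: lieD (lie_trace X) (lieZ _ lieE).
Qed.

End LieAlgebra.

(** * Density from the spectrum and cyclicity of one generator *)

Fixpoint mprod (R : comNzRingType) N (A : 'M[R]_N) (lam : nat -> R) k : 'M[R]_N :=
  if k is k'.+1 then A *m mprod A lam k' - lam k' *: mprod A lam k' else 1%:M.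

Definition mword (R : comNzRingType) N (I : Type) (sig : I -> 'M[R]_N) (g : seq I)
  : 'M[R]_N :=
  foldr (fun i M => sig i *m M) 1%:M g.

Section Shift.
Variables (F : fieldType) (N : nat).

Lemma mprod_diag (r : 'rV[F]_N) lam k :
  mprod (diag_mx r) lam k = diag_mx (\row_i \prod_(j < k) (r 0 i - lam j)).
Proof.
elim: k => [|k IH] /=.
  rewrite (_ : \row_i _ = const_mx 1) ?diag_const_mx //.
  by apply/rowP=> i; rewrite !mxE big_ord0.
rewrite IH mulmx_diag; apply/matrixP=> i j; rewrite !mxE big_ord_recr /=.
case: eqP => _ /=; rewrite ?mulr0n ?mulr0 ?subr0 // !mulr1n; ring.
Qed.

Lemma mprod_conj (Q A : 'M[F]_N) lam k : Q \in unitmx ->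
  mprod (Q *m A *m invmx Q) lam k = Q *m mprod A lam k *m invmx Q.
Proof.
move=> Qu; elim: k => [|k IH] /=; first by rewrite mulmx1 mulmxV.
rewrite IH mulmxBr mulmxBl -scalemxAr -scalemxAl; congr (_ - _).
by rewrite !mulmxA mulmxKV.
Qed.

End Shift.

Lemma horner_mprod (F : fieldType) N (A : 'M[F]_N.+1) lam k :
  horner_mx A (\prod_(j <- rev (map lam (iota 0 k))) ('X - j%:P)) = mprod A lam k.
Proof.
elim: k => [|k IH]; first by rewrite big_nil rmorph1.
rewrite -addn1 iotaD map_cat rev_cat big_cons add0n rmorphM /= IH addn1 /=.
by rewrite rmorphB /= horner_mx_X horner_mx_C mulrBl -mulmxE mul_scalar_mx.
Qed.

(** The polynomial with roots lam 0, ..., lam l annihilates A and has simple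
    roots. *)
Lemma diagonalization (F : fieldType) N (A : 'M[F]_N) lam l :
  (forall i j, lam i = lam j -> i = j) -> mprod A lam l.+1 = 0 ->
  exists2 Q, Q \in unitmx & exists2 kap : 'I_N -> nat, (forall i, (kap i <= l)%N) &
  Q *m A *m invmx Q = diag_mx (\row_i lam (kap i)).
Proof.
case: N A => [|N] A lam_inj A0.
  by exists 1%:M; rewrite ?unitmx1 //; exists (fun=> 0%N) => //;
    apply/matrixP=> -[].
have [Q Qu] : diagonalizable A.
  apply/diagonalizableP; exists (rev (map lam (iota 0 l.+1))).
    by rewrite rev_uniq map_inj_uniq ?iota_uniq // => i j /lam_inj.
  by apply: mxminpoly_min; rewrite horner_mprod.
move=> /diagonalizable_forPex [r /(simmxRL Qu) rE].
have rk i : exists k : 'I_l.+1, r 0 i == lam k.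
  have := mprod_conj A lam l.+1 Qu; rewrite A0 mulmx0 mul0mx -rE mprod_diag.
  move=> /matrixP/(_ i i).
  rewrite !mxE eqxx mulr1n => /eqP/prodf_eq0[k _].
  by rewrite subr_eq0 => E; exists k.
exists Q => //; exists (fun i => nat_of_ord (xchoose (rk i))) => [i|];
  first by rewrite -ltnS ltn_ord.
by rewrite -rE; congr diag_mx; apply/rowP=> i; rewrite mxE;
  apply/eqP/(xchooseP (rk i)).
Qed.

Section Criterion.
Variables (F : fieldType) (N : nat) (Gam : 'M[F]_N -> Prop).
Hypothesis Gam1 : Gam 1%:M.
Hypothesis GamM : forall X Y, Gam X -> Gam Y -> Gam (X *m Y).
Hypothesis GamV : forall X, Gam X -> exists2 Y, Gam Y & X *m Y = 1%:M /\ Y *m X =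
  1%:M.
Hypothesis char0 : forall k, k.+1%:R != 0 :> F.
Variables (I : Type) (sig : I -> 'M[F]_N) (i1 : I).
Hypothesis Gam_sig : forall i, Gam (sig i).
Hypothesis sig_conj : forall i, exists X Y,
  [/\ Gam X, Gam Y, X *m Y = 1%:M & sig i = X *m sig i1 *m Y].
Variables (u v : F) (l : nat).
Hypothesis uv_indep : forall a b a' b',
  u ^+ a * v ^+ b = u ^+ a' * v ^+ b' -> a = a' /\ b = b'.
Let lam k := u ^+ k * v ^+ (k * (k - 1)).
Hypothesis sig_minpoly : mprod (sig i1) lam l.+1 = 0.
Variables (w : 'cV[F]_N) (phi : 'rV[F]_N).
Hypothesis sig_rank1 : mprod (sig i1) lam l = w *m phi.

Variables (g h : 'I_N -> seq I).
Hypothesis words_unit :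
  \matrix_(i, j) (phi *m mword sig (h i) *m (mword sig (g j) *m w)) 0 0 \in unitmx.

Let U : 'M[F]_N := \matrix_i (phi *m mword sig (h i)).
Let V : 'M[F]_N := (\matrix_j (mword sig (g j) *m w)^T)^T.

(** The matrix of pairings is the product U V. *)
Lemma UV_unit : U \in unitmx /\ V \in unitmx.
Proof.
apply/andP; rewrite -unitmx_mul; congr (_ \in unitmx): words_unit.
apply/matrixP=> i j; rewrite !mxE; apply: eq_bigr => k _.
by rewrite !mxE.
Qed.

Lemma lam_inj i j : lam i = lam j -> i = j.
Proof. by move=> /uv_indep []. Qed.

Lemma words_span_col (P : 'cV[F]_N -> Prop) : is_subspace P -> P w ->
  (forall i x, P x -> P (sig i *m x)) -> forall x, P x.
Proof.
move=> [P0 PD PZ] Pw Psig x.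
have Pword r : P (mword sig r *m w).
  by elim: r => [|i r IH] /=; rewrite ?mul1mx // -mulmxA; apply: Psig.
have [_ Vu] := UV_unit.
rewrite -(mulKVmx Vu x); move: (invmx V *m x) => c.
have -> : V *m c = \sum_j c j 0 *: (mword sig (g j) *m w).
  apply/colP=> i; rewrite summxE mxE; apply: eq_bigr => j _.
  by rewrite !mxE mulrC.
by elim/big_ind: _ => // j _; apply/PZ/Pword.
Qed.

Lemma words_span_row (P : 'rV[F]_N -> Prop) : is_subspace P -> P phi ->
  (forall i x, P x -> P (x *m sig i)) -> forall x, P x.
Proof.
move=> [P0 PD PZ] Pphi Psig x.
have Pword r y : P y -> P (y *m mword sig r).
  by elim: r y => [|i r IH] y Py /=; rewrite ?mulmx1 // mulmxA; apply/IH/Psig.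
have [Uu _] := UV_unit.
rewrite -(mulmxKV Uu x); move: (x *m invmx U) => c.
have -> : c *m U = \sum_j c 0 j *: (phi *m mword sig (h j)).
  by rewrite mulmx_sum_row; apply: eq_bigr => j _; rewrite rowK.
by elim/big_ind: _ => // j _; apply/PZ/Pword.
Qed.

(** In an eigenbasis of the generator, [sig_rank1] says that the eigenvalue lam l
    is simple, and that w and phi are multiples of the corresponding basis vector
    and coordinate.  The images of w under words span the space and those of phi
    span the dual ([UV_unit]), which is the cyclicity asked for by [lie_all], as the
    generators are conjugates of one of them. *)
Theorem tspan_full d X : tspan Gam (tpow d X).
Proof.
have [N0|N0] := posnP N.
  suff -> : X = 1%:M by apply: tspan_tpow.
  by apply/matrixP=> i; have := ltn_ord i; rewrite {2}N0.
have [Q Qu [kap kap_le SE]] := diagonalization lam_inj sig_minpoly.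
pose S := diag_mx (\row_i lam (kap i)).
pose x := Q *m w; pose y := phi *m invmx Q.
pose D i := \prod_(j < l) (lam (kap i) - lam j).
have xyE i j : x i 0 * y 0 j = D i *+ (i == j).
  have := mprod_conj (sig i1) lam l Qu.
  have -> : Q *m mprod (sig i1) lam l *m invmx Q = x *m y by rewrite sig_rank1 /x
    /y !mulmxA.
  rewrite SE mprod_diag => /matrixP/(_ i j).
  rewrite mxE [X in X *+ _]mxE [RHS]mxE big_ord1 => <-; congr (_ *+ _).
  by apply: eq_bigr => k _; rewrite mxE.
have D0 i : (D i != 0) = (kap i == l).
  apply/idP/eqP => [|E].
    move=> /prodf_neq0 H; apply/eqP; rewrite eqn_leq kap_le /= leqNgt;
      apply/negP => lt.
    by have := H (Ordinal lt) isT; rewrite subrr eqxx.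
  apply/prodf_neq0 => j _; rewrite subr_eq0 E; apply/eqP => /lam_inj E'.
  by have := ltn_ord j; rewrite -E' ltnn.
have [Uu Vu] := UV_unit.
have closed0 p r : is_subspace (fun A : 'M[F]_(p, r) => A = 0).
  by split=> [//|A B -> ->|a A ->]; rewrite ?addr0 ?scaler0.
have [i xi] : exists i, x i 0 != 0.
  apply/existsP; apply: contraT => /existsPn x0.
  have w0 : w = 0.
    rewrite -(mulKmx Qu w) -/x (_ : x = 0) ?mulmx0 //.
    by apply/colP=> i; rewrite [RHS]mxE; apply/eqP/negPn/x0.
  have H : forall z : 'cV[F]_N, z = 0.
    by apply: words_span_col => // k z ->; rewrite mulmx0.
  have /colP/(_ (Ordinal N0))/eqP := H (const_mx 1).
  by rewrite !mxE oner_eq0.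
have [j yj] : exists j, y 0 j != 0.
  apply/existsP; apply: contraT => /existsPn y0.
  have p0 : phi = 0.
    rewrite -(mulmxKV Qu phi) -/y (_ : y = 0) ?mul0mx //.
    by apply/rowP=> k; rewrite [RHS]mxE; apply/eqP/negPn/y0.
  have H : forall z : 'rV[F]_N, z = 0.
    by apply: words_span_row => // k z ->; rewrite mul0mx.
  have /rowP/(_ (Ordinal N0))/eqP := H (const_mx 1).
  by rewrite !mxE oner_eq0.
have top k : x k 0 != 0 -> k = j.
  move=> xk; have : x k 0 * y 0 j != 0 by rewrite mulf_neq0.
  by rewrite xyE; case: (k =P j) => // _; rewrite mulr0n eqxx.
have ij := top i xi; subst j.
have DE k : D k = x k 0 * y 0 k by rewrite xyE eqxx mulr1n.
have kapi : kap i = l by apply/eqP; rewrite -D0 DE mulf_neq0.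
have kap_top k : kap k = l -> k = i.
  move=> /eqP; rewrite -D0 DE mulf_eq0 negb_or => /andP[xk _].
  exact: top.
have xE : x = x i 0 *: delta_mx i 0.
  apply/colP=> k; rewrite [RHS]mxE [delta_mx _ _ _ _]mxE eqxx andbT;
    case: eqP => [->|/eqP ne]; first by rewrite mulr1.
  by rewrite mulr0; apply/eqP; apply: contraNT ne => /top ->.
have yE : y = y 0 i *: delta_mx 0 i.
  apply/rowP=> k; rewrite [RHS]mxE [delta_mx _ _ _ _]mxE eqxx /=;
    case: eqP => [->|/eqP ne]; first by rewrite mulr1.
  rewrite mulr0; apply/eqP; have := xyE i k; rewrite eq_sym (negPf ne) /= mulr0n =>
    /eqP.
  by rewrite mulf_eq0 (negPf xi).
(* The group in the eigenbasis. *)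
pose Gam' (A : 'M[F]_N) := Gam (invmx Q *m A *m Q).
have toGam A : Gam A -> Gam' (Q *m A *m invmx Q).
  by rewrite /Gam' !mulmxA mulVmx // mul1mx mulmxKV.
have Gam'1 : Gam' 1%:M by rewrite /Gam' mulmx1 mulVmx.
have Gam'M A B : Gam' A -> Gam' B -> Gam' (A *m B).
  rewrite /Gam' => hA hB; have := GamM hA hB; congr Gam.
  by rewrite !mulmxA; congr (_ *m _ *m _); rewrite mulmxK.
have Gam'V A : Gam' A -> exists2 B, Gam' B & A *m B = 1%:M /\ B *m A = 1%:M.
  move=> /GamV[B hB [AB BA]]; exists (Q *m B *m invmx Q); first exact: toGam.
  split.
    have -> : A *m (Q *m B *m invmx Q) = Q *m (invmx Q *m A *m Q *m B) *m invmx Q.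
      by rewrite !mulmxA mulmxV // mul1mx.
    by rewrite AB mulmx1 mulmxV.
  have -> : Q *m B *m invmx Q *m A = Q *m (B *m (invmx Q *m A *m Q)) *m invmx Q.
    by rewrite !mulmxA mulmxK.
  by rewrite BA mulmx1 mulmxV.
have QsigE k : exists A B, [/\ Gam' A, Gam' B, A *m B = 1%:M &
    Q *m sig k *m invmx Q = A *m S *m B].
  have [A [B [hA hB AB ->]]] := sig_conj k.
  exists (Q *m A *m invmx Q), (Q *m B *m invmx Q); split; try exact: toGam.
    by rewrite !mulmxA mulmxKV // -(mulmxA Q) AB mulmx1 mulmxV.
  by rewrite /S -SE !mulmxA !mulmxKV.
have cyc (P : 'cV[F]_N -> Prop) : is_subspace P -> P (delta_mx i 0) ->
    (forall A B, Gam' A -> Gam' B -> A *m B = 1%:M -> forall z, P z -> P (A *m S *m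
      B *m z)) ->
    forall z, P z.
  move=> [P0 PD PZ] Pe PS z; rewrite -(mulKVmx Qu z); move: (invmx Q *m z) => {}z.
  move: z; apply: words_span_col.
  - by split=> [|A B|c A]; rewrite ?mulmx0 // ?mulmxDr -?scalemxAr;
    [apply: PD | apply: PZ].
  - by rewrite -/x xE; apply: PZ.
  move=> k z Pz; have [A [B [hA hB AB E]]] := QsigE k.
  have -> : Q *m (sig k *m z) = A *m S *m B *m (Q *m z).
    by rewrite -E !mulmxA mulmxKV.
  exact: PS.
have cyr (P : 'rV[F]_N -> Prop) : is_subspace P -> P (delta_mx 0 i) ->
    (forall A B, Gam' A -> Gam' B -> A *m B = 1%:M -> forall z, P z -> P (z *m (A
      *m S *m B))) ->
    forall z, P z.
  move=> [P0 PD PZ] Pe PS z; rewrite -(mulmxK Qu z); move: (z *m Q) => {}z.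
  move: z; apply: words_span_row.
  - by split=> [|A B|c A]; rewrite ?mul0mx // ?mulmxDl -?scalemxAl;
    [apply: PD | apply: PZ].
  - by rewrite -/y yE; apply: PZ.
  move=> k z Pz; have [A [B [hA hB AB E]]] := QsigE k.
  have -> : z *m sig k *m invmx Q = z *m invmx Q *m (A *m S *m B).
    by rewrite -E !mulmxA mulmxKV.
  exact: PS.
have Gam'S : Gam' S by rewrite /S -SE; apply/toGam/Gam_sig.
have full Y : tspan Gam' (tpow d Y).
  apply: tspan_tpow_of_tder => // Z.
  exact: (lie_all Gam'1 Gam'M Gam'V char0 uv_indep kap_le kapi kap_top Gam'S cyc
    cyr).
have back A : tspan Gam' A -> tspan Gam (tpow d (invmx Q) *m A *m tpow d Q).
  elim=> [|A1 A2 _ h1 _ h2|a A1 _ h1|A1 hA1].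
  - by rewrite mulmx0 mul0mx; apply: tspan0.
  - by rewrite mulmxDr mulmxDl; apply: tspanD.
  - by rewrite -scalemxAr -scalemxAl; apply: tspanZ.
  by rewrite -!tpowM; apply: tspan_tpow.
have := back _ (full (Q *m X *m invmx Q)).
by rewrite -!tpowM !mulmxA mulVmx // mul1mx mulmxKV.
Qed.

End Criterion.

From mathcomp Require Import finmap monalg.

(** * The coefficients of the R-matrix *)

Lemma s_neq0 : s != 0.
Proof. by rewrite /s tofrac_eq0 polyX_eq0. Qed.

Lemma qL_unit : qL \is a GRing.unit.
Proof. by rewrite unfold_in /= /LL_unit /= q_neq0; apply/laurentP/laurent_qV. Qed.

Lemma sL_unit : sL \is a GRing.unit.
Proof. by rewrite unfold_in /= /LL_unit /= s_neq0; apply/laurentP/laurent_sV. Qed.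

Lemma LL_inj (x y : LL) : val x = val y -> x = y.
Proof. exact: val_inj. Qed.
Lemma valLM (x y : LL) : val (x * y) = val x * val y.
Proof. exact: rmorphM. Qed.
Lemma valLD (x y : LL) : val (x + y) = val x + val y.
Proof. exact: rmorphD. Qed.
Lemma valLB (x y : LL) : val (x - y) = val x - val y.
Proof. exact: rmorphB. Qed.
Lemma valLX (x : LL) n : val (x ^+ n) = val x ^+ n.
Proof. exact: rmorphXn. Qed.
Lemma valLV (x : LL) : x \is a GRing.unit -> val x^-1 = (val x)^-1.
Proof. exact: rmorphV. Qed.

Lemma val_qLV n : val (qL ^ (- n%:Z)) = q ^- n.
Proof. by rewrite -exprnN valLV ?unitrX ?qL_unit // valLX. Qed.

Lemma val_sLV n : val (sL ^ (- n%:Z)) = s ^- n.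
Proof. by rewrite -exprnN valLV ?unitrX ?sL_unit // valLX. Qed.

Definition triangular m := ((m * (m - 1)) %/ 2)%N.

Lemma triangularS m : triangular m.+1 = (triangular m + m)%N.
Proof.
rewrite /triangular; case: m => [|m] //.
rewrite !subn1 /= (_ : m.+2 * m.+1 = m.+1 * 2 + m.+1 * m)%N; last by lia.
by rewrite divnMDl // addnC.
Qed.

(** For s = q^h this is q - q^-1 times the q-integer of h - x. *)
Definition swt (x : nat) : KK := s * q ^- x - s^-1 * q ^+ x.

Lemma val_Rcoef i j m : val (Rcoef i j m) =
  s ^- (i + j) * q ^+ (2 * (i - m) * (j + m) + triangular m) * qbinom (m + j) j
  * \prod_(0 <= k < m) swt (k + j).
Proof.
rewrite /Rcoef !valLM val_sLV valLX (big_morph _ valLM (erefl : val (1 : LL) = 1));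
  congr (_ * _).
apply: eq_bigr => k _; by rewrite valLB !valLM valLX val_qLV valLV ?sL_unit.
Qed.

Lemma val_Kwt j : val (Kwt j) = s * q ^- (2 * j).
Proof. by rewrite /Kwt valLM val_qLV. Qed.

(** What the commutation of R with E comes down to once the common factors of
    four neighbouring coefficients are divided out; a and c stand for
    q^m and q^j. *)
Lemma Rcoef_core_identity (F : fieldType) (q s a c : F) :
  q != 0 -> s != 0 -> a != 0 -> c != 0 -> (q * a) ^+ 2 - 1 != 0 -> q ^+ 2 - 1 != 0
    ->
  s * a * ((q * a * c - (q * a * c)^-1) / (q - q^-1) / ((q * a - (q * a)^-1) / (q -
    q^-1)))
    * (s * (a * c)^-1 - s^-1 * (a * c)) + a ^+ 2 * c ^+ 2 =
  s ^+ 2 * c ^- 2 + s * a * ((c - c^-1) / (q - q^-1) / ((q * a - (q * a)^-1) / (q -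
    q^-1)))
    * (s * (q / c) - s^-1 * (c / q)).
Proof.
move=> q0 s0 a0 c0 h1 h2; field.
by rewrite h1 h2 a0 c0 s0 q0.
Qed.

Lemma qbinom_addS m j : qbinom (m.+1 + j) j = qbinom (m + j) j * (qint (m.+1 + j) /
  qint m.+1).
Proof. by rewrite /qbinom !addnK addSn !qfactS !invfM mulrA mulrACA -!mulrA. Qed.

Lemma qbinom_shift_aux (F : fieldType) (n a b x y : F) : a != 0 -> b != 0 -> x != 0
  -> y != 0 ->
  n / (a * (b * y)) = n / (a * x * b) * (x / y).
Proof. by move=> a0 b0 x0 y0; field; rewrite a0 b0 x0 y0. Qed.

Lemma qbinom_shift m j : qbinom (m.+1 + j) j = qbinom (m + j.+1) j.+1 * (qint j.+1
  / qint m.+1).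
Proof.
rewrite /qbinom addnS -addSn addnK (_ : m.+1 + j - j.+1 = m)%N; last by lia.
rewrite (qfactS m) (qfactS j); apply: qbinom_shift_aux;
  by rewrite ?qfact_neq0 ?qint_neq0.
Qed.

Lemma qbinom_nn n : qbinom n n = 1.
Proof.
rewrite /qbinom subnn {3}/qfact big_geq // mulr1 mulfV //; exact: qfact_neq0.
Qed.

(** The coefficient of f r (p + 1) in the commutation [E2_R2]. *)
Lemma Rcoef_comm0 r p : Kwt r * Rcoef r p.+1 0 = Rcoef r p 0.
Proof.
apply: val_inj; rewrite valLM val_Kwt !val_Rcoef !big_geq // !add0n !qbinom_nn
  !mulr1.
rewrite !subn0 !addn0 (_ : 2 * r * p.+1 = 2 * r + 2 * r * p)%N; last by lia.
rewrite addnS (exprS s) (exprD q (2 * r)%N).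
have aux (F : fieldType) (a b c d : F) : a != 0 -> b != 0 -> c != 0 ->
    a / b * ((a * c)^-1 * (b * d)) = c^-1 * d.
  by move=> a0 b0 c0; field; rewrite a0 b0 c0.
apply: aux; [exact: s_neq0 | exact: expf_neq0 q_neq0 | exact: expf_neq0 s_neq0].
Qed.

(** Reduces [Rcoef_commS] to [Rcoef_core_identity].  Here and in the next three
    lemmas the powers of q and s are indeterminates of an arbitrary field. *)
Lemma Rcoef_commS_aux (F : fieldType) (Z q s a c r A B S : F) :
  q != 0 -> s != 0 -> a != 0 -> c != 0 -> r != 0 ->
  s * a * A * S + a ^+ 2 * c ^+ 2 =
    s ^+ 2 * c ^- 2 + s * a * B * (s * (q / c) - s^-1 * (c / q)) ->
  s / r * (Z * s^-1 * r * a * A * S) + Z * s^-1 * (a ^+ 2 * c ^+ 2) =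
  s / c ^+ 2 * Z + Z * a * B * (s * (q / c) - s^-1 * (c / q)).
Proof.
move=> q0 s0 a0 c0 r0 H.
have -> : s / r * (Z * s^-1 * r * a * A * S) = Z * s^-1 * (s * a * A * S).
  by field; rewrite r0 s0.
rewrite -mulrDr H; field.
by rewrite q0 s0 c0.
Qed.

Lemma Rcoef_factor1 (F : fieldType) (s1 t s r a B A P S : F) :
  (s1 * s)^-1 * (t * r * a) * (B * A) * (P * S) =
  s1^-1 * t * B * P * s^-1 * r * a * A * S.
Proof. by rewrite invfM; ring. Qed.

Lemma Rcoef_factor2 (F : fieldType) (s1 t s a B P : F) :
  (s1 * s)^-1 * (t * a) * B * P = s1^-1 * t * B * P * s^-1 * a.
Proof. by rewrite invfM; ring. Qed.

Lemma Rcoef_factor3 (F : fieldType) (s1 t a B A P S : F) :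
  s1 * (t * a) * (B * A) * (S * P) = s1 * t * B * P * a * A * S.
Proof. by ring. Qed.

(** The coefficient of f (r + m + 1) j in the commutation [E2_R2]; the last term
    comes from R2 at (r + m + 1, j - 1). *)
Lemma Rcoef_commS r j m :
  Kwt r * Rcoef (r + m).+1 j m.+1 + Rcoef (r + m).+1 j m =
  Kwt j * Rcoef (r + m) j m + (if j is j'.+1 then Rcoef (r + m).+1 j' m.+1 else 0).
Proof.
(* Z is the common factor of the four coefficients. *)
pose Z := s ^- (r + m + j) * q ^+ (2 * r * (j + m) + triangular m) * qbinom (m + j)
  j
  * \prod_(0 <= k < m) swt (k + j).
have hq := q_neq0; have hs := s_neq0.
have v1 : val (Rcoef (r + m).+1 j m.+1) =
   Z * s^-1 * q ^+ (2 * r) * q ^+ m * (qint (m.+1 + j) / qint m.+1) * swt (m + j).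
  rewrite val_Rcoef big_nat_recr //= qbinom_addS triangularS subSS addnK.
  rewrite (_ : 2 * r * (j + m.+1) + _ = 2 * r * (j + m) + triangular m + 2 * r +
    m)%N; last by lia.
  rewrite (addSn (r + m)) exprSr (exprD q _ m) (exprD q _ (2 * r)%N);
    apply: Rcoef_factor1.
have v2 : val (Rcoef (r + m).+1 j m) = Z * s^-1 * (q ^+ m ^+ 2 * q ^+ j ^+ 2).
  rewrite val_Rcoef -addSn addnK -!exprM.
  rewrite (_ : 2 * r.+1 * (j + m) + _ = 2 * r * (j + m) + triangular m + (m * 2 + j
    * 2))%N; last by lia.
  rewrite (addSn (r + m)) exprSr (exprD q (2 * r * (j + m) + triangular m)%N).
  by rewrite (exprD q (m * 2)%N) /Z; apply: Rcoef_factor2.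
have v3 : val (Rcoef (r + m) j m) = Z by rewrite val_Rcoef addnK.
have v4 : val (if j is j'.+1 then Rcoef (r + m).+1 j' m.+1 else 0) =
  Z * q ^+ m * (qint j / qint m.+1) * (s * (q / q ^+ j) - s^-1 * (q ^+ j / q)).
  rewrite /Z; clear; have hq := q_neq0; case: j => [|j].
    by rewrite /qint expr0 invr1 subrr !mul0r mulr0 mul0r.
  rewrite val_Rcoef big_nat_recl //= qbinom_shift triangularS subSS addnK.
  rewrite (_ : 2 * r * (j + m.+1) + _ = 2 * r * (j.+1 + m) + triangular m + m)%N;
    last by lia.
  rewrite (_ : (r + m).+1 + j = r + m + j.+1)%N; last by lia.
  under eq_bigr => k _ do rewrite addSnnS.
  rewrite (exprD q _ m) {1}/swt add0n (exprSr q j).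
  have -> : q / (q ^+ j * q) = (q ^+ j)^-1 by rewrite invfM mulrCA mulfV ?mulr1.
  by rewrite (mulfK hq); apply: Rcoef_factor3.
apply: LL_inj; rewrite 2!valLD (valLM (Kwt r)) (valLM (Kwt j)) !val_Kwt v1 v2 v3 v4.
have ha := expf_neq0 m hq; have hc := expf_neq0 j hq.
have h1 : (q * q ^+ m) ^+ 2 - 1 != 0.
  by rewrite subr_eq0 -exprS -exprM qn_neq1 // mulnC.
have h2 : q ^+ 2 - 1 != 0 by rewrite subr_eq0 qn_neq1.
have q2r := expf_neq0 (2 * r)%N hq.
have -> : q ^- (2 * j) = q ^+ j ^- 2 by rewrite mulnC exprM.
have e1 : qint (m.+1 + j) = (q * q ^+ m * q ^+ j - (q * q ^+ m * q ^+ j)^-1) / (q -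
  q^-1).
  by rewrite /qint exprD exprS.
have e2 : qint m.+1 = (q * q ^+ m - (q * q ^+ m)^-1) / (q - q^-1).
  by rewrite /qint exprS.
have e3 : swt (m + j) = s * (q ^+ m * q ^+ j)^-1 - s^-1 * (q ^+ m * q ^+ j).
  by rewrite /swt exprD.
refine (@Rcoef_commS_aux KK Z q s _ _ _ (qint (m.+1 + j) / qint m.+1)
  (qint j / qint m.+1) (swt (m + j)) hq hs ha hc q2r _).
rewrite e1 e2 e3; exact: (Rcoef_core_identity hq hs ha hc h1 h2).
Qed.

(** * The R-matrix and the operator E on two tensor factors *)

Section TwoFactors.
Variables (A : comNzRingType) (c : nat -> nat -> nat -> A).
Implicit Types f g : nat -> nat -> A.

(** The R-matrix on coefficients: if f p r is the coefficient of v_p ⊗ v_r in a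
    vector, then [R2 Rcoef f] gives the coefficients of its image.  The family c is
    a parameter because the specialization at q = 1 is of the same form. *)
Definition R2 f p r : A := \sum_(m < p.+1) c (r + m) (p - m) m * f (r + m)%N (p -
  m)%N.

Lemma R2_weight f g m : (forall p r, (p + r)%N = m -> f p r = g p r) ->
  forall p r, (p + r)%N = m -> R2 f p r = R2 g p r.
Proof.
move=> fg p r prm; apply: eq_bigr => k _; rewrite fg //.
by rewrite -prm addnC addnCA subnK 1?addnC // -ltnS.
Qed.

Lemma R2_lin a f g p r : R2 (fun p r => f p r - a * g p r) p r = R2 f p r - a * R2
  g p r.
Proof.
rewrite /R2 mulr_sumr -sumrB; apply: eq_bigr => k _; ring.
Qed.

Variable lam : nat -> A.

Fixpoint R2prod k f : nat -> nat -> A :=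
  if k is k'.+1 then fun p r => R2 (R2prod k' f) p r - lam k' * R2prod k' f p r
    else f.

End TwoFactors.

(** The operator E on coefficients, as [R2] is for R. *)
Definition E2 (f : nat -> nat -> LL) p r : LL := Kwt r * f p.+1 r + f p r.+1.

Lemma E2_R2 f : E2 (R2 Rcoef f) = R2 Rcoef (E2 f).
Proof.
apply/funext=> p; apply/funext=> r; rewrite /E2 /R2.
rewrite big_ord_recl /= addn0 subn0 mulrDr mulrA Rcoef_comm0 -addrA mulr_sumr
  -big_split /=.
under [RHS]eq_bigr => m _ do rewrite mulrDr.
rewrite [RHS]big_split /= [X in _ = _ + X]big_ord_recl /= addn0 subn0 addrCA;
  congr (_ + _).
(* The terms of R2 Rcoef applied to the second half of E2, shifted by one. *)
pose G m := (if (p - m)%N is j'.+1 then Rcoef (r + m).+1 j' m.+1 else 0) * f (r +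
  m).+1 (p - m)%N.
have -> : \sum_(i < p) Rcoef (r + bump 0 i) (p - bump 0 i) (bump 0 i) *
            f (r + bump 0 i)%N (p - bump 0 i).+1 = \sum_(m < p.+1) G m.
  rewrite big_ord_recr /= /G subnn mul0r addr0; apply: eq_bigr => i _.
  by rewrite /bump /= add1n addnS subnSK // -(subnSK (ltn_ord i)).
rewrite -big_split /=; apply: eq_bigr => m _.
rewrite /bump leq0n add1n addnS subSS addSn mulrA -mulrDl Rcoef_commS mulrDl.
by rewrite /G (mulrC (Kwt (p - m))) -mulrA.
Qed.

(** The coefficients of the element of the kernel of E of weight p + r whose
    coefficient at v_0 ⊗ v_(p + r) is 1. *)
Definition topcoef p r : LL := (-1) ^+ p * sL^-1 ^+ p * qL ^+ (2 * p * r + p * (p -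
  1)).

Lemma topcoef0 r : topcoef 0 r = 1.
Proof. by rewrite /topcoef !expr0 !mulr1. Qed.

Lemma topcoefS p r : topcoef p.+1 r = - (sL^-1 * qL ^+ (2 * r)) * topcoef p r.+1.
Proof.
rewrite /topcoef (_ : 2 * p.+1 * r + _ = 2 * r + (2 * p * r.+1 + p * (p - 1)))%N;
  last first.
  by rewrite subn1 /= [(p.+1 * p)%N]mulnC; case: p => [|p]; lia.
rewrite (exprD _ (2 * r)%N) !exprS.
by move: (qL ^+ _) (sL^-1) (qL ^+ _) => a b d; ring.
Qed.

(** The eigenvalue of R on the kernel of E in weight k.  At v_0 ⊗ v_k only the
    term of v_k ⊗ v_0 contributes to R, with the factor s^-k. *)
Definition lamL k : LL := sL^-1 ^+ k * topcoef k 0.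

(** The kernel of E has rank one in each weight: E f = 0 is a recursion on p with
    an invertible coefficient. *)
Lemma E2_ker f m : (forall p r, (p + r).+1 = m -> E2 f p r = 0) ->
  forall p r, (p + r)%N = m -> f p r = topcoef p r * f 0%N m.
Proof.
move=> hf; elim=> [|p IH] r prm; first by rewrite topcoef0 mul1r -prm.
have := hf p r prm; rewrite /E2 (IH r.+1); last by rewrite addnS.
move=> /eqP; rewrite addr_eq0 => /eqP H.
have KV : sL^-1 * qL ^+ (2 * r) * Kwt r = 1.
  rewrite /Kwt mulrACA mulVr ?sL_unit // mul1r -exprnN mulrV //.
  by rewrite unitrX // qL_unit.
have -> : f p.+1 r = sL^-1 * qL ^+ (2 * r) * (Kwt r * f p.+1 r) by rewrite mulrA KV
  mul1r.
by rewrite H topcoefS mulrN mulNr mulrA mulNr.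
Qed.

Notation Rprod := (R2prod Rcoef lamL).

Lemma E2_Rprod k f : E2 (Rprod k f) = Rprod k (E2 f).
Proof.
elim: k f => [|k IH] f //=; rewrite -IH -E2_R2.
apply/funext=> p; apply/funext=> r; rewrite /E2.
by move: (lamL k) (Kwt r) (Rprod k f) => a b g; ring.
Qed.

(** R preserves the kernel of E, so by [E2_ker] it is enough to compare the
    coefficients at v_0 ⊗ v_m. *)
Lemma R2_eigen f m : (forall p r, (p + r).+1 = m -> E2 f p r = 0) ->
  forall p r, (p + r)%N = m -> R2 Rcoef f p r = lamL m * f p r.
Proof.
move=> hf p r prm.
have hR p' r' : (p' + r').+1 = m -> E2 (R2 Rcoef f) p' r' = 0.
  move=> prm'; rewrite E2_R2; apply: big1 => k _; rewrite hf ?mulr0 //.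
  by rewrite -prm' addnC addnCA subnK 1?addnC // -ltnS.
rewrite (E2_ker hR prm) (E2_ker hf prm) mulrCA; congr (_ * _).
rewrite /R2 big_ord1 subn0 addn0 (E2_ker hf (addn0 m)) /lamL mulrA;
  congr (_ * _ * _).
apply: LL_inj; rewrite val_Rcoef big_geq // subn0 muln0 add0n qbinom_nn !mulr1
  addn0.
by rewrite valLX valLV ?sL_unit // exprVn.
Qed.

(** By induction on the weight, E kills Rprod m f in weight m, because it commutes
    with R and lowers the weight; then R acts on it by lam m. *)
Lemma Rprod_kill m f p r : (p + r)%N = m -> Rprod m.+1 f p r = 0.
Proof.
elim: m f p r => [|m IH] f p r prm; apply/eqP; rewrite [Rprod _ _ _ _]/= subr_eq0;
  apply/eqP.
  by apply: (@R2_eigen f) prm.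
apply: (@R2_eigen (Rprod m.+1 f) _ _ p r prm) => p' r' [prm'].
by rewrite E2_Rprod IH.
Qed.

Lemma Rprod_kill_le k f p r : (p + r < k)%N -> Rprod k f p r = 0.
Proof.
elim: k p r => // k IH p r; rewrite ltnS leq_eqVlt => /orP[/eqP/Rprod_kill //|lt].
rewrite /= IH // mulr0 subr0; apply: big1 => i _; rewrite IH ?mulr0 //.
suff -> : (r + i + (p - i) = p + r)%N by [].
by rewrite addnC addnCA subnK 1?addnC // -ltnS.
Qed.

Lemma Rprod_top m f p r : (p + r)%N = m -> Rprod m f p r = topcoef p r * Rprod m f
  0%N m.
Proof.
move=> prm; apply: (E2_ker _ prm) => p' r' prm'.
by rewrite E2_Rprod -prm' Rprod_kill.
Qed.

(** * Coefficients of the operators on n tensor factors *)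

Section Coefficients.
Variable n : nat.
Implicit Types (x y : Vtens n) (a c : {ffun 'I_n -> nat}).

Definition upd (i : 'I_n.-1) a (p r : nat) : {ffun 'I_n -> nat} :=
  [ffun k => if k == pos1 i then p else if k == pos2 i then r else a k].

Lemma pos12 (i : 'I_n.-1) : (pos2 i == pos1 i) = false.
Proof. by apply/eqP => /(congr1 val) /= /eqP; rewrite eqn_leq ltnn. Qed.

Lemma upd1 i a p r : upd i a p r (pos1 i) = p.
Proof. by rewrite ffunE eqxx. Qed.
Lemma upd2 i a p r : upd i a p r (pos2 i) = r.
Proof. by rewrite ffunE pos12 eqxx. Qed.
Lemma updK i a : upd i a (a (pos1 i)) (a (pos2 i)) = a.
Proof. by apply/ffunP=> k; rewrite ffunE; do 2![case: eqP => [->|_] //]. Qed.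
Lemma upd_upd i a p r p' r' : upd i (upd i a p r) p' r' = upd i a p' r'.
Proof. by apply/ffunP=> k; rewrite !ffunE; do 2![case: eqP => // _]. Qed.

Lemma mcoeff_sum_supp x a :
  mcoeff a x = \sum_(c <- msupp x) mcoeff c x * (c == a)%:R.
Proof.
have [ax|ax] := boolP (a \in msupp x).
  rewrite (big_rem a) //= eqxx mulr1 big_seq big1 ?addr0 // => c.
  by rewrite (mem_rem_uniq _ (fset_uniq _)) inE => /andP[/negPf -> _];
    rewrite mulr0.
rewrite mcoeff_outdom // big_seq big1 // => c cx.
by case: eqP ax => [<-|_ _]; [rewrite cx | rewrite mulr0].
Qed.

Lemma mcoeff_lin_ext f x a (g : {ffun 'I_n -> nat} -> Vtens n -> LL) :
  (forall c, mcoeff a (f c) = g a (vtens c)) ->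
  g a x = \sum_(c <- msupp x) mcoeff c x * g a (vtens c) ->
  mcoeff a (lin_ext f x) = g a x.
Proof.
move=> fg ->; rewrite /lin_ext raddf_sum /=; apply: eq_bigr => c _.
by rewrite mcoeffZ fg.
Qed.

(** The image under Rop of the basis vector c has a nonzero coefficient at a for
    at most one m, and c is recovered from a and this m. *)
Lemma mcoeff_Rop i x a :
  mcoeff a (Rop i x) =
  R2 Rcoef (fun p r => mcoeff (upd i a p r) x) (a (pos1 i)) (a (pos2 i)).
Proof.
pose g a (x : Vtens n) := R2 Rcoef (fun p r => mcoeff (upd i a p r) x) (a (pos1 i))
  (a (pos2 i)).
apply: (@mcoeff_lin_ext _ x a g) => [c|]; last first.
  rewrite /g /R2; under eq_bigr => m _ do rewrite mcoeff_sum_supp mulr_sumr.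
  rewrite exchange_big /=; apply: eq_bigr => c _; rewrite mulr_sumr;
    apply: eq_bigr => m _.
  by rewrite mcoeffU mulrCA.
rewrite /g /R2 raddf_sum /=.
rewrite -(big_mkord xpredT (fun m => Rcoef (a (pos2 i) + m) (a (pos1 i) - m) m *
  mcoeff (upd i a (a (pos2 i) + m) (a (pos1 i) - m)) (vtens c))).
(* Both sums are extended to a common range. *)
pose B := maxn (a (pos1 i)).+1 (c (pos1 i)).+1.
rewrite (big_nat_widen _ _ B) ?leq_maxr // [RHS](big_nat_widen _ _ B) ?leq_maxl //.
rewrite big_mkcond [RHS]big_mkcond /=; apply: eq_bigr => m _.
rewrite mcoeffZ !mcoeffU !ltnS -/(upd i c _ _).
have [/andP[mc /eqP E]|H] := boolP ((m <= c (pos1 i)) && (upd i c (c (pos2 i) + m)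
  (c (pos1 i) - m) == a))%N.
  have a1 : a (pos1 i) = (c (pos2 i) + m)%N by rewrite -E upd1.
  have a2 : a (pos2 i) = (c (pos1 i) - m)%N by rewrite -E upd2.
  have E' : upd i a (a (pos2 i) + m) (a (pos1 i) - m) = c.
    by rewrite a1 a2 subnK // addnK -E upd_upd updK.
  by rewrite E' E mc !eqxx a1 a2 leq_addl subnK // addnK.
have H' : ~~ ((m <= a (pos1 i)) && (c == upd i a (a (pos2 i) + m) (a (pos1 i) -
  m)))%N.
  apply: contra H => /andP[ma /eqP E].
  have c1 : c (pos1 i) = (a (pos2 i) + m)%N by rewrite E upd1.
  have c2 : c (pos2 i) = (a (pos1 i) - m)%N by rewrite E upd2.
  by rewrite c1 c2 leq_addl subnK // addnK E upd_upd updK eqxx.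
move: H H'; case: (m <= _)%N => /= [/negPf ->|_]; rewrite ?mulr0.
  by case: (m <= _)%N => //= /negPf ->; rewrite mulr0.
by case: (m <= _)%N => //= /negPf ->; rewrite mulr0.
Qed.

Lemma mcoeff_Eop x a :
  mcoeff a (Eop x) = \sum_(i < n) (\prod_(j < n | (i < j)%N) Kwt (a j)) *
    mcoeff [ffun j => if j == i then (a i).+1 else a j] x.
Proof.
pose g a (x : Vtens n) := \sum_(i < n) (\prod_(j < n | (i < j)%N) Kwt (a j)) *
    mcoeff [ffun j => if j == i then (a i).+1 else a j] x.
apply: (@mcoeff_lin_ext _ x a g) => [c|]; last first.
  rewrite /g; under eq_bigr => i _ do rewrite mcoeff_sum_supp mulr_sumr.
  rewrite exchange_big /=; apply: eq_bigr => c _; rewrite mulr_sumr;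
    apply: eq_bigr => m _.
  by rewrite mcoeffU mulrCA.
rewrite /g raddf_sum /=; apply: eq_bigr => i _; rewrite mcoeffU /Eterm.
have [E|ne] := eqVneq c [ffun j => if j == i then (a i).+1 else a j].
  have ci : c i = (a i).+1 by rewrite E ffunE eqxx.
  rewrite ci /= mcoeffZ mcoeffU.
  have -> : [ffun j => if j == i then a i else c j] = a.
    by apply/ffunP=> j; rewrite ffunE E ffunE; case: eqP => [->|].
  rewrite eqxx !mulr1; apply: eq_bigr => j ij; rewrite E ffunE.
  by case: eqP ij => [->|//]; rewrite ltnn.
rewrite mulr0; case: eqP => [_|c0]; first by rewrite mcoeff0.
rewrite mcoeffZ mcoeffU; case: eqP => [E|_]; last by rewrite mulr0.
case/eqP: ne; apply/ffunP=> j; rewrite ffunE -E !ffunE eqxx; case: eqP => [->|//].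
by rewrite prednK // lt0n; apply/eqP.
Qed.

End Coefficients.

(** * The top eigenvector of a generator *)

Lemma R2prod_zero k f m : (forall p r, (p + r)%N = m -> f p r = 0) ->
  forall p r, (p + r)%N = m -> Rprod k f p r = 0.
Proof.
move=> hf; elim: k => [|k IH] p r prm /=; first exact: hf.
rewrite IH // mulr0 subr0; apply: big1 => i _; rewrite IH ?mulr0 //.
by rewrite -prm addnC addnCA subnK 1?addnC // -ltnS.
Qed.

Lemma Kwt_topcoef p r : Kwt r * topcoef p.+1 r + topcoef p r.+1 = 0.
Proof.
rewrite topcoefS mulNr mulrN addrC mulrA.
suff -> : Kwt r * (sL^-1 * qL ^+ (2 * r)) = 1 by rewrite mul1r subrr.
by rewrite /Kwt mulrACA mulrV ?sL_unit // mul1r -exprnN mulVr // unitrX // qL_unit.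
Qed.

Section TopVector.
Variables (n : nat) (i : 'I_n.-1).
Implicit Types (x y : Vtens n) (a c : {ffun 'I_n -> nat}).

Lemma Rop_lin t x y : Rop i (t *: x + y) = t *: Rop i x + Rop i y.
Proof.
apply/malgP=> a; rewrite mcoeffD mcoeffZ !mcoeff_Rop /R2 mulr_sumr -big_split /=.
apply: eq_bigr => m _; rewrite mcoeffD mcoeffZ mulrDr; congr (_ + _).
exact: mulrCA.
Qed.

(** The product of the operators Rop i - lamL j for j < k. *)
Fixpoint opprod k x : Vtens n :=
  if k is k'.+1 then Rop i (opprod k' x) - lamL k' *: opprod k' x else x.

Lemma mcoeff_opprod k x a : mcoeff a (opprod k x) =
  Rprod k (fun p r => mcoeff (upd i a p r) x) (a (pos1 i)) (a (pos2 i)).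
Proof.
elim: k a => [|k IH] a /=; first by rewrite updK.
rewrite mcoeffB mcoeffZ mcoeff_Rop IH; congr (_ - _); congr R2.
apply/funext=> p; apply/funext=> r; rewrite IH upd1 upd2; congr Rprod.
by apply/funext=> p'; apply/funext=> r'; rewrite upd_upd.
Qed.

Definition wt a := (\sum_k a k)%N.

Lemma wt_upd a p r :
  wt (upd i a p r) = (p + r + \sum_(k | (k != pos1 i) && (k != pos2 i)) a k)%N.
Proof.
rewrite /wt (bigD1 (pos1 i)) //= (bigD1 (pos2 i)) /= ?pos12 // upd1 upd2 addnA.
congr addn; apply: eq_bigr => k /andP[/negPf k1 /negPf k2].
by rewrite ffunE k1 k2.
Qed.

Lemma wt_upd_eq a p r : (p + r = a (pos1 i) + a (pos2 i))%N -> wt (upd i a p r) =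
  wt a.
Proof. by move=> E; rewrite -[in RHS](updK i a) !wt_upd E. Qed.

Lemma weight_coeff l x a : Vweight l x -> wt a != l -> mcoeff a x = 0.
Proof.
by move=> hx al; apply: mcoeff_outdom; apply/negP => /hx/eqP; rewrite (negPf al).
Qed.

Lemma opprod_off_weight l k x a : Vweight l x -> wt a != l -> mcoeff a (opprod k x)
  = 0.
Proof.
move=> hx al; rewrite mcoeff_opprod; apply: R2prod_zero (erefl _) => p r prm.
by apply: (weight_coeff hx); rewrite wt_upd_eq.
Qed.

Lemma opprod_kill l x : Vweight l x -> opprod l.+1 x = 0.
Proof.
move=> hx; apply/malgP=> a; rewrite mcoeff0.
have [al|al] := eqVneq (wt a) l; last exact: (opprod_off_weight _ hx).
rewrite mcoeff_opprod Rprod_kill_le // ltnS -al -{3}(updK i a) wt_upd.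
exact: leq_addr.
Qed.

Definition zeroidx : {ffun 'I_n -> nat} := [ffun=> 0%N].

Definition isupd a := a == upd i zeroidx (a (pos1 i)) (a (pos2 i)).

Lemma wt_zero p r : wt (upd i zeroidx p r) = (p + r)%N.
Proof. by rewrite wt_upd big1 ?addn0 // => k _; rewrite ffunE. Qed.

Lemma isupd_wt a : isupd a = (wt a == a (pos1 i) + a (pos2 i))%N.
Proof.
apply/eqP/eqP => [->|]; first by rewrite wt_zero upd1 upd2.
rewrite -{1}(updK i a) wt_upd -[RHS]addn0 => /addnI/eqP.
rewrite sum_nat_eq0 => /forallP h; apply/ffunP=> k; rewrite !ffunE.
have := h k; case: eqP => [->|_] //=; case: eqP => [->|_] //= /eqP.
exact.
Qed.

Definition topvec l : Vtens n :=
  \sum_(p < l.+1) topcoef p (l - p) *: vtens (upd i zeroidx p (l - p)).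

Lemma mcoeff_topvec l a : mcoeff a (topvec l) =
  if isupd a && (wt a == l) then topcoef (a (pos1 i)) (a (pos2 i)) else 0.
Proof.
rewrite /topvec raddf_sum /=.
case: ifP => [/andP[/eqP ua /eqP al]|h].
  have la : (a (pos1 i) + a (pos2 i) = l)%N by rewrite -al [in wt a]ua wt_zero.
  have lt1 : (a (pos1 i) < l.+1)%N by rewrite ltnS -la leq_addr.
  rewrite (bigD1 (Ordinal lt1)) //= big1 => [|p pne].
    by rewrite mcoeffZ mcoeffU -la addKn -ua eqxx mulr1 addr0.
  rewrite mcoeffZ mcoeffU; case: eqP => [E|_]; last by rewrite mulr0.
  by case/eqP: pne; apply: val_inj; rewrite /= -E upd1.
apply: big1 => p _; rewrite mcoeffZ mcoeffU; case: eqP => [E|_];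
  last by rewrite mulr0.
move: h; rewrite -E /isupd upd1 upd2 eqxx wt_zero subnKC ?eqxx //.
by rewrite -ltnS.
Qed.

Lemma topvec_weight l : Vweight l (topvec l).
Proof.
move=> a; rewrite -mcoeff_neq0 mcoeff_topvec.
by case: ifP => [/andP[_ /eqP <-]|_]; rewrite ?eqxx.
Qed.

Definition topidx l := upd i zeroidx 0%N l.

(** Components with weight less than l in the two factors are killed by one of
    the operators; in the part of weight l the other factors are v_0, and
    [Rprod_top] describes it. *)
Lemma opprod_top l x : Vweight l x ->
  opprod l x = mcoeff (topidx l) (opprod l x) *: topvec l.
Proof.
move=> hx; apply/malgP=> a; rewrite mcoeffZ mcoeff_topvec.
have [al|al] := eqVneq (wt a) l; last first.
  by rewrite andbF mulr0 (opprod_off_weight _ hx).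
rewrite andbT isupd_wt al; case: eqP => [la|ne].
  have ua : a = upd i zeroidx (a (pos1 i)) (a (pos2 i)).
    by apply/eqP; rewrite -[_ == _]/(isupd a) isupd_wt al la.
  rewrite !mcoeff_opprod upd1 upd2.
  have -> : (fun p r => mcoeff (upd i a p r) x) = (fun p r => mcoeff (upd i (topidx
    l) p r) x).
    by apply/funext=> p; apply/funext=> r; rewrite ua !upd_upd.
  by rewrite Rprod_top // mulrC.
rewrite mulr0 mcoeff_opprod Rprod_kill_le // ltn_neqAle; apply/andP; split.
  by apply/eqP => E; apply: ne.
by rewrite -al -{3}(updK i a) wt_upd leq_addr.
Qed.

Definition incr a (k : 'I_n) : {ffun 'I_n -> nat} :=
  [ffun j => if j == k then (a k).+1 else a j].

Lemma wt_incr a k : wt (incr a k) = (wt a).+1.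
Proof.
rewrite /wt (bigD1 k) //= [in RHS](bigD1 k) //= ffunE eqxx addSn; congr (_ + _).+1.
by apply: eq_bigr => j /negPf jk; rewrite ffunE jk.
Qed.

(** Two terms of E survive, those on the two factors of the generator, and they
    cancel by [Kwt_topcoef]. *)
Lemma topvec_E l : Eop (topvec l) = 0.
Proof.
apply/malgP=> a; rewrite mcoeff0 mcoeff_Eop.
rewrite (bigD1 (pos1 i)) //= [X in _ + X](bigD1 (pos2 i)) /= ?pos12 //.
rewrite [X in _ + (_ + X)]big1 ?addr0 => [|k /andP[k1 k2]]; last first.
  rewrite -/(incr a k) mcoeff_topvec isupd_wt wt_incr !ffunE ![_ == k]eq_sym (negPf
    k1) (negPf k2).
  case: ifP; rewrite ?mulr0 // => /andP[/eqP E _].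
  by have := leq_addr (\sum_(k | (k != pos1 i) && (k != pos2 i)) a k)
     (a (pos1 i) + a (pos2 i)); rewrite -(wt_upd a) updK -E ltnn.
rewrite -/(incr a (pos1 i)) -/(incr a (pos2 i)) !mcoeff_topvec !isupd_wt !wt_incr
  !ffunE !eqxx pos12 [pos1 i == _]eq_sym pos12.
rewrite addSn addnS; case: ifP => _; rewrite ?mulr0 ?addr0 //.
rewrite (bigD1 (pos2 i)) //= mulrAC.
have -> : \prod_(j < n | (i < j)%N && (j != pos2 i)) Kwt (a j) =
          \prod_(j < n | (pos2 i < j)%N) Kwt (a j).
  apply: eq_bigl => j; rewrite -[(j == _)]/(j == i.+1 :> nat) /= [RHS]ltn_neqAle
    andbC.
  by rewrite eq_sym.
by rewrite [X in _ + X]mulrC -mulrDl Kwt_topcoef mul0r.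
Qed.

Lemma topvec_W l : Wspace l (topvec l).
Proof. by split; [exact: topvec_E | exact: topvec_weight]. Qed.

End TopVector.

(** * Specialization of Laurent polynomials at q = 1, s = 2 *)

(** The value at q = 1 and s = 2, s being the outer variable. *)
Definition pt_eval (p : {poly {poly rat}}) : rat := p.[2%:R%:P].[1].

Lemma pt_evalD p r : pt_eval (p + r) = pt_eval p + pt_eval r.
Proof. by rewrite /pt_eval !hornerD. Qed.
Lemma pt_evalN p : pt_eval (- p) = - pt_eval p.
Proof. by rewrite /pt_eval !hornerN. Qed.
Lemma pt_evalM p r : pt_eval (p * r) = pt_eval p * pt_eval r.
Proof. by rewrite /pt_eval !hornerM. Qed.
Lemma pt_eval1 : pt_eval 1 = 1.
Proof. by rewrite /pt_eval !hornerE. Qed.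
Lemma pt_evalX p k : pt_eval (p ^+ k) = pt_eval p ^+ k.
Proof. by elim: k => [|k IH]; rewrite ?pt_eval1 // !exprS pt_evalM IH. Qed.
Lemma pt_eval_q : pt_eval ('X%:P) = 1.
Proof. by rewrite /pt_eval hornerC hornerX. Qed.
Lemma pt_eval_s : pt_eval 'X = 2%:R.
Proof. by rewrite /pt_eval hornerX hornerC. Qed.

(** A relation, because a Laurent polynomial is p / (q^a s^b) in many ways;
    [spec_rel_fun] says that the value does not depend on the choice. *)
Definition spec_rel (x : KK) (t : rat) : Prop := exists p a b,
  x * q ^+ a * s ^+ b = tofrac p /\ t * 2%:R ^+ b = pt_eval p.

Lemma two_neq0 : 2%:R != 0 :> rat. Proof. by []. Qed.

Lemma cross_mul (R : comPzRingType) (x a b c d : R) :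
  x * a * b * (c * d) = x * c * d * (a * b).
Proof. by ring. Qed.

Lemma cross_sub (R : comPzRingType) (x y a b c d : R) :
  (x - y) * (a * c) * (b * d) = x * a * b * (c * d) - y * c * d * (a * b).
Proof. by ring. Qed.

Lemma spec_rel_fun x t t' : spec_rel x t -> spec_rel x t' -> t = t'.
Proof.
move=> [p [a [b [xp tp]]]] [p' [a' [b' [xp' tp']]]].
have E : p * ('X%:P ^+ a' * 'X ^+ b') = p' * ('X%:P ^+ a * 'X ^+ b).
  apply/eqP; rewrite -tofrac_eq !tofracM -xp -xp' !tofracXn -/q -/s.
  by apply/eqP; apply: cross_mul.
have := congr1 pt_eval E.
rewrite !pt_evalM -tp -tp' !pt_evalX pt_eval_q pt_eval_s !expr1n !mul1r.
rewrite -!mulrA [_ ^+ b' * _]mulrC; apply: mulIf.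
by rewrite mulf_neq0 // expf_neq0.
Qed.

Lemma spec_rel_poly p : spec_rel (tofrac p) (pt_eval p).
Proof. by exists p, 0%N, 0%N; rewrite !expr0 !mulr1. Qed.

Lemma spec_relM x y t u : spec_rel x t -> spec_rel y u -> spec_rel (x * y) (t * u).
Proof.
move=> [p [a [b [xp tp]]]] [p' [a' [b' [xp' tp']]]].
exists (p * p'), (a + a')%N, (b + b')%N; split.
  by rewrite tofracM -xp -xp' !exprD (mulrACA x y) (mulrACA (x * _)).
by rewrite pt_evalM -tp -tp' exprD mulrACA.
Qed.

Lemma spec_relB x y t u : spec_rel x t -> spec_rel y u -> spec_rel (x - y) (t - u).
Proof.
move=> [p [a [b [xp tp]]]] [p' [a' [b' [xp' tp']]]].
exists (p * ('X%:P ^+ a' * 'X ^+ b') - p' * ('X%:P ^+ a * 'X ^+ b)), (a + a')%N, (b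
  + b')%N; split.
  rewrite tofracB !tofracM -xp -xp' !tofracXn -/q -/s !exprD.
  exact: cross_sub.
rewrite pt_evalD pt_evalN !pt_evalM !pt_evalX -tp -tp' pt_eval_q pt_eval_s !expr1n
  !mul1r exprD.
by rewrite mulrBl mulrA; congr (_ - _); rewrite -mulrA [_ * 2%:R ^+ b']mulrC.
Qed.

Lemma spec_rel_ex (x : LL) : exists t, spec_rel (val x) t.
Proof.
have /laurentP := valP x; elim=> {x} [|x y _ [t ht] _ [u hu]|x y _ [t ht] _ [u
  hu]||||].
- by exists (pt_eval 1); rewrite -tofrac1; apply: spec_rel_poly.
- by exists (t - u); apply: spec_relB.
- by exists (t * u); apply: spec_relM.
- by exists (pt_eval 'X%:P); apply: spec_rel_poly.
- exists 1, 1, 1%N, 0%N; rewrite expr1 !expr0 mulr1 mulVf ?tofrac1 ?pt_eval1 ?mulr1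
  //.
  exact: q_neq0.
- by exists (pt_eval 'X); apply: spec_rel_poly.
- exists 2%:R^-1, 1, 0%N, 1%N; rewrite !expr1 !expr0 mulr1 mulVf ?tofrac1 ?pt_eval1
  ?mulVf //.
  exact: s_neq0.
Qed.

Definition spec (x : LL) : rat := projT1 (cid (spec_rel_ex x)).

Lemma specP x : spec_rel (val x) (spec x).
Proof. exact: projT2 (cid (spec_rel_ex x)). Qed.

Fact spec_zmod : zmod_morphism spec.
Proof.
move=> x y; apply: spec_rel_fun (specP _) _.
by rewrite valLB; apply: spec_relB; apply: specP.
Qed.

Fact spec_monoid : monoid_morphism spec.
Proof.
split=> [|x y]; last first.
  apply: spec_rel_fun (specP _) _.
  by rewrite valLM; apply: spec_relM; apply: specP.
apply: spec_rel_fun (specP _) _.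
by have := spec_rel_poly 1; rewrite tofrac1 pt_eval1.
Qed.

HB.instance Definition _ := GRing.isZmodMorphism.Build LL rat spec spec_zmod.
HB.instance Definition _ := GRing.isMonoidMorphism.Build LL rat spec spec_monoid.

Lemma specD x y : spec (x + y) = spec x + spec y. Proof. exact: rmorphD. Qed.
Lemma specB x y : spec (x - y) = spec x - spec y. Proof. exact: rmorphB. Qed.
Lemma specN x : spec (- x) = - spec x. Proof. exact: rmorphN. Qed.
Lemma specM x y : spec (x * y) = spec x * spec y. Proof. exact: rmorphM. Qed.
Lemma specX x k : spec (x ^+ k) = spec x ^+ k. Proof. exact: rmorphXn. Qed.
Lemma spec1 : spec 1 = 1. Proof. exact: rmorph1. Qed.
Lemma specV x : x \is a GRing.unit -> spec x^-1 = (spec x)^-1.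
Proof. exact: rmorphV. Qed.

Lemma spec_q : spec qL = 1.
Proof.
apply: spec_rel_fun (specP _) _; rewrite -pt_eval_q; exact: spec_rel_poly.
Qed.

Lemma spec_s : spec sL = 2%:R.
Proof.
apply: spec_rel_fun (specP _) _; rewrite -pt_eval_s; exact: spec_rel_poly.
Qed.

Lemma spec_qV k : spec (qL ^ (- k%:Z)) = 1.
Proof. by rewrite -exprnN specV ?unitrX ?qL_unit // specX spec_q expr1n invr1. Qed.

Lemma spec_sV : spec sL^-1 = 2%:R^-1.
Proof. by rewrite specV ?sL_unit // spec_s. Qed.

(** At q = 1 the recursion for the q-binomial coefficients is Pascal's. *)
Lemma spec_qbinom a b (ab : (b <= a)%N) (x : LL) : val x = qbinom a b -> spec x =
  'C(a, b)%:R.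
Proof.
elim: a b ab x => [|a IH] [|b] //; rewrite ?bin0.
- move=> _ x xE; suff -> : x = 1 by rewrite spec1.
  by apply: LL_inj; rewrite xE qbinom_nn.
- move=> _ x xE; suff -> : x = 1 by rewrite spec1.
  apply: LL_inj; rewrite xE /qbinom subn0 /qfact (@big_geq _ _ _ 1 1) // mul1r
    mulfV //.
  exact: qfact_neq0.
rewrite ltnS leq_eqVlt => /orP[/eqP ->|ab] x xE.
  rewrite binn; suff -> : x = 1 by rewrite spec1.
  by apply: LL_inj; rewrite xE qbinom_nn.
have -> : x = qL ^+ b.+1 * Sub (qbinom a b.+1) (qbinom_laurent ab)
    + qL ^ (- (a - b)%:Z) * Sub (qbinom a b) (qbinom_laurent (ltnW ab)).
  by apply: LL_inj; rewrite xE qbinomS // valLD !valLM valLX val_qLV !SubK.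
rewrite specD !specM specX spec_q spec_qV expr1n !mul1r.
by rewrite (IH b.+1) // (IH b) 1?ltnW // -natrD binS.
Qed.

(** At q = 1 and s = 2 each factor s q^-x - s^-1 q^x becomes 3 / 2. *)
Definition Rcoef_q1 (i j m : nat) : rat := 2%:R^-1 ^+ (i + j) * 'C(m + j, j)%:R *
  (3%:R / 2%:R) ^+ m.

Lemma spec_Rcoef i j m : spec (Rcoef i j m) = Rcoef_q1 i j m.
Proof.
rewrite /Rcoef !specM specX spec_q expr1n mulr1.
rewrite (@spec_qbinom (m + j) j (leq_addl _ _) (qbinomL m j) (erefl _)) -exprnN.
rewrite specV ?unitrX ?sL_unit // specX spec_s -exprVn (big_morph _ specM spec1)
  /Rcoef_q1; congr (_ * _).
rewrite (eq_bigr (fun=> 3%:R / 2%:R)) => [|k _].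
  by rewrite big_const_nat subn0; elim: m => //= m ->; rewrite exprS.
by rewrite specB !specM specX spec_qV spec_q spec_s spec_sV expr1n.
Qed.

Lemma spec_topcoef p r : spec (topcoef p r) = (- 2%:R^-1) ^+ p.
Proof.
rewrite /topcoef !specM !specX spec_q expr1n mulr1 specN spec1 spec_sV.
by rewrite -exprMn mulN1r.
Qed.

Lemma spec_lam k : spec (lamL k) = (- 4%:R^-1) ^+ k.
Proof. by rewrite /lamL specM specX spec_topcoef spec_sV -exprMn mulrN. Qed.

(** * The Burau action at q = 1 *)

(** The nontrivial eigenvalue - s^-2 of the Burau matrices at s = 2. *)
Definition mu : rat := - 4%:R^-1.

Lemma R2prod_R2 (A : comNzRingType) c (lam : nat -> A) k f :
  R2prod c lam k (R2 c f) = R2 c (R2prod c lam k f).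
Proof.
elim: k => [|k IH] //=; apply/funext=> p; apply/funext=> r.
by rewrite R2_lin IH.
Qed.

Lemma R2prod_weight (A : comNzRingType) c (lam : nat -> A) k f g m :
  (forall p r, (p + r)%N = m -> f p r = g p r) ->
  forall p r, (p + r)%N = m -> R2prod c lam k f p r = R2prod c lam k g p r.
Proof.
move=> fg; elim: k => [|k IH] p r prm /=; first exact: fg.
by rewrite (R2_weight c IH) // IH.
Qed.

Lemma spec_R2 f p r : spec (R2 Rcoef f p r) = R2 Rcoef_q1 (fun p r => spec (f p r))
  p r.
Proof.
rewrite /R2 (big_morph _ specD (_ : spec 0 = 0)) ?raddf0 //.
by apply: eq_bigr => m _; rewrite specM spec_Rcoef.
Qed.

Lemma spec_Rprod k f p r : spec (Rprod k f p r) =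
  R2prod Rcoef_q1 (fun k => mu ^+ k) k (fun p r => spec (f p r)) p r.
Proof.
elim: k p r => [|k IH] p r //=.
rewrite specB specM spec_lam spec_R2 IH; congr (_ - _); congr R2.
by apply/funext=> p'; apply/funext=> r'; rewrite IH.
Qed.

Definition pw2 (a b : rat) (p r : nat) : rat := a ^+ p * b ^+ r.

Lemma binomial_term (R : comPzRingType) (h t d a x : R) p r m :
  h ^+ (r + p) * d * (t * h) ^+ m * (a ^+ (r + m) * x) =
  x * (t * h * a) ^+ m * d * h ^+ p * (a * h) ^+ r.
Proof. by rewrite !exprMn !exprD; ring. Qed.

(** The binomial theorem: at q = 1 the R-matrix substitutes linear forms. *)
Lemma R2_pw2 a b : R2 Rcoef_q1 (pw2 a b) = pw2 ((b + 3%:R / 2%:R * a) / 2%:R) (a /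
  2%:R).
Proof.
apply/funext=> p; apply/funext=> r; rewrite /pw2 [in RHS]exprMn exprDn !mulr_suml.
apply: eq_bigr => m _; have mp : (m <= p)%N by rewrite -ltnS.
rewrite /Rcoef_q1 /pw2 -addnA subnKC // bin_sub // -[X in _ = X * _ * _]mulr_natr.
exact: binomial_term.
Qed.

Lemma eigen_term (R : comPzRingType) (x m e y P : R) j c :
  (x * (m * e) ^+ j *+ c) * P - y * ((x * e ^+ j *+ c) * P) =
  (x * e ^+ j *+ c) * (P * (m ^+ j - y)).
Proof.
rewrite exprMn -[x * (m ^+ j * e ^+ j) *+ c]mulr_natr -[x * e ^+ j *+ c]mulr_natr.
by ring.
Qed.

(** The vector (2 al - et / 2, al + et) has coordinates al and et in an eigenbasis
    of the substitution of [R2_pw2], with eigenvalues 1 and mu; the operator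
    R2 - mu^i therefore multiplies the term in et^j by mu^j - mu^i. *)
Lemma R2prod_pw2 k l (al et : rat) :
  R2prod Rcoef_q1 (fun k => mu ^+ k) k (pw2 (2%:R * al - et / 2%:R) (al + et)) 0%N
    l =
  \sum_(j < l.+1) (al ^+ (l - j) * et ^+ j *+ 'C(l, j)) *
     \prod_(i < k) (mu ^+ j - mu ^+ i).
Proof.
elim: k et => [|k IH] et /=.
  rewrite /pw2 expr0 mul1r exprDn; apply: eq_bigr => j _.
  by rewrite big_ord0 mulr1.
rewrite -R2prod_R2 R2_pw2.
have -> : (al + et + 3%:R / 2%:R * (2%:R * al - et / 2%:R)) / 2%:R = 2%:R * al -
  (mu * et) / 2%:R.
  by rewrite /mu; field.
have -> : (2%:R * al - et / 2%:R) / 2%:R = al + mu * et by rewrite /mu; field.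
rewrite !IH mulr_sumr -sumrB; apply: eq_bigr => j _.
rewrite big_ord_recr; exact: eigen_term.
Qed.

Lemma mu_neq i j : (i < j)%N -> mu ^+ j - mu ^+ i != 0.
Proof.
move=> ij; have mu0 : mu != 0 by [].
rewrite subr_eq0 -(subnK (ltnW ij)) exprD -[X in _ != X]mul1r (inj_eq (mulIf _));
  last first.
  by rewrite expf_neq0.
have k0 : (0 < j - i)%N by rewrite subn_gt0.
apply/eqP => /(congr1 Num.norm) /eqP.
by rewrite Num.Theory.normrX Num.Theory.normr1 Num.Theory.pexpr_eq1 //
  Num.Theory.normr_ge0.
Qed.

(** In [R2prod_pw2_top], 2 / 5 (2 b - a) is the coordinate of (a, b) along the
    eigenvector for mu. *)
Definition topcst (l : nat) : rat :=
  (2%:R / 5%:R) ^+ l * \prod_(i < l) (mu ^+ l - mu ^+ i).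

Lemma topcst_neq0 l : topcst l != 0.
Proof.
rewrite mulf_neq0 ?expf_neq0 //; apply/prodf_neq0 => i _; exact: mu_neq.
Qed.

Lemma pow_cancel (R : comPzRingType) (h k e P : R) n : h * k = 1 ->
  e ^+ n * P = h ^+ n * P * (k * e) ^+ n.
Proof.
move=> hk; have hkn : h ^+ n * k ^+ n = 1 by rewrite -exprMn hk expr1n.
transitivity (h ^+ n * k ^+ n * (e ^+ n * P)); first by rewrite hkn mul1r.
by rewrite exprMn; ring.
Qed.

Lemma R2prod_pw2_top l (a b : rat) :
  R2prod Rcoef_q1 (fun k => mu ^+ k) l (pw2 a b) 0%N l = topcst l * (2%:R * b - a)
    ^+ l.
Proof.
pose et := 2%:R / 5%:R * (2%:R * b - a); pose al := b - et.
have -> : a = 2%:R * al - et / 2%:R by rewrite /al /et; field.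
have -> : b = al + et by rewrite /al subrK.
rewrite R2prod_pw2 (bigD1 ord_max) //= [X in _ + X]big1 ?addr0 => [|j jl];
  last first.
  have jl' : (j < l)%N.
    rewrite ltn_neqAle -ltnS (ltn_ord j) andbT.
    by apply: contra jl => /eqP jl; apply/eqP/val_inj.
  by rewrite (bigD1 (Ordinal jl')) //= subrr mul0r mulr0.
rewrite subnn expr0 mul1r binn mulr1n.
have -> : 2%:R * (al + et) - (2%:R * al - et / 2%:R) = 5%:R / 2%:R * et by field.
exact: pow_cancel.
Qed.

Section Burau.
Variable n : nat.
Implicit Types (y : 'I_n -> rat) (a : {ffun 'I_n -> nat}) (i : 'I_n.-1).

(** In degree l, the coefficients of the l-th divided power of the linear form with
    coefficients y, when v_j is identified with x^j / j!. *)
Definition pw y a : rat := \prod_k y k ^+ a k.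

(** The eigenvector of [burau i] for the eigenvalue mu. *)
Definition rootvec i : 'I_n -> rat :=
  fun k => if k == pos1 i then - 2%:R^-1 else if k == pos2 i then 1 else 0.

Definition coroot i y : rat := 2%:R * y (pos2 i) - y (pos1 i).

Definition burau i y : 'I_n -> rat := fun k => y k - 2%:R^-1 * coroot i y * rootvec
  i k.

Lemma pw_upd y i a p r : pw y (upd i a p r) =
  pw2 (y (pos1 i)) (y (pos2 i)) p r * \prod_(k | (k != pos1 i) && (k != pos2 i)) y
    k ^+ a k.
Proof.
rewrite /pw (bigD1 (pos1 i)) //= (bigD1 (pos2 i)) /= ?pos12 // upd1 upd2 mulrA;
  congr (_ * _).
by apply: eq_bigr => k /andP[/negPf k1 /negPf k2]; rewrite ffunE k1 k2.
Qed.

Lemma pw_burau y i a : pw (burau i y) a =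
  R2 Rcoef_q1 (fun p r => pw y (upd i a p r)) (a (pos1 i)) (a (pos2 i)).
Proof.
rewrite -{1}(updK i a) pw_upd.
have -> : burau i y (pos1 i) = (y (pos2 i) + 3%:R / 2%:R * y (pos1 i)) / 2%:R.
  by rewrite /burau /rootvec eqxx /coroot; field.
have -> : burau i y (pos2 i) = y (pos1 i) / 2%:R.
  by rewrite /burau /rootvec pos12 eqxx /coroot; field.
rewrite -R2_pw2 {1}/R2 mulr_suml; apply: eq_bigr => m _; rewrite pw_upd -mulrA.
do 2![congr (_ * _)]; apply: eq_bigr => k /andP[/negPf k1 /negPf k2].
by rewrite /burau /rootvec k1 k2 mulr0 subr0.
Qed.

(** At q = 1, s = 2 the part of weight l of x is the divided power of y. *)
Definition models l (x : Vtens n) y := forall a, wt a = l -> spec (mcoeff a x) = pw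
  y a.

Lemma models_Rop l x y i : models l x y -> models l (Rop i x) (burau i y).
Proof.
move=> xy a al; rewrite mcoeff_Rop spec_R2 pw_burau.
by apply: R2_weight (erefl _) => p r prm; rewrite xy // wt_upd_eq.
Qed.

Lemma models_topvec l i : models l (topvec i l) (rootvec i).
Proof.
move=> a al; rewrite mcoeff_topvec al eqxx andbT.
case: ifP => [/eqP E|].
  rewrite spec_topcoef [in RHS]E pw_upd big1 ?mulr1 => [|k _];
    last by rewrite ffunE.
  by rewrite /pw2 /rootvec eqxx pos12 eqxx expr1n mulr1.
rewrite raddf0 => /negP h; symmetry; apply/eqP; rewrite prodf_seq_eq0.
apply/hasP; have /existsP[k /and3P[k1 k2 ak]] :
  [exists k, [&& k != pos1 i, k != pos2 i & a k != 0%N]].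
  apply: contraT => /existsPn H; case: h; apply/eqP/ffunP=> k.
  rewrite !ffunE; have := H k; case: eqP => [->|_] //=; case: eqP => [->|_] //=.
  by rewrite negbK => /eqP.
exists k; first by rewrite mem_index_enum.
by rewrite /= expf_eq0 lt0n ak /rootvec (negPf k1) (negPf k2) eqxx.
Qed.

Definition opword (g : seq 'I_n.-1) (x : Vtens n) := foldr (@Rop n) x g.
Definition burau_word (g : seq 'I_n.-1) y := foldr burau y g.

Lemma models_word l x y g : models l x y -> models l (opword g x) (burau_word g y).
Proof. by move=> xy; elim: g => //= i g; apply: models_Rop. Qed.

Lemma spec_opprod l i x y : models l x y ->
  spec (mcoeff (topidx i l) (opprod i l x)) = topcst l * coroot i y ^+ l.
Proof.
move=> xy; rewrite mcoeff_opprod spec_Rprod /topidx upd1 upd2 -R2prod_pw2_top.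
apply: (@R2prod_weight _ _ _ _ _ _ l _ 0%N l (add0n l)) => p r prl.
rewrite upd_upd xy ?wt_zero // pw_upd big1 ?mulr1 // => k _.
by rewrite ffunE.
Qed.

End Burau.

(** * The invariant form of the reduced Burau representation *)

Lemma poly_eq0_of_roots (F : fieldType) (p : {poly F}) (x : nat -> F) :
  injective x -> (forall k, p.[x k] = 0) -> p = 0.
Proof.
move=> xinj px; apply/eqP/negPn/negP => p0.
have := max_poly_roots p0 (_ : all (root p) (map x (iota 0 (size p)))).
rewrite map_inj_uniq // iota_uniq size_map size_iota ltnn => H.
suff : false by []; apply: H => //.
by apply/allP => _ /mapP[k _ ->]; apply/rootP.
Qed.

Lemma natrat_inj : injective (fun k => k%:R : rat).
Proof. by move=> i j /eqP; rewrite Num.Theory.eqr_nat => /eqP. Qed.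

Lemma mu_pow_inj : injective (fun k => mu ^+ k).
Proof.
move=> i j /eqP; rewrite -subr_eq0; case: (ltngtP i j) => // ij.
  by rewrite -oppr_eq0 opprB (negPf (mu_neq ij)).
by rewrite (negPf (mu_neq ij)).
Qed.

Section Orbit.
Variable m : nat.
Implicit Types (t v z : 'rV[rat]_m.+1) (i j : 'I_m.+1).

Definition rootv j : 'I_m.+2 -> rat := @rootvec m.+2 j.
Definition corootv i (y : 'I_m.+2 -> rat) : rat := @coroot m.+2 i y.

(** The reduced Burau representation in the basis of the root vectors. *)
Definition yvec t : 'I_m.+2 -> rat := fun k => \sum_j t 0 j * rootv j k.

Lemma rootvE j (k : 'I_m.+2) : rootv j k = (k == j.+1 :> nat)%:R - 2%:R^-1 * (k ==
  j :> nat)%:R.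
Proof.
rewrite /rootv /rootvec -!val_eqE /=; case: eqP => [->|_] /=.
  by rewrite ltn_eqF // mulr1 sub0r.
by rewrite mulr0 subr0; case: eqP.
Qed.

Lemma coroot_rootv i j : corootv i (rootv j) = 5%:R / 2%:R * (i == j :> nat)%:R
   - (i.+1 == j :> nat)%:R - (i == j.+1 :> nat)%:R.
Proof.
rewrite /corootv /coroot !rootvE /= eqSS.
move: ((i == j :> nat)%:R : rat) ((i.+1 == j :> nat)%:R : rat) => a b.
by move: ((i == j.+1 :> nat)%:R : rat) => c; field.
Qed.

Definition gram : 'M[rat]_m.+1 := \matrix_(i, j) corootv i (rootv j).

Lemma gram_sym : gram^T = gram.
Proof.
apply/matrixP=> i j; rewrite !mxE !coroot_rootv (eq_sym (nat_of_ord j) i).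
by rewrite (eq_sym j.+1) (eq_sym (nat_of_ord j) i.+1) addrAC.
Qed.

Lemma corootv_yvec i t : corootv i (yvec t) = (t *m gram) 0 i.
Proof.
rewrite -gram_sym mxE /corootv /coroot /yvec mulr_sumr -sumrB;
  apply: eq_bigr => j _.
by rewrite !mxE /corootv /coroot mulrBr mulrCA.
Qed.

Definition burau_coord i t : 'rV[rat]_m.+1 := t - (2%:R^-1 * (t *m gram) 0 i) *:
  delta_mx 0 i.

Lemma burau_coordE i t j : burau_coord i t 0 j = t 0 j - 2%:R^-1 * (t *m gram) 0 i
  * (j == i)%:R.
Proof. by rewrite /burau_coord; move: (_ * _) => c; rewrite !mxE eqxx. Qed.

Lemma yvec_burau_coord i t : yvec (burau_coord i t) = burau (i : 'I_m.+2.-1) (yvec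
  t).
Proof.
apply/funext=> k; rewrite /burau -/(corootv i _) corootv_yvec /yvec.
under eq_bigr => j _ do rewrite burau_coordE mulrBl.
rewrite sumrB; congr (_ - _); rewrite (bigD1 i) //= big1 ?addr0 => [|j /negPf ji].
  by rewrite eqxx mulr1.
by rewrite ji mulr0 mul0r.
Qed.

Definition coord_word (g : seq 'I_m.+1) t := foldr burau_coord t g.

Lemma yvec_coord_word g t : yvec (coord_word g t) = burau_word (g : seq 'I_m.+2.-1)
  (yvec t).
Proof. by elim: g => //= i g IH; rewrite yvec_burau_coord IH. Qed.

Definition coord0 : 'rV[rat]_m.+1 := delta_mx 0 0.

Lemma yvec_coord0 : yvec coord0 = rootv 0.
Proof.
apply/funext=> k; rewrite /yvec (bigD1 0) //= big1 ?addr0 => [|j j0].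
  by rewrite mxE !eqxx mul1r.
by rewrite mxE (negPf j0) mul0r.
Qed.

Lemma burau_coord_gram i t v : burau_coord i t *m gram *m v^T = t *m gram *m
  (burau_coord i v)^T.
Proof.
rewrite /burau_coord mulmxBl mulmxBl linearB mulmxBr; congr (_ - _).
rewrite -!scalemxAl linearZ -scalemxAr /= trmx_delta.
have h1 : delta_mx 0 i *m gram *m v^T = ((v *m gram) 0 i)%:M.
  transitivity (v *m gram *m (delta_mx i 0 : 'cV_m.+1))^T.
    by rewrite !trmx_mul trmx_delta gram_sym mulmxA.
  by rewrite -colE [LHS]mx11_scalar mxE [in LHS]mxE.
have h2 : t *m gram *m (delta_mx i 0 : 'cV_m.+1) = ((t *m gram) 0 i)%:M.
  by rewrite -colE [LHS]mx11_scalar [in LHS]mxE.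
by rewrite h1 h2 !scale_scalar_mx; congr (_%:M); rewrite -!mulrA; congr (_ * _);
  rewrite mulrC.
Qed.

(** The Burau reflections are self-adjoint for the form, so a word is adjoint to
    the reversed word. *)
Lemma coord_word_gram g t v : coord_word (rev g) t *m gram *m v^T = t *m gram *m
  (coord_word g v)^T.
Proof.
elim: g t v => [|i g IH] t v //.
by rewrite rev_cons -cats1 /coord_word foldr_cat /= -/(coord_word _ _) IH
  -burau_coord_gram.
Qed.

(** If t is in the radical of the form, then y = yvec t satisfies y_k = 2 y_(k+1),
    so that y_k is 2^(m+1-k) times the last entry.  On the span of the root vectors
    the sum of the 2^(m+1-k) y_k vanishes; it is here a sum of squares times the
    last entry.  Hence y = 0, and t = 0 by triangularity. *)
Lemma gram_unit : gram \in unitmx.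
Proof.
rewrite -row_free_unit -kermx_eq0; apply/rowV0P => t /sub_kermxP tG.
have y2 i : yvec t (@pos1 m.+2 i) = 2%:R * yvec t (@pos2 m.+2 i).
  have := corootv_yvec i t; rewrite tG mxE /corootv /coroot => /eqP.
  by rewrite subr_eq0 => /eqP ->.
(* inord (m.+1 - k) is the k-th index from the end. *)
have yk k (km : (k <= m.+1)%N) : yvec t (inord (m.+1 - k)) = 2%:R ^+ k * yvec t
  ord_max.
  elim: k km => [|k IH] km.
    by rewrite expr0 mul1r; congr yvec; apply: val_inj; rewrite /= subn0 inordK.
  have ltk : (m.+1 - k.+1 < m.+1)%N by lia.
  have := y2 (Ordinal ltk).
  have -> : @pos1 m.+2 (Ordinal ltk) = inord (m.+1 - k.+1).
    by apply: val_inj; rewrite /= inordK //; lia.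
  have -> : @pos2 m.+2 (Ordinal ltk) = inord (m.+1 - k).
    by apply: val_inj; rewrite /= inordK //; lia.
  by move=> ->; rewrite IH ?exprS ?mulrA // ltnW.
have psi : \sum_(k < m.+2) 2%:R ^+ (m.+1 - k) * yvec t k = 0.
  rewrite /yvec; under eq_bigr => k _ do rewrite mulr_sumr.
  rewrite exchange_big big1 //= => j _.
  rewrite (bigD1 (@pos1 m.+2 j)) //= (bigD1 (@pos2 m.+2 j)) /= ?pos12 // big1
    ?addr0; last first.
    by move=> k /andP[/negPf k1 /negPf k2]; rewrite /rootv /rootvec k1 k2 !mulr0.
  rewrite /rootv /rootvec !eqxx pos12 (_ : m.+1 - j = (m.+1 - j.+1).+1)%N;
    last by have := ltn_ord j; lia.
  by rewrite exprS; field.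
have ymax0 : yvec t ord_max = 0.
  have : \sum_(k < m.+2) 2%:R ^+ (m.+1 - k) * yvec t k
    = (\sum_(k < m.+2) (2%:R ^+ (m.+1 - k)) ^+ 2) * yvec t ord_max.
    rewrite mulr_suml; apply: eq_bigr => k _; rewrite expr2 -mulrA; congr (_ * _).
    rewrite -yk ?leq_subr // subKn; last by rewrite -ltnS.
    by congr yvec; apply: val_inj; rewrite /= inordK.
  rewrite psi => /esym/eqP; rewrite mulf_eq0 => /orP[|/eqP //].
  rewrite Num.Theory.psumr_eq0 => [|k _]; last by rewrite Num.Theory.sqr_ge0.
  by move=> /allP/(_ ord0 (mem_index_enum _));
    rewrite /= (negPf (expf_neq0 _ (expf_neq0 _ two_neq0))).
have y0 k : yvec t k = 0.
  have := yk (m.+1 - k)%N (leq_subr _ _); rewrite subKn; last by rewrite -ltnS.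
  rewrite ymax0 mulr0 => <-; congr yvec; apply: val_inj; by rewrite /= inordK.
suff t0 : forall k (j : 'I_m.+1), (j < k)%N -> t 0 j = 0.
  by apply/rowP=> j; rewrite mxE (t0 m.+1).
elim=> // k IH j; rewrite ltnS leq_eqVlt => /orP[/eqP jk|]; last exact: IH.
have := y0 (@pos1 m.+2 j); rewrite /yvec (bigD1 j) //= big1 ?addr0 => [|i ij].
  rewrite /rootv /rootvec eqxx => /eqP; rewrite mulf_eq0 => /orP[/eqP //|].
  by rewrite oppr_eq0 invr_eq0.
have [lt|gt|E] := ltngtP i j.
- by rewrite IH ?mul0r // -jk.
- by rewrite rootvE /= !ltn_eqF ?mulr0 ?subr0 ?mulr0 // ltnW // ltnS.
by move: ij; rewrite -val_eqE /= E eqxx.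
Qed.

End Orbit.

(** * Zariski density of the orbit of a root *)

Section Closure.
Variable m : nat.
Implicit Types (t v z : 'rV[rat]_m.+1) (i j : 'I_m.+1) (f : 'rV[rat]_m.+1 -> rat).

(** The only property of polynomial functions that the density argument uses. *)
Definition line_poly f := forall t v, exists p : {poly rat}, forall c, f (t + c *:
  v) = p.[c].

Lemma gram_lin i t c v : ((t + c *: v) *m gram m) 0 i =
  (t *m gram m) 0 i + c * (v *m gram m) 0 i.
Proof. by rewrite mulmxDl -scalemxAl mxE [X in _ + X]mxE. Qed.

Lemma burau_coord_lin i t c v : burau_coord i (t + c *: v) = burau_coord i t + c *:
  burau_coord i v.
Proof.
rewrite /burau_coord gram_lin.
move: (2%:R^-1) (_ 0 i) (_ 0 i) => h x y.
by rewrite mulrDr scalerDl opprD addrACA scalerBr scalerA (mulrCA h).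
Qed.

Lemma line_poly_burau_coord f i : line_poly f -> line_poly (f \o burau_coord i).
Proof. by move=> hf t v; have [p hp] := hf (burau_coord i t) (burau_coord i v);
  exists p => c /=; rewrite burau_coord_lin. Qed.

(** The points at which every such function vanishing on the orbit of [coord0]
    vanishes. *)
Definition zclosure t := forall f, line_poly f ->
  (forall g, f (coord_word g (coord0 m)) = 0) -> f t = 0.

Lemma zclosure_iter i k t : zclosure t -> zclosure (iter k (burau_coord i) t).
Proof.
elim: k => //= k IH zt f hf fg; apply: (IH zt (f \o burau_coord i));
  first exact: line_poly_burau_coord.
by move=> g; apply: (fg (i :: g)).
Qed.

Lemma gram_diag i : gram m i i = 5%:R / 2%:R.
Proof. by rewrite mxE coroot_rootv eqxx [i.+1 == _]eq_sym ltn_eqF // !subr0 mulr1.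
  Qed.

Lemma delta_gram i : ((delta_mx 0 i : 'rV_m.+1) *m gram m) 0 i = 5%:R / 2%:R.
Proof. by rewrite -rowE mxE gram_diag. Qed.

Lemma iter_burau_coord i k t : iter k (burau_coord i) t =
  t + (2%:R / 5%:R * (mu ^+ k - 1) * (t *m gram m) 0 i) *: delta_mx 0 i.
Proof.
elim: k => [|k IH] /=; first by rewrite expr0 subrr mulr0 mul0r scale0r addr0.
rewrite IH /burau_coord gram_lin delta_gram exprS.
move: ((t *m gram m) 0 i) (mu ^+ k) (delta_mx 0 i) => x y d.
suff -> : 2%:R / 5%:R * (mu * y - 1) * x =
    2%:R / 5%:R * (y - 1) * x - 2%:R^-1 * (x + 2%:R / 5%:R * (y - 1) * x * (5%:R /
      2%:R)).
  by rewrite scalerBl addrA.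
by rewrite /mu; field.
Qed.

(** The iterates of a reflection move t along a line, through the infinitely many
    multiples mu^k - 1 of one vector. *)
Lemma zclosure_add i c t : zclosure t ->
  zclosure (t + (c * (t *m gram m) 0 i) *: delta_mx 0 i).
Proof.
move=> zt f hf fg.
have [p hp] := hf t ((t *m gram m) 0 i *: delta_mx 0 i).
rewrite -scalerA hp; suff -> : p = 0 by rewrite horner0.
apply: (@poly_eq0_of_roots _ p (fun k => 2%:R / 5%:R * (mu ^+ k - 1))).
  have h : 2%:R / 5%:R != 0 :> rat by [].
  by move=> k k' /(mulfI h) /addIr /mu_pow_inj.
move=> k; rewrite -hp scalerA -iter_burau_coord.
exact: (zclosure_iter i k zt hf fg).
Qed.

Definition trunc k t : 'rV[rat]_m.+1 := \row_j (if (j <= k)%N then t 0 j else 0).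

Lemma trunc_gram k t (km : (k.+1 < m.+1)%N) :
  (trunc k t *m gram m) 0 (Ordinal km) = - t 0 (inord k).
Proof.
have ltk : (k < m.+1)%N by apply: ltnW.
rewrite mxE (bigD1 (inord k)) //= big1 ?addr0 => [|j jk].
  rewrite !mxE coroot_rootv /= !inordK // leqnn eqxx ltn_eqF // ltn_eqF //.
  by rewrite mulr0 sub0r subr0 mulrN mulr1.
rewrite mxE; case: leqP => [jk'|_]; last by rewrite mul0r.
have jk2 : (j < k)%N.
  by rewrite ltn_neqAle jk' andbT; apply: contra jk => /eqP E; apply/eqP/val_inj;
    rewrite /= inordK.
rewrite mxE coroot_rootv /= !ltn_eqF ?subr0 ?mulr0 //; lia.
Qed.

(** Starting from the first root, the reflections create the coordinates one after
    the other: the form of the truncation with the next root is - t_k, which is not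
    zero. *)
Lemma zclosure_trunc k t : (k < m.+1)%N -> (forall j, t 0 j != 0) -> zclosure
  (trunc k t).
Proof.
move=> km tn0; elim: k km => [|k IH] km.
  have -> : trunc 0 t = coord0 m + (2%:R / 5%:R * (t 0 0 - 1) * (coord0 m *m gram
    m) 0 0) *: delta_mx 0 0.
    rewrite delta_gram (_ : 2%:R / 5%:R * _ * _ = t 0 0 - 1); last by field.
    rewrite /coord0 scalerBl scale1r addrC subrK; apply/rowP=> j;
      rewrite !mxE leqn0 eqxx /=.
    case: (j =P 0) => [->|/eqP j0]; first by rewrite eqxx mulr1.
    by rewrite -[(_ == 0)%N]/(j == 0) (negPf j0) mulr0.
  by apply: zclosure_add => f _ /(_ [::]).
have := @zclosure_add (Ordinal km) (- (t 0 (Ordinal km) / t 0 (inord k))) _ (IH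
  (ltnW km)).
rewrite trunc_gram mulrNN divfK //; congr zclosure.
apply/rowP=> j; rewrite !mxE eqxx /= -val_eqE /= [(j <= k.+1)%N]leq_eqVlt ltnS.
case: eqP => [jk|_] /=; last by rewrite mulr0 addr0.
by rewrite leqNgt jk ltnSn /= add0r mulr1; congr (t _ _); apply: val_inj.
Qed.

(** By [zclosure_trunc] a function vanishing on the orbit vanishes at the points
    without zero coordinate.  A line through (1, ..., 1) and t has all but finitely
    many of its points of this kind. *)
Lemma closure_all f : line_poly f -> (forall g, f (coord_word g (coord0 m)) = 0) ->
  forall t, f t = 0.
Proof.
move=> hf fg.
have hf0 t : (forall j, t 0 j != 0) -> f t = 0.
  move=> tn0; have := zclosure_trunc (ltnSn m) tn0 hf fg.
  suff -> : trunc m t = t by [].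
  by apply/rowP=> j; rewrite mxE -ltnS ltn_ord.
move=> t; pose one : 'rV[rat]_m.+1 := const_mx 1.
have [p hp] := hf one (t - one).
(* The roots of r are the parameters at which the line leaves the good set. *)
pose r : {poly rat} := \prod_j (1 + (t 0 j - 1) *: 'X).
have rE c : r.[c] = \prod_j (one + c *: (t - one)) 0 j.
  rewrite horner_prod; apply: eq_bigr => j _.
  by rewrite !mxE !hornerE mulrC.
have r0 : r != 0.
  apply/eqP => r0; have := rE 0; rewrite r0 horner0 big1 => [/eqP|j _].
    by rewrite eq_sym oner_eq0.
  by rewrite scale0r addr0 mxE.
have /eqP : p * r = 0.
  apply: (poly_eq0_of_roots natrat_inj) => k; rewrite hornerM rE -hp.
  have [/eqP/prodf_eq0[j _ /eqP E]|ne] := eqVneq (\prod_j (one + k%:R *: (t - one))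
    0 j) 0.
    by rewrite (bigD1 j) //= E mul0r mulr0.
  by rewrite hf0 ?mul0r // => j; apply/(prodf_neq0 _ _ ne).
rewrite mulf_eq0 (negPf r0) orbF => /eqP p0.
have := hp 1; rewrite p0 horner0 scale1r addrC subrK; exact.
Qed.

End Closure.

(** * Powers of linear forms *)

(** Uniqueness of the expansion in base B. *)
Lemma digits_inj n B (a b : 'I_n -> nat) :
  (forall i, a i < B)%N -> (forall i, b i < B)%N ->
  (\sum_i a i * B ^ i = \sum_i b i * B ^ i)%N -> a =1 b.
Proof.
elim: n a b => [|n IH] a b aB bB; first by move=> _ [].
rewrite !big_ord_recl /= !expn0 !muln1.
have shift (c : 'I_n.+1 -> nat) :
    (\sum_(i < n) c (lift ord0 i) * B ^ lift ord0 i =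
     (\sum_(i < n) c (lift ord0 i) * B ^ i) * B)%N.
  by rewrite big_distrl; apply: eq_bigr => i _; rewrite /= /bump add1n expnSr mulnA.
rewrite !shift => E.
have B0 : (0 < B)%N by apply: leq_ltn_trans (aB ord0).
have E0 : a ord0 = b ord0.
  have := congr1 (modn^~ B) E.
  by rewrite ![(_ ord0 + _)%N]addnC !modnMDl !modn_small.
move: E; rewrite E0 => /addnI/eqP; rewrite eqn_pmul2r // => /eqP E i.
have H := IH (fun j => a (lift ord0 j)) (fun j => b (lift ord0 j))
  (fun j => aB _) (fun j => bB _) E.
by case: (unliftP ord0 i) => [j|] ->; [apply: H | apply: E0].
Qed.

(** As long as the chosen rows do not span, some column vector annihilates them,
    and by hypothesis it does not annihilate every h y. *)
Lemma select_unitmx (F : fieldType) (Y : Type) N (h : Y -> 'rV[F]_N) :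
  (forall c : 'cV[F]_N, (forall y, h y *m c = 0) -> c = 0) ->
  exists y : 'I_N -> Y, (\matrix_i h (y i)) \in unitmx.
Proof.
move=> hc.
suff H r : (r <= N)%N -> exists y : 'I_r -> Y, row_free (\matrix_i h (y i)).
  by have [y hy] := H N (leqnn _); exists y; rewrite -row_free_unit.
elim: r => [|r IH] rN.
  by exists (fun i : 'I_0 => match i with Ordinal _ h => False_rect _ (notF h)
    end); rewrite /row_free -leqn0 rank_leq_row.
have [y hy] := IH (ltnW rN); set M := \matrix_i h (y i) in hy.
have [z hz] : exists z, ~~ (h z <= M)%MS.
  apply: contrapT => /forallNP hz.
  have MN : (\rank (cokermx M) != 0)%N.
    by rewrite mxrank_coker subn_eq0 -ltnNge (eqP hy).
  case/negP: MN; rewrite mxrank_eq0; apply/eqP/matrixP=> i j; rewrite [RHS]mxE.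
  have /colP/(_ i) : col j (cokermx M) = 0.
    apply: hc => z; rewrite colE mulmxA; have /negP/negPn := hz z.
    by rewrite submxE => /eqP ->; rewrite mul0mx.
  by rewrite !mxE.
exists (fun i : 'I_(r.+1) => if unlift ord0 i is Some j then y j else z).
set M' := \matrix_i _.
rewrite -row_leq_rank; have lt : (M < h z + M)%MS.
  by rewrite ltmxE addsmxSr /=; apply: contra hz; apply: submx_trans (addsmxSl _ _).
apply: leq_trans (mxrankS (_ : h z + M <= M')%MS);
  first by rewrite -{1}(eqP hy) rank_ltmx.
rewrite addsmx_sub; apply/andP; split.
  have -> : h z = row ord0 M' by rewrite rowK unlift_none.
  exact: row_sub.
apply/row_subP => k; have -> : row k M = row (lift ord0 k) M' by rewrite !rowK
  liftK.
exact: row_sub.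
Qed.

Section Monomials.
Variables (m l : nat).
Implicit Types (t z : 'rV[rat]_m.+1) (tau : (m.+1).-tuple 'I_l.+1).

Definition exponents : {set (m.+1).-tuple 'I_l.+1} := [set tau : (m.+1).-tuple
  'I_l.+1 | \sum_(i <- tau) i == l]%N.

Lemma card_exponents : #|exponents| = 'C(m + l, m).
Proof. exact: card_ord_partitions. Qed.

Definition mono tau t : rat := \prod_i t 0 i ^+ tnth tau i.

(** Kronecker's substitution t_i = z^((l + 1)^i) sends distinct monomials to
    distinct powers of z. *)
Lemma mono_indep (c : (m.+1).-tuple 'I_l.+1 -> rat) :
  (forall t, \sum_(tau in exponents) c tau * mono tau t = 0) ->
  forall tau, tau \in exponents -> c tau = 0.
Proof.
move=> hc; pose e (tau : (m.+1).-tuple 'I_l.+1) := (\sum_i tnth tau i * l.+1 ^ i)%N.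
have einj : injective e.
  move=> t1 t2 /digits_inj H; apply: eq_from_tnth => i; apply: val_inj.
  exact: (H (fun i => ltn_ord _) (fun i => ltn_ord _)).
pose p : {poly rat} := \sum_(tau in exponents) c tau *: 'X^(e tau).
have p0 : p = 0.
  apply: (poly_eq0_of_roots natrat_inj) => k; rewrite horner_sum.
  rewrite -[RHS](hc (\row_i k%:R ^+ (l.+1 ^ i))); apply: eq_bigr => tau _.
  rewrite hornerZ hornerXn /mono /e -prodrXr; congr (_ * _); apply: eq_bigr => i _.
  by rewrite mxE -exprM mulnC.
move=> tau htau; have := congr1 (fun p : {poly rat} => p`_(e tau)) p0.
rewrite coef0 coef_sum (bigD1 tau) //= big1 ?addr0 => [|tau' /andP[_ ne]].
  by rewrite coefZ coefXn eqxx mulr1.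
by rewrite coefZ coefXn (inj_eq einj) eq_sym (negPf ne) mulr0.
Qed.

Definition fibre_card (phi : {ffun 'I_l -> 'I_m.+1}) i := #|[set k | phi k == i]|.

Definition fibre_type (phi : {ffun 'I_l -> 'I_m.+1}) : (m.+1).-tuple 'I_l.+1 :=
  [tuple inord (fibre_card phi i) | i < m.+1].

Lemma tnth_fibre_type phi i : tnth (fibre_type phi) i = fibre_card phi i :> nat.
Proof.
rewrite tnth_mktuple inordK // ltnS -[X in (_ <= X)%N](card_ord l); exact: max_card.
Qed.

Lemma sum_tuple tau : (\sum_(i <- tau) i = \sum_i tnth tau i)%N.
Proof. by rewrite big_tuple. Qed.

Lemma fibre_type_exponents phi : fibre_type phi \in exponents.
Proof.
rewrite inE sum_tuple; apply/eqP; under eq_bigr => i _ do rewrite tnth_fibre_type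
  /fibre_card -sum1_card.
rewrite -[RHS]card_ord -sum1_card (partition_big phi xpredT) //=.
by apply: eq_bigr => i _; apply: eq_bigl => k; rewrite inE.
Qed.

Lemma prod_fibre t (phi : {ffun 'I_l -> 'I_m.+1}) : \prod_k t 0 (phi k) = mono
  (fibre_type phi) t.
Proof.
rewrite (partition_big phi xpredT) //=; apply: eq_bigr => i _.
rewrite tnth_fibre_type /fibre_card -sum1_card -prodrXr; apply: eq_big => k;
  first by rewrite inE.
by move=> /eqP ->; rewrite expr1.
Qed.

Definition multinom_coef tau := #|[set phi | fibre_type phi == tau]|.

(** A word with the letter i repeated tau_i times has the prescribed fibres. *)
Lemma multinom_coef_gt0 tau : tau \in exponents -> (0 < multinom_coef tau)%N.
Proof.
rewrite inE sum_tuple => /eqP htau.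
pose s := flatten [seq nseq (tnth tau i) i | i <- index_enum 'I_m.+1].
have szs : size s = l.
  rewrite -htau /s size_flatten sumnE !big_map; apply: eq_bigr => i _;
    exact: size_nseq.
apply/card_gt0P; exists [ffun k : 'I_l => nth ord0 s k]; rewrite inE; apply/eqP.
apply: eq_from_tnth => i; apply: ord_inj; rewrite tnth_fibre_type /fibre_card
  -sum1_card.
under eq_bigl => k do rewrite inE ffunE.
transitivity (\sum_(0 <= k < size s | nth ord0 s k == i) 1)%N.
  by rewrite szs big_mkord.
rewrite -(big_nth ord0 (fun j => j == i) (fun=> 1%N)) sum1_count /s count_flatten
  sumnE !big_map.
rewrite (bigD1 i) //= big1 ?addn0 => [|j /negPf ji]; rewrite count_nseq /=.
  by rewrite eqxx mul1n.
by rewrite ji.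
Qed.

(** The multinomial theorem, obtained by expanding the product of l equal sums
    and grouping the maps phi by the cardinals of their fibres. *)
Lemma multinomial z t : (\sum_i z 0 i * t 0 i) ^+ l =
  \sum_(tau in exponents) (multinom_coef tau)%:R * (mono tau z * mono tau t).
Proof.
rewrite -[in LHS](card_ord l) -prodr_const (bigA_distr_bigA (fun (k : 'I_l) i => z
  0 i * t 0 i)).
rewrite (partition_big fibre_type (mem exponents)) /= => [|phi _];
  last exact: fibre_type_exponents.
apply: eq_bigr => tau _; rewrite /multinom_coef -sum1_card natr_sum mulr_suml.
apply: eq_big => phi; first by rewrite inE.
by move=> /eqP <-; rewrite big_split /= !prod_fibre mul1r.
Qed.

End Monomials.

(** * Words with a nonsingular matrix of pairings *)

Section Words.
Variables (m l : nat).
Implicit Types (t z v : 'rV[rat]_m.+1) (f g : 'rV[rat]_m.+1 -> rat).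

Lemma line_poly_cst c : line_poly (fun _ : 'rV[rat]_m.+1 => c).
Proof. by move=> t v; exists c%:P => d; rewrite hornerC. Qed.

Lemma line_polyM f g : line_poly f -> line_poly g -> line_poly (fun t => f t * g t).
Proof.
move=> hf hg t v; have [p hp] := hf t v; have [r hr] := hg t v.
by exists (p * r) => c; rewrite hornerM hp hr.
Qed.

Lemma line_polyX f k : line_poly f -> line_poly (fun t => f t ^+ k).
Proof.
move=> hf t v; have [p hp] := hf t v.
by exists (p ^+ k) => c; rewrite horner_exp hp.
Qed.

Lemma line_poly_sum (I : finType) (F : I -> 'rV[rat]_m.+1 -> rat) :
  (forall i, line_poly (F i)) -> line_poly (fun t => \sum_i F i t).
Proof.
move=> hF t v.
pose p i := projT1 (cid (hF i t v)); have hp i := projT2 (cid (hF i t v)).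
by exists (\sum_i p i) => c; rewrite horner_sum; apply: eq_bigr => i _; apply: hp.
Qed.

Lemma line_poly_prod (I : finType) (F : I -> 'rV[rat]_m.+1 -> rat) :
  (forall i, line_poly (F i)) -> line_poly (fun t => \prod_i F i t).
Proof.
move=> hF t v.
pose p i := projT1 (cid (hF i t v)); have hp i := projT2 (cid (hF i t v)).
by exists (\prod_i p i) => c; rewrite horner_prod; apply: eq_bigr => i _; apply: hp.
Qed.

Lemma line_poly_lin (w : 'cV[rat]_m.+1) : line_poly (fun t => (t *m w) 0 0).
Proof.
move=> t v; exists (((t *m w) 0 0)%:P + ((v *m w) 0 0) *: 'X) => c.
by rewrite hornerD hornerC hornerZ hornerX mulmxDl -scalemxAl mxE [X in _ + X]mxE
  mulrC.
Qed.

Lemma line_poly_mono tau : line_poly (@mono m l tau).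
Proof.
apply: line_poly_prod => i; apply: line_polyX => t v.
by exists ((t 0 i)%:P + (v 0 i) *: 'X) => c; rewrite !mxE !hornerE mulrC.
Qed.

Let A := @exponents m l.

Lemma mono_indep_col (c : 'cV[rat]_#|A|) :
  (forall t, \sum_j mono (enum_val j) t * c j 0 = 0) -> c = 0.
Proof.
move=> hc; (* The coefficient of tau; the sum has one term. *)
pose c' tau := \sum_(j | enum_val j == tau) c j 0.
have c'E j : c' (enum_val j) = c j 0.
  by rewrite /c' (eq_bigl (pred1 j)) ?big_pred1_eq // => i;
    rewrite /= (inj_eq enum_val_inj).
apply/colP=> j; rewrite mxE -c'E; apply: (@mono_indep m l c');
  last exact: enum_valP.
move=> t; rewrite -[RHS](hc t) -/A big_enum_val /=.
by apply: eq_bigr => i _; rewrite c'E mulrC.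
Qed.

(** Words g_j at which the monomials of degree l are independent exist by density
    of the orbit.  For these, the functions t -> (t gram t_j^T)^l are independent:
    as the form is nondegenerate, a relation between them is one between l-th
    powers of linear forms, so by [multinomial] one between the monomials at the g_j.
    Density then provides the words h_i. *)
Lemma gram_words : exists g h : 'I_#|A| -> seq 'I_m.+1,
  \matrix_(i, j) ((coord_word (h i) (coord0 m) *m gram m *m (coord_word (g j)
    (coord0 m))^T) 0 0) ^+ l
    \in unitmx.
Proof.
have [|g Hunit] := @select_unitmx rat (seq 'I_m.+1) #|A|
    (fun w => \row_j mono (enum_val j) (coord_word w (coord0 m))).
  move=> c hc; apply: mono_indep_col; apply: closure_all.
    by apply: line_poly_sum => j; apply: line_polyM;
      [apply: line_poly_mono | apply: line_poly_cst].
  move=> w; have /matrixP/(_ 0 0) := hc w; rewrite mxE [RHS]mxE => E;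
    rewrite -[RHS]E.
  by apply: eq_bigr => j _; rewrite [in RHS]mxE.
pose T j := coord_word (g j) (coord0 m).
have [|h hunit] := @select_unitmx rat (seq 'I_m.+1) #|A|
    (fun w => \row_j ((coord_word w (coord0 m) *m gram m *m (T j)^T) 0 0) ^+ l);
      last first.
  exists g, h; move: hunit; congr (_ \in unitmx).
  by apply/matrixP=> i j; rewrite !mxE.
move=> c hc.
have h1 t : \sum_j ((t *m gram m *m (T j)^T) 0 0) ^+ l * c j 0 = 0.
  move: t; apply: closure_all => [|w].
    apply: line_poly_sum => j; apply: line_polyM; last exact: line_poly_cst.
    apply: line_polyX => t v; have [p hp] := line_poly_lin (gram m *m (T j)^T) t v.
    by exists p => d; rewrite -hp mulmxA.
  have /matrixP/(_ 0 0) := hc w; rewrite mxE [RHS]mxE => E; rewrite -[RHS]E.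
  by apply: eq_bigr => j _; rewrite [in RHS]mxE.
have h2 z : \sum_j (\sum_i z 0 i * T j 0 i) ^+ l * c j 0 = 0.
  rewrite -[RHS](h1 (z *m invmx (gram m))); apply: eq_bigr => j _.
  rewrite mulmxKV ?gram_unit // mxE; congr (_ ^+ _ * _).
  by apply: eq_bigr => i _; rewrite mxE.
have h3 z : \sum_(tau in A) ((multinom_coef tau)%:R * \sum_j mono tau (T j) * c j
  0) * mono tau z = 0.
  rewrite -[RHS](h2 z).
  under [RHS]eq_bigr => j _ do rewrite multinomial mulr_suml.
  rewrite exchange_big /=; apply: eq_bigr => tau _.
  rewrite mulr_sumr mulr_suml; apply: eq_bigr => j _.
  by move: (mono tau z) (_%:R) (c j 0) => x y d; ring.
have h4 tau : tau \in A -> \sum_j mono tau (T j) * c j 0 = 0.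
  move=> tauA; have /eqP := mono_indep h3 tauA.
  rewrite mulf_eq0 => /orP[|/eqP //].
  by rewrite Num.Theory.pnatr_eq0 => /eqP E; have := multinom_coef_gt0 tauA;
    rewrite E.
set H := \matrix_i _ in Hunit.
have HTc : H^T *m c = 0.
  apply/colP=> k; rewrite !mxE -[RHS](h4 (enum_val k)) ?enum_valP //.
  by apply: eq_bigr => j _; rewrite !mxE.
by rewrite -(mulKmx (_ : H^T \in unitmx) c) ?unitmx_tr // HTc mulmx0.
Qed.

End Words.

(** * The matrices of the generators *)

Definition eig_s : KK := - (s^-1 ^+ 2).

Lemma val_lamL k : val (lamL k) = eig_s ^+ k * q ^+ (k * (k - 1)).
Proof.
rewrite /lamL /topcoef !valLM !valLX valLV ?sL_unit // muln0 add0n mulrA;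
  congr (_ * _).
have -> : val (-1 : LL) = -1 by exact: rmorphN1.
by rewrite -!exprMn /eig_s mulN1r mulrN.
Qed.

Definition qs_monomial a b c : {poly {poly rat}} := ((-1) ^+ a * 'X^b)%:P * 'X^c.

Lemma tofrac_qs_monomial a b c : tofrac (qs_monomial a b c) = (-1) ^+ a * q ^+ b *
  s ^+ c.
Proof.
by rewrite /qs_monomial polyCM !polyC_exp !tofracM !tofracXn polyCN tofracN polyC1
  tofrac1.
Qed.

Lemma qs_monomial_size a b c : size (qs_monomial a b c) = c.+1 /\ lead_coef
  (qs_monomial a b c) = (-1) ^+ a * 'X^b.
Proof.
have l0 : lead_coef (((-1) ^+ a * 'X^b : {poly rat})%:P * 'X^c) = (-1) ^+ a * 'X^b.
  by rewrite lead_coefM lead_coefXn mulr1 lead_coefC.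
have n0 : ((-1) ^+ a * 'X^b : {poly rat}) != 0.
  by rewrite mulf_neq0 ?signr_eq0 ?expf_neq0 ?polyX_eq0.
by split=> //; rewrite /qs_monomial size_mulXn ?polyC_eq0 // size_polyC n0 addn1.
Qed.

(** After clearing the powers of s^-1, compare the degrees in s, then in q; the
    sign is determined by a. *)
Lemma eig_s_indep a b a' b' : eig_s ^+ a * q ^+ b = eig_s ^+ a' * q ^+ b' -> a = a'
  /\ b = b'.
Proof.
move=> E.
have eE k : eig_s ^+ k * s ^+ (2 * k) = (-1) ^+ k.
  rewrite exprM -exprMn; congr (_ ^+ _).
  by rewrite /eig_s mulNr -exprMn mulVf ?expr1n //; exact: s_neq0.
have : qs_monomial a b (2 * a') = qs_monomial a' b' (2 * a).
  apply/eqP; rewrite -tofrac_eq !tofrac_qs_monomial -!eE; apply/eqP.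
  have AC (x y t z : KK) : x * t * y * z = x * y * (t * z).
    by rewrite -!mulrA; congr (_ * _); rewrite mulrCA.
  by rewrite !AC E [s ^+ _ * _]mulrC.
move=> kE; have [sz1 lc1] := qs_monomial_size a b (2 * a');
  have [sz2 lc2] := qs_monomial_size a' b' (2 * a).
have aa : a = a'.
  have := congr1 (fun p : {poly {poly rat}} => size p) kE.
  by rewrite sz1 sz2 => -[] /eqP; rewrite eqn_pmul2l // => /eqP ->.
split=> //; move: lc1; rewrite kE lc2 aa => /mulfI => H.
have /H : (-1) ^+ a' != 0 :> {poly rat} by rewrite signr_eq0.
move=> /(congr1 (fun p : {poly rat} => size p)); rewrite !size_polyXn => -[];
  exact: esym.
Qed.

Section BasisMatrices.
Variables (n l N : nat) (b : 'I_N -> Vtens n).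
Hypothesis b_basis : is_basis_of (Wspace (n := n) l) b.
Variable A : 'I_n.-1 -> 'M[LL]_N.
Hypothesis AE : forall i j, Rop i (b j) = \sum_k A i k j *: b k.

(** The vector with given coordinates in the basis b. *)
Definition beta (c : 'cV[LL]_N) : Vtens n := \sum_j c j 0 *: b j.

Lemma beta_lin t c d : beta (t *: c + d) = t *: beta c + beta d.
Proof.
rewrite /beta scaler_sumr -big_split; apply: eq_bigr => j _.
by rewrite !mxE scalerDl scalerA.
Qed.

Lemma betaZ t c : beta (t *: c) = t *: beta c.
Proof.
by rewrite /beta scaler_sumr; apply: eq_bigr => j _; rewrite !mxE scalerA.
Qed.

Lemma betaB c d : beta (c - d) = beta c - beta d.
Proof.
by rewrite (_ : c - d = -1 *: d + c) ?beta_lin ?scaleN1r addrC.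
Qed.

Lemma beta0 : beta 0 = 0.
Proof. by rewrite /beta big1 // => j _; rewrite mxE scale0r. Qed.

Lemma Wspace0 : Wspace l (0 : Vtens n).
Proof.
split; first by rewrite /Eop /lin_ext msupp0 big_nil.
by move=> a; rewrite msupp0.
Qed.

Lemma beta_inj c d : beta c = beta d -> c = d.
Proof.
move=> E; apply/eqP; rewrite -subr_eq0; apply/eqP.
have [e [_ euniq]] := (proj2 b_basis) 0 Wspace0.
have h1 : e = 0 by apply: euniq; rewrite big1 // => j _; rewrite mxE scale0r.
have h2 : e = (c - d)^T.
  apply: euniq; have H : beta (c - d) = 0 by rewrite betaB E subrr.
  by rewrite -[LHS]H; apply: eq_bigr => j _; rewrite [_^T _ _]mxE.
by apply: trmx_inj; rewrite -h2 h1 trmx0.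
Qed.

Lemma beta_surj x : Wspace l x -> exists c, x = beta c.
Proof.
move=> /(proj2 b_basis)[c [xc _]]; exists c^T; rewrite xc.
by apply: eq_bigr => j _; rewrite mxE.
Qed.

Lemma beta_weight c : Vweight l (beta c).
Proof.
move=> a; rewrite -mcoeff_neq0 => ac; apply: contraNeq ac => al.
rewrite /beta raddf_sum /= big1 // => j _; rewrite mcoeffZ.
have [_ /weight_coeff -> //] := (proj1 b_basis) j; by rewrite mulr0.
Qed.

Lemma Rop0 i : Rop i (0 : Vtens n) = 0.
Proof. by rewrite /Rop /lin_ext msupp0 big_nil. Qed.

Lemma Rop_beta i c : Rop i (beta c) = beta (A i *m c).
Proof.
have -> : Rop i (beta c) = \sum_j c j 0 *: Rop i (b j).
  rewrite /beta; elim/big_rec2: _ => [|j x y _ <-]; first exact: Rop0.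
  by rewrite Rop_lin.
under eq_bigr => j _ do rewrite AE scaler_sumr.
rewrite exchange_big; apply: eq_bigr => k _ /=.
rewrite mxE scaler_suml; apply: eq_bigr => j _.
by rewrite scalerA mulrC.
Qed.

Lemma opprod_beta i k c : opprod i k (beta c) = beta (mprod (A i) lamL k *m c).
Proof.
elim: k => [|k IH] /=; first by rewrite mul1mx.
by rewrite IH Rop_beta -betaZ -betaB mulmxBl -scalemxAl mulmxA.
Qed.

Lemma opword_beta g c : opword g (beta c) = beta (mword A g *m c).
Proof.
elim: g => [|i g IH] /=; first by rewrite mul1mx.
by rewrite IH Rop_beta mulmxA.
Qed.

Lemma mulmx_col_ext (M M' : 'M[LL]_N) : (forall c : 'cV_N, M *m c = M' *m c) -> M =
  M'.
Proof.
move=> H; apply/matrixP=> i j; have /colP/(_ i) := H (delta_mx j 0).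
by rewrite -!colE !mxE.
Qed.

Lemma gen_minpoly i : mprod (A i) lamL l.+1 = 0.
Proof.
apply: mulmx_col_ext => c; rewrite mul0mx; apply: beta_inj.
by rewrite -opprod_beta beta0 opprod_kill //; apply: beta_weight.
Qed.

(** The coordinate of c along the top eigenvector, up to the factor by which the
    product of the Rop i - lamL j multiplies this vector. *)
Definition topfun i (c : 'cV[LL]_N) : LL := mcoeff (topidx i l) (opprod i l (beta
  c)).

Definition toprow i : 'rV[LL]_N := \row_j topfun i (delta_mx j 0).

Lemma toprowE i c : (toprow i *m c) 0 0 = topfun i c.
Proof.
rewrite /topfun opprod_beta mxE.
have -> : mprod (A i) lamL l *m c = \sum_j c j 0 *: (mprod (A i) lamL l *m delta_mx
  j 0).
  apply/colP=> k; rewrite summxE mxE; apply: eq_bigr => j _.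
  by rewrite -colE !mxE mulrC.
have -> : forall (F : 'I_N -> 'cV[LL]_N), beta (\sum_j c j 0 *: F j) = \sum_j c j 0
  *: beta (F j).
  move=> F; elim/big_rec2: _ => [|j x y _ <-]; first exact: beta0.
  by rewrite beta_lin.
rewrite raddf_sum /=; apply: eq_bigr => j _.
by rewrite mcoeffZ mxE /topfun opprod_beta mulrC.
Qed.

Lemma gen_rank1 i w : topvec i l = beta w -> mprod (A i) lamL l = w *m toprow i.
Proof.
move=> wE; apply: mulmx_col_ext => c; apply: beta_inj.
rewrite -opprod_beta opprod_top; last exact: beta_weight.
rewrite -/(topfun i c) wE -betaZ -toprowE; congr beta.
by rewrite -mulmxA {2}(mx11_scalar (toprow i *m c)) mul_mx_scalar.
Qed.

(** [models_word] follows the top vector through the word, and [spec_opprod]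
    evaluates its top coordinate. *)
Lemma spec_topfun i w g : topvec i l = beta w ->
  spec ((toprow i *m (mword A g *m w)) 0 0) =
  topcst l * coroot i (burau_word g (rootvec i)) ^+ l.
Proof.
move=> wE; rewrite toprowE /topfun -opword_beta -wE.
by apply: spec_opprod; apply: models_word; apply: models_topvec.
Qed.

Lemma mword_cat g h : mword A (g ++ h) = mword A g *m mword A h.
Proof. by elim: g => [|i g IH] /=; rewrite ?mul1mx // IH mulmxA. Qed.

End BasisMatrices.

Lemma map_mprod (R R' : comNzRingType) (f : {rmorphism R -> R'}) N (A : 'M[R]_N)
  lam k :
  map_mx f (mprod A lam k) = mprod (map_mx f A) (f \o lam) k.
Proof.
elim: k => [|k IH] /=; first by rewrite map_mx1.
by rewrite map_mxB map_mxM map_mxZ IH.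
Qed.

Lemma map_mword (R R' : comNzRingType) (f : {rmorphism R -> R'}) N (I : Type) (A :
  I -> 'M[R]_N) g :
  map_mx f (mword A g) = mword (fun i => map_mx f (A i)) g.
Proof. by elim: g => [|i g IH] /=; rewrite ?map_mx1 // map_mxM IH. Qed.

(** The word h, moved to the other side of the form, is reversed. *)
Lemma word_pairing m l N (b : 'I_N -> Vtens m.+2) (A : 'I_m.+1 -> 'M[LL]_N) w :
  (forall (i : 'I_m.+2.-1) j, Rop i (b j) = \sum_k A i k j *: b k) ->
  @topvec m.+2 (0 : 'I_m.+1) l = beta b w ->
  forall g h : seq 'I_m.+1,
  spec ((@toprow m.+2 l N b (0 : 'I_m.+1) *m mword A (rev h) *m (mword A g *m w)) 0
    0) =
  topcst l * ((coord_word h (coord0 m) *m gram m *m (coord_word g (coord0 m))^T) 0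
    0) ^+ l.
Proof.
move=> AE wE g h.
have := @spec_topfun m.+2 l N b A AE 0 w (rev h ++ g) wE.
rewrite mword_cat !mulmxA => ->; congr (_ * _ ^+ _).
rewrite -[rootvec _]/(rootv 0) -yvec_coord0 -yvec_coord_word -[coroot _ _]/(corootv
  0 _) corootv_yvec.
have -> (x : 'rV[rat]_m.+1) : (x *m gram m) 0 0 = (x *m gram m *m (coord0 m)^T) 0 0.
  by rewrite trmx_delta -colE [RHS]mxE.
rewrite /coord_word foldr_cat -/(coord_word g _) -/(coord_word (rev h) _)
  coord_word_gram.
transitivity ((coord_word h (coord0 m) *m gram m *m (coord_word g (coord0 m))^T)^T
  0 0); last by rewrite mxE.
by rewrite !trmx_mul trmxK gram_sym mulmxA.
Qed.

(** * Density of the image of the braid group *)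

Lemma gram_words_card m l N : N = 'C(m.+2 + l - 2, l) ->
  exists g h : 'I_N -> seq 'I_m.+1,
  \matrix_(i, j) ((coord_word (h i) (coord0 m) *m gram m *m (coord_word (g j)
    (coord0 m))^T) 0 0) ^+ l
    \in unitmx.
Proof.
have -> : (m.+2 + l - 2 = m + l)%N by lia.
rewrite -(bin_sub (leq_addl m l)) addnK -card_exponents => ->.
exact: gram_words.
Qed.

Section BraidConjugacy.
Variable n : nat.

Lemma sigma_braid (i j : 'I_n.-1) : j = i.+1 :> nat ->
  (sigma i * sigma j * sigma i = sigma j * sigma i * sigma j)%g.
Proof.
move=> ij.
have mulwE (x y : braid_word n) : (braid_of_word x * braid_of_word y)%g =
  braid_of_word (x ++ y).
  by apply/braid_eq; apply: braid_cong_cat; apply: braid_repr.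
rewrite /sigma !mulwE -!catA; apply/braid_eq.
have := braid_ctx [::] [::] (braid_yb ij); by rewrite !cats0.
Qed.

(** The braid relation says that sigma_(i+1) is the conjugate of sigma_i by
    sigma_i sigma_(i+1). *)
Lemma sigma_conj (i0 i : 'I_n.-1) : i0 = 0%N :> nat ->
  exists g : braid n, sigma i = (g * sigma i0 * g^-1)%g.
Proof.
move=> i00; case: i => k; elim: k => [|k IH] kn.
  exists 1%g; rewrite invg1 mulg1 mul1g; congr sigma; exact: val_inj.
have [g E] := IH (ltnW kn).
have := @sigma_braid (Ordinal (ltnW kn)) (Ordinal kn) (erefl _).
set si := sigma (Ordinal (ltnW kn)) in E *; set sj := sigma (Ordinal kn) => Y.
exists (si * sj * g)%g.
have -> : (si * sj * g * sigma i0 * (si * sj * g)^-1 = si * sj * si * (si *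
  sj)^-1)%g.
  by rewrite [X in (_ = _ * X * _)%g]E !invgM !mulgA.
by rewrite Y -(mulgA sj) mulgK.
Qed.

End BraidConjugacy.

Theorem theorem7p2 (n l : nat) (n_ge2 : (2 <= n)%N)
    (Kbar : closedFieldType) (iota : {rmorphism KK -> Kbar})
    (iota_alg : forall x : Kbar, algebraicOver iota x)
    (b : 'I_('C(n + l - 2, l)) -> Vtens n)
    (b_basis : is_basis_of (Wspace (n := n) l) b)
    (rho : monoid.UMagmaMorphism.type (braid n) (GL LL 'C(n + l - 2, l)))
    (rho_sigma : forall (i : 'I_n.-1) (j : 'I_('C(n + l - 2, l))),
       Rop i (b j) = \sum_k GLmat (rho (sigma i)) k j *: b k) :
  zariski_dense (fun x : PGL Kbar 'C(n + l - 2, l) =>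
    exists g : braid n, x = to_PGL (GL_map (iota \o val) (rho g))).
Proof.
case: n n_ge2 b b_basis rho rho_sigma => [|[|m]] // _.
move N_def: 'C(m.+2 + l - 2, l) => N b b_basis rho rho_sigma.
pose f : {rmorphism LL -> Kbar} := iota \o val.
pose A (i : 'I_m.+1) : 'M[LL]_N := GLmat (rho (sigma (i : 'I_m.+2.-1))).
pose Gam (X : 'M[Kbar]_N) := exists g : braid m.+2, X = map_mx f (GLmat (rho g)).
have rhoM g h : GLmat (rho (g * h)%g) = GLmat (rho g) *m GLmat (rho h) by rewrite
  gmulfM.
have rho1 : GLmat (rho 1%g) = 1%:M by rewrite gmulf1.
have Gam1 : Gam 1%:M by exists 1%g; rewrite rho1 map_mx1.
have GamM X Y : Gam X -> Gam Y -> Gam (X *m Y).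
  by move=> [g ->] [h ->]; exists (g * h)%g; rewrite rhoM map_mxM.
have GamV X : Gam X -> exists2 Y, Gam Y & X *m Y = 1%:M /\ Y *m X = 1%:M.
  move=> [g ->]; exists (map_mx f (GLmat (rho g^-1%g))); first by exists g^-1%g.
  by rewrite -!map_mxM -!rhoM mulgV mulVg rho1 map_mx1.
have char0 k : k.+1%:R != 0 :> Kbar.
  rewrite -(rmorph_nat iota) fmorph_eq0 -(rmorph_nat (@tofrac _)) tofrac_eq0.
  by rewrite -!polyC_natr !polyC_eq0 Num.Theory.pnatr_eq0.
pose sig i := map_mx f (A i).
have Gam_sig i : Gam (sig i) by exists (sigma (i : 'I_m.+2.-1)).
have sig_conj i : exists X Y, [/\ Gam X, Gam Y, X *m Y = 1%:M & sig i = X *m sig 0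
  *m Y].
  have [g E] := @sigma_conj m.+2 (0 : 'I_m.+1) i (erefl _).
  exists (map_mx f (GLmat (rho g))), (map_mx f (GLmat (rho g^-1%g))).
  split; [by exists g | by exists g^-1%g | | ].
    by rewrite -map_mxM -rhoM mulgV rho1 map_mx1.
  by rewrite -!map_mxM -!rhoM -E.
have indep a c a' c' : iota eig_s ^+ a * iota q ^+ c = iota eig_s ^+ a' * iota q ^+
  c' ->
    a = a' /\ c = c'.
  move=> E; apply: eig_s_indep; apply: (fmorph_inj iota).
  by rewrite !rmorphM !rmorphXn.
have lamE : f \o lamL = fun k => iota eig_s ^+ k * iota q ^+ (k * (k - 1)).
  by apply/funext=> k; rewrite -[LHS]/(iota (val (lamL k))) val_lamL rmorphM
    !rmorphXn.
have [w wE] := beta_surj b_basis (@topvec_W m.+2 (0 : 'I_m.+1) l).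
have AE (i : 'I_m.+2.-1) j : Rop i (b j) = \sum_k A i k j *: b k by apply:
  rho_sigma.
have [g [h unit_gh]] := gram_words_card (esym N_def).
pose phi := @toprow m.+2 l N b (0 : 'I_m.+1).
have sig_minpoly : mprod (sig 0) (fun k => iota eig_s ^+ k * iota q ^+ (k * (k -
  1))) l.+1 = 0.
  by rewrite -lamE -map_mprod (gen_minpoly b_basis AE) map_mx0.
have sig_rank1 : mprod (sig 0) (fun k => iota eig_s ^+ k * iota q ^+ (k * (k - 1)))
  l =
    map_mx f w *m map_mx f phi.
  by rewrite -lamE -map_mprod (gen_rank1 b_basis AE wE) map_mxM.
have words_unit : \matrix_(i, j) (map_mx f phi *m mword sig (rev (h i)) *m
    (mword sig (g j) *m map_mx f w)) 0 0 \in unitmx.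
  pose M : 'M[LL]_N := \matrix_(i, j) (phi *m mword A (rev (h i)) *m (mword A (g j)
    *m w)) 0 0.
  have -> : \matrix_(i, j) (map_mx f phi *m mword sig (rev (h i)) *m
    (mword sig (g j) *m map_mx f w)) 0 0 = map_mx f M.
    by apply/matrixP=> i j; rewrite mxE [RHS]mxE [in RHS]mxE /sig -!map_mword
      -!map_mxM mxE.
  rewrite unitmxE unitfE det_map_mx /= fmorph_eq0.
  apply/eqP => detM0; have detM : \det M = 0 by apply: LL_inj.
  have : spec (\det M) = 0 by rewrite detM raddf0.
  rewrite -(det_map_mx spec).
  have -> : map_mx spec M = topcst l *: \matrix_(i, j)
     ((coord_word (h i) (coord0 m) *m gram m *m (coord_word (g j) (coord0 m))^T) 0
       0) ^+ l.
    by apply/matrixP=> i j; rewrite mxE [M i j]mxE (word_pairing AE wE) [RHS]mxE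
      [in RHS]mxE.
  rewrite detZ => /eqP; rewrite mulf_eq0 expf_eq0 (negPf (topcst_neq0 l)) andbF /=.
  by apply/negP; rewrite -unitfE -unitmxE.
have full := tspan_full Gam1 GamM GamV char0 Gam_sig sig_conj indep sig_minpoly
  sig_rank1 words_unit.
move=> Z [P [Phom PZ]] sub x.
rewrite -[x]reprK -/(to_PGL (repr x)); apply/PZ => p Pp.
have [d pd] := Phom p Pp.
apply: (homog_vanish (Gam := Gam) pd); last exact: full.
move=> _ [y ->].
by have /PZ/(_ p Pp) := sub _ (ex_intro _ y (erefl _)).
Qed.
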